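(* Let $q\in H^{-1}_{unif}(\mathbb{R})$ be a (complex-valued) distribution. Then the operators $\mathrm{S}_0(q)$, $\mathrm{S}(q)$, $\mathrm{S}_{fs}(q)$ and $\mathrm{S}_F(q)$ in $L^2(\mathbb{R})$ are $m$-sectorial and coincide: $\mathrm{S}_0(q)=\mathrm{S}(q)=\mathrm{S}_{fs}(q)=\mathrm{S}_F(q)$.
   Context: All functions are complex-valued; $(f,g)_{L^2(\mathbb{R})}=\int_{\mathbb{R}} f\overline{g}\,dx$. For $1\le p<\infty$ the Stepanov space $L^p_{unif}(\mathbb{R})$ consists of $f\in L^p_{loc}(\mathbb{R})$ with $\|f\|_{L^p_{unif}(\mathbb{R})}^p:=\sup_{t\in\mathbb{R}}\int_t^{t+1}|f(s)|^p\,ds<\infty$. $H^{-1}_{unif}(\mathbb{R})$ is the space of distributions $q$ on $\mathbb{R}$ that can be represented (not uniquely) as $q=Q'+\tau$ (distributional derivative) with $Q\in L^2_{unif}(\mathbb{R})$, $\tau\in L^1_{unif}(\mathbb{R})$. Fix such a representation (the operators below do not depend on its choice). $\mathrm{AC}_{loc}(\mathbb{R})$ is the space of locally absolutely continuous functions. For $y$ with $y,\ y'-Qy\in \mathrm{AC}_{loc}(\mathbb{R})$ put $l[y]:=-(y'-Qy)'-Qy'+\tau y$. Maximal operator: $\mathrm{S}(q)y=l[y]$, $\mathrm{Dom}(\mathrm{S}(q))=\{y\in L^2(\mathbb{R}) : y,\ y'-Qy\in\mathrm{AC}_{loc}(\mathbb{R}),\ l[y]\in L^2(\mathbb{R})\}$.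 Preminimal operator $\mathrm{S}_{00}(q)$: the restriction of $\mathrm{S}(q)$ to the functions in $\mathrm{Dom}(\mathrm{S}(q))$ with compact support. Minimal operator: $\mathrm{S}_0(q)$ is the closure of $\mathrm{S}_{00}(q)$. Form-sum: $\mathrm{S}_{fs}(q)$ is the operator associated, by Kato's First Representation Theorem, with the densely defined closed sectorial form on $H^1(\mathbb{R})$ $$t[u,v]=(u',v')_{L^2(\mathbb{R})}-\int_{\mathbb{R}}Q\,(u'\overline{v}+u\overline{v}')\,dx+\int_{\mathbb{R}}\tau u\overline{v}\,dx .$$ $\mathrm{S}_F(q)$ is the Friedrichs extension of $\mathrm{S}_0(q)$ (equivalently of $\mathrm{S}_{00}(q)$), i.e. the operator associated with the closure of the sectorial form $(\mathrm{S}_{00}(q)u,v)_{L^2(\mathbb{R})}$, $u,v\in\mathrm{Dom}(\mathrm{S}_{00}(q))$. An operator is $m$-sectorial (Kato) if its numerical range lies in a sector $\{\lambda:|\arg(\lambda-\gamma)|\le\theta\}$ with $\gamma\in\mathbb{R}$, $0\le\theta<\pi/2$, and it is quasi-$m$-accretive (i.e. $T+c$ is $m$-accretive for some real $c$). *)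

(* Defs.v *)
From HB Require Import structures.
From mathcomp Require Import all_boot all_order all_algebra.
From mathcomp Require Import complex.
From mathcomp Require Import all_classical all_reals all_analysis.
Set Implicit Arguments.
Unset Strict Implicit.
Unset Printing Implicit Defensive.
Import Order.TTheory GRing.Theory Num.Theory.
Import numFieldNormedType.Exports.
Local Open Scope classical_set_scope.
Local Open Scope ring_scope.
Local Open Scope complex_scope.

(* Elements of function spaces defined up to null sets
   (L^p_loc, L^2, H^1) are represented by Borel functions R -> R[i], and every
   notion below about such elements is invariant under a.e. equality.  An
   operator in L^2(R) is its graph, a set of pairs of functions which is itself
   invariant under a.e. equality; equality of operators is thus equality of
   these sets.                                                                *)

Notation normc := ComplexField.Normc.normc.

Section ComplexFunctions.
Context {R : realType}.
Local Notation mu := (@lebesgue_measure R).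
Implicit Types (f g u v : R -> R[i]) (p : R).

Definition cmeasurable f :=
  measurable_fun [set: R] (fun x => complex.Re (f x)) /\
  measurable_fun [set: R] (fun x => complex.Im (f x)).

Definition cintegral f : R[i] :=
  (\int[mu]_x complex.Re (f x)) +i* (\int[mu]_x complex.Im (f x)).

Definition aeeq f g := {ae mu, forall x, f x = g x}.

(* The value is meaningful only where f is differentiable. *)
Definition cderive f : R -> R[i] :=
  fun x => derive1 (fun t => complex.Re (f t)) x
        +i* derive1 (fun t => complex.Im (f t)) x.

Definition AC_on (a b : R) f :=
  forall e : R, 0 < e -> exists2 d : R, 0 < d &
  forall (n : nat) (s t : 'I_n -> R),
    (forall i, a <= s i /\ s i <= t i /\ t i <= b) ->
    trivIset [set: 'I_n] (fun i => `]s i, t i[%classic) ->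
    \sum_(i < n) (t i - s i) < d ->
    \sum_(i < n) normc (f (t i) - f (s i)) < e.

Definition AC_loc f := forall a b : R, a <= b -> AC_on a b f.

Definition Lp_loc p f :=
  cmeasurable f /\ locally_integrable [set: R] (fun x => normc (f x) `^ p).

Definition Lp_unif p f :=
  Lp_loc p f /\
  (ereal_sup (range (fun t : R =>
     \int[mu]_(s in `[t, (t + 1)%R]) (normc (f s) `^ p)%:E)) < +oo)%E.

Definition L2norm f : \bar R :=
  Lnorm mu 2%:E (fun x => (normc (f x))%:E).

Definition L2 f := cmeasurable f /\ (L2norm f < +oo)%E.

Definition inner f g : R[i] := cintegral (fun x => f x * (g x)^*).

Definition cvgL2 (f_ : nat -> R -> R[i]) f :=
  L2norm (fun x => f_ n x - f x) @[n --> \oo] --> 0%E.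

End ComplexFunctions.

Section Distributions.
Context {R : realType}.
Implicit Types (phi psi u g Q tau : R -> R[i]).

Definition smooth phi := forall (n : nat) (x : R),
  derivable (derive1n n (fun t => complex.Re (phi t))) x 1 /\
  derivable (derive1n n (fun t => complex.Im (phi t))) x 1.

Definition test_function phi :=
  smooth phi /\ compact (closure [set x | phi x != 0]).

(* Only the values on test functions are constrained or used. *)
Record schwartz_distribution := Distribution {
  dist_app :> (R -> R[i]) -> R[i];
  dist_linear : forall (a : R[i]) phi psi,
    test_function phi -> test_function psi ->
    dist_app (fun x => a * phi x + psi x) = a * dist_app phi + dist_app psi;
  dist_continuous : forall K : set R, compact K ->
    exists (c : R) (N : nat), forall phi, test_function phi ->
    (forall x, ~ K x -> phi x = 0) ->
    normc (dist_app phi) <=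
      c * \sum_(k < N.+1) sup (range (fun x => normc (iter k cderive phi x))) }.

(* q = Q' + tau with Q in L^2_unif and tau in L^1_unif. *)
Definition Hm1_representation (q : schwartz_distribution) Q tau :=
  [/\ Lp_unif 2 Q, Lp_unif 1 tau &
   forall phi, test_function phi ->
     q phi = - cintegral (fun x => Q x * cderive phi x)
             + cintegral (fun x => tau x * phi x)].

Definition Hm1_unif (q : schwartz_distribution) :=
  exists Q tau, Hm1_representation q Q tau.

Definition weak_derivative u g := forall phi, test_function phi ->
  cintegral (fun x => u x * cderive phi x) =
  - cintegral (fun x => g x * phi x).

Definition H1 u := L2 u /\ exists2 g, L2 g & weak_derivative u g.

(* The distributional derivative of u in H^1 (as an element of L^2). *)
Definition wderiv u : R -> R[i] :=
  xget (fun=> 0) [set g | L2 g /\ weak_derivative u g].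

End Distributions.

Section Operators.
Context {R : realType}.
Local Notation mu := (@lebesgue_measure R).
Local Notation fn := (R -> R[i]).
Definition graph := set (fn * fn).
Implicit Types T : graph.

Definition is_operator T :=
  [/\ forall u f, T (u, f) -> L2 u /\ L2 f,
      forall u v f g, T (u, f) -> L2 v -> L2 g ->
        aeeq u v -> aeeq f g -> T (v, g),
      T (fun=> 0, fun=> 0),
      forall (a : R[i]) u v f g, T (u, f) -> T (v, g) ->
        T (fun x => a * u x + v x, fun x => a * f x + g x) &
      forall u f g, T (u, f) -> T (u, g) -> aeeq f g].

Definition op_dom T : set fn := [set u | exists f, T (u, f)].

(* T u, for u in the domain of T. *)
Definition op_app T (u : fn) : fn := xget (fun=> 0) [set f | T (u, f)].

Definition op_shift T (c : R[i]) : graph :=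
  [set p | exists2 f : fn, T (p.1, f) &
     L2 p.2 /\ aeeq p.2 (fun x => f x + c * p.1 x)].

Definition op_closure T : graph :=
  [set p | L2 p.1 /\ L2 p.2 /\
     exists u_ f_ : nat -> fn,
       [/\ forall n, T (u_ n, f_ n), cvgL2 u_ p.1 & cvgL2 f_ p.2]].

Definition numerical_range T : set R[i] :=
  [set z | exists u f, [/\ T (u, f), L2norm u = 1%E & z = inner f u]].

(* { lambda : |arg (lambda - gamma)| <= theta }, in polar coordinates and with
   the vertex gamma included. *)
Definition sector (gamma theta : R) : set R[i] :=
  [set z | exists r phi : R, [/\ 0 <= r, `|phi| <= theta &
     z = gamma%:C + (r * cos phi) +i* (r * sin phi)]].

(* Kato: for Re lambda > 0, (T + lambda)^{-1} is everywhere defined and bounded,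
   with norm at most 1 / Re lambda. *)
Definition m_accretive T :=
  is_operator T /\
  forall lambda : R[i], 0 < complex.Re lambda ->
    (forall g, L2 g -> exists u, op_shift T lambda (u, g)) /\
    (forall u g, op_shift T lambda (u, g) ->
       (L2norm u <= ((complex.Re lambda)^-1)%:E * L2norm g)%E).

Definition quasi_m_accretive T :=
  exists c : R, m_accretive (op_shift T c%:C).

Definition m_sectorial T :=
  [/\ is_operator T,
      exists gamma theta : R, [/\ 0 <= theta, theta < pi / 2 &
        numerical_range T `<=` sector gamma theta] &
      quasi_m_accretive T].

(* Sesquilinear forms, linear in the first argument; only the values on the
   domain are meaningful. *)
Record form := Form { form_dom : set fn ; form_app : fn -> fn -> R[i] }.

(* The operator associated with a densely defined closed sectorial form by the
   first representation theorem. *)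
Definition form_operator (t : form) : graph :=
  [set p | form_dom t p.1 /\ L2 p.2 /\
     forall v, form_dom t v -> form_app t p.1 v = inner p.2 v].

(* u_ is t-convergent to u. *)
Definition form_cvg (t : form) (u_ : nat -> fn) (u : fn) :=
  [/\ forall n, form_dom t (u_ n), L2 u, cvgL2 u_ u &
      forall e : R, 0 < e -> exists N : nat, forall n m,
        (N <= n)%N -> (N <= m)%N ->
        normc (form_app t (fun x => u_ n x - u_ m x)
                          (fun x => u_ n x - u_ m x)) < e].

(* The closure of a closable sectorial form: the limit of t[u_n, v_n] exists
   and depends only on u and v. *)
Definition form_closure (t : form) : form :=
  {| form_dom := [set u | exists u_, form_cvg t u_ u] ;
     form_app := fun u v => xget 0 [set z | exists u_ v_,
       [/\ form_cvg t u_ u, form_cvg t v_ v &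
           normc (form_app t (u_ n) (v_ n) - z) @[n --> \oo] --> (0 : R)]] |}.

Definition operator_form T : form :=
  {| form_dom := op_dom T ; form_app := fun u v => inner (op_app T u) v |}.

Definition friedrichs T : graph :=
  form_operator (form_closure (operator_form T)).

End Operators.

Section Schroedinger.
Context {R : realType}.
Local Notation mu := (@lebesgue_measure R).
Local Notation fn := (R -> R[i]).
Implicit Types Q tau : fn.

(* u is the locally absolutely continuous representative of y, and w that of
   the quasi-derivative y' - Q y; then l[y] = - w' - Q u' + tau u a.e. *)
Definition Smax Q tau : @graph R :=
  [set p | L2 p.1 /\ L2 p.2 /\
     exists u w : fn,
       [/\ AC_loc u, AC_loc w, aeeq p.1 u,
           aeeq w (fun x => cderive u x - Q x * u x) &
           aeeq p.2 (fun x => - cderive w x - Q x * cderive u x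
                              + tau x * u x)]].

Definition compactly_supported (y : fn) :=
  exists2 K : set R, compact K & {ae mu, forall x, ~ K x -> y x = 0}.

Definition S00 Q tau : @graph R :=
  [set p | Smax Q tau p /\ compactly_supported p.1].

Definition Smin Q tau : @graph R := op_closure (S00 Q tau).

Definition t_form Q tau : @form R :=
  {| form_dom := H1 ;
     form_app := fun u v =>
       inner (wderiv u) (wderiv v)
       - cintegral (fun x => Q x * (wderiv u x * (v x)^*
                                    + u x * (wderiv v x)^*))
       + cintegral (fun x => tau x * u x * (v x)^*) |}.

Definition Sfs Q tau : @graph R := form_operator (t_form Q tau).

Definition SF Q tau : @graph R := friedrichs (S00 Q tau).

End Schroedinger.

(* Main.v *)
(* Put V = 4 |Q|^2 + |tau|.  On unit intervals |u|^2 is controlled by small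
   multiples of int |u'|^2 and large multiples of int |u|^2, and int V is bounded,
   so int V |u|^2 <= 1/4 int |u'|^2 + C int |u|^2.  Hence, whenever the boundary
   terms vanish, E = int |u'|^2 - Q (u' u^* + u u'^* ) + tau |u|^2 satisfies
   |Im E| <= Re E + 2 C |u|^2 and Re E >= 1/2 |u'|^2 - C |u|^2.

   For u in the domain of the maximal operator S, applying this to cutoffs of u
   gives u' in L^2, and integration by parts then shows that S is contained in
   the form-sum, so both are sectorial.  For Re lambda > 2 C the equation
   l[u] + lambda u = G is solved on [- n, n] with Dirichlet conditions, uniformly
   in n, and a limit solution lies in L^2: S + lambda is onto.  A sectorial
   operator extending S then equals S, which gives S = S_fs.  Cutoffs show that
   the preminimal operator is a core of S, so S_0 = S.  Finally the Friedrichs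
   extension of S_00 is sectorial and contains S by the core property, so it
   equals S as well. *)
Require Import Defs.
From HB Require Import structures.
From mathcomp Require Import all_boot all_order all_algebra complex.
From mathcomp Require Import all_classical all_reals all_analysis.
From mathcomp Require Import measurable_realfun ring lra.
Set Implicit Arguments.
Unset Strict Implicit.
Unset Printing Implicit Defensive.
Import Order.TTheory GRing.Theory Num.Theory.
Import numFieldNormedType.Exports.
Local Open Scope classical_set_scope.
Local Open Scope ring_scope.

(** * Locally absolutely continuous real functions *)

Section LocalIntegrals.
Context {R : realType}.
Local Notation mu := (@lebesgue_measure R).
Implicit Types (f g h u v : R -> R) (a b c x y : R).

(** What survives is multiplication by a smooth p: the quasi-derivative of p u is p (u' - Q u) + p'
    u, with no derivative of Q, so cutoffs stay in the domain. The commutator terms contain u',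
    which is why u' in L^2 is needed before any limit over cutoffs. The potential estimate and the
    pointwise bound cost a quarter of int |u'|^2 each; the half that remains gives a sector of
    half-angle pi / 4 with vertex - 2 C. Equality of operators rests on one mechanism: a shifted
    sectorial extension is injective, while the smaller operator is already onto. The only
    compactness used for solvability is that of bounded pairs of initial data at 0, because the
    solutions of the equation form a two-parameter family. Absolute continuity is given by an
    epsilon-delta condition, whereas every estimate needs a density; the passage uses total
    variation and the Radon-Nikodym theorem. *)

Definition locint g :=
  measurable_fun [set: R] g /\ forall a b, mu.-integrable `[a, b] (EFin \o g).

(** The working form of local absolute continuity: the density g is carried along as an argument,
    and later estimates use g instead of a pointwise derivative of u. *)
Definition rprim u g := locint g /\
  forall a b, a <= b -> u b - u a = \int[mu]_(x in `[a, b]) g x.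

Lemma Rintegral_split f a b c : a <= b -> b <= c ->
  mu.-integrable `[a, c] (EFin \o f) ->
  \int[mu]_(x in `[a, c]) f x =
  \int[mu]_(x in `[a, b]) f x + \int[mu]_(x in `[b, c]) f x.
Proof.
move=> ab bc fi.
rewrite -(@Rintegral_itv_obnd_cbnd _ b (BRight c)); last first.
  apply: integrableS fi => //; apply: subset_itv; rewrite bnd_simp //.
rewrite -(@Rintegral_itvB _ f (BLeft a) (BRight c) b) ?bnd_simp//.
by rewrite addrCA subrr addr0.
Qed.

Lemma locint_meas g : locint g -> measurable_fun [set: R] g.
Proof. by case. Qed.

Lemma locint_le f g : measurable_fun [set: R] f -> locint g ->
  (forall x, `|f x| <= g x) -> locint f.
Proof.
move=> mf [mg ig] fg; split=> // a b.
apply: le_integrable (ig a b) => //=.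
  by apply/measurable_EFinP; exact: measurable_funTS.
by move=> x _; rewrite lee_fin (le_trans (fg x))// ler_norm.
Qed.

Lemma locintD f g : locint f -> locint g -> locint (fun x => f x + g x).
Proof.
move=> [mf fi] [mg gi]; split; first exact: measurable_funD.
move=> a b; have := integrableD _ (fi a b) (gi a b); exact.
Qed.

Lemma locintZ k f : locint f -> locint (fun x => k * f x).
Proof.
move=> [mf fi]; split; first exact: measurable_funM.
move=> a b; have := integrableZl _ k (fi a b); exact.
Qed.

Lemma locintN f : locint f -> locint (fun x => - f x).
Proof.
by move=> /(locintZ (-1)); under eq_fun do rewrite mulN1r.
Qed.

Lemma locintB f g : locint f -> locint g -> locint (fun x => f x - g x).
Proof. by move=> fi gi; apply: locintD => //; exact: locintN. Qed.

Lemma locint_norm f : locint f -> locint (fun x => `|f x|).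
Proof.
move=> [mf fi]; split; first exact: measurableT_comp.
by move=> a b; exact: integrable_norm.
Qed.

Lemma locint_cont f : continuous f -> locint f.
Proof.
move=> cf; split; first exact: continuous_measurable_fun.
move=> a b; apply: continuous_compact_integrable; first exact: segment_compact.
exact: continuous_subspaceT.
Qed.

Lemma cont_bounded f a b : continuous f ->
  exists2 M, 0 <= M & forall x, a <= x <= b -> `|f x| <= M.
Proof.
move=> cf.
have [|M [_ HM]] := @compact_bounded R R (f @` `[a, b]).
  apply: continuous_compact; first exact: continuous_subspaceT.
  exact: segment_compact.
exists (`|M| + 1) => [|x xab]; first by rewrite addr_ge0.
apply: (HM (`|M| + 1)); first by rewrite (le_lt_trans (ler_norm M))// ltrDl.
by exists x => //; rewrite /= in_itv.
Qed.

Lemma locintMl f g : continuous f -> locint g -> locint (fun x => f x * g x).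
Proof.
move=> cf [mg gi]; split.
  by apply: measurable_funM => //; exact: continuous_measurable_fun.
move=> a b; have [M M0 HM] := cont_bounded a b cf.
apply: (@le_integrable _ _ _ mu _ _ _ (fun x => M%:E * (EFin \o (@Num.norm _ _ \o g)) x)%E) => //=.
- apply/measurable_EFinP/measurable_funTS/measurable_funM => //.
  exact: continuous_measurable_fun.
- move=> x; rewrite in_itv/= => xab; rewrite lee_fin normrM.
  by rewrite normrM normr_id (ger0_norm M0) ler_wpM2r// HM.
- by apply: integrableZl => //; exact: integrable_norm.
Qed.

Lemma locint_open_ae f : locint f -> locally_integrable [set: R] f.
Proof.
move=> [mf fi]; split => //; first exact: openT.
move=> K _ cK; have [M [_ HM]] := compact_bounded cK.
have KM : K `<=` `[- (`|M| + 1), `|M| + 1].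
  move=> x Kx; rewrite /= in_itv/= -ler_norml.
  by apply: HM => //; rewrite (le_lt_trans (ler_norm M))// ltrDl.
have /integrableP[_] := fi (- (`|M| + 1)) (`|M| + 1).
apply: le_lt_trans; apply: ge0_subset_integral => //.
- exact: compact_measurable.
- by apply/measurable_EFinP/measurableT_comp => //; exact: measurable_funTS.
Qed.

Lemma locintP f : locally_integrable [set: R] f -> locint f.
Proof.
move=> [mf _ fi]; split=> // a b; apply/integrableP; split.
  by apply/measurable_EFinP; exact: measurable_funTS.
by apply: fi => //; exact: segment_compact.
Qed.

Lemma ae_imp (P S : R -> Prop) : (forall x, P x -> S x) ->
  {ae mu, forall x, P x} -> {ae mu, forall x, S x}.
Proof. by move=> PS; apply: (@filterS _ _ (ae_filter_ringOfSetsType mu)). Qed.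

Lemma ae_imp2 (P S T : R -> Prop) : (forall x, P x -> S x -> T x) ->
  {ae mu, forall x, P x} -> {ae mu, forall x, S x} -> {ae mu, forall x, T x}.
Proof. by move=> PS; apply: (@filterS2 _ _ (ae_filter_ringOfSetsType mu)). Qed.

Lemma mintD (D : set R) f g : measurable D -> mu.-integrable D (EFin \o f) ->
  mu.-integrable D (EFin \o g) -> mu.-integrable D (EFin \o (fun x => f x + g x)).
Proof. by move=> mD fi gi; have := integrableD _ fi gi; exact. Qed.

Lemma mintZ (D : set R) c f : measurable D -> mu.-integrable D (EFin \o f) ->
  mu.-integrable D (EFin \o (fun x => c * f x)).
Proof. by move=> mD fi; have := integrableZl _ c fi; exact. Qed.

Lemma mintN (D : set R) f : measurable D -> mu.-integrable D (EFin \o f) ->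
  mu.-integrable D (EFin \o (fun x => - f x)).
Proof. by move=> mD /(mintZ (-1) mD); under eq_fun do rewrite mulN1r. Qed.

Lemma mintB (D : set R) f g : measurable D -> mu.-integrable D (EFin \o f) ->
  mu.-integrable D (EFin \o g) -> mu.-integrable D (EFin \o (fun x => f x - g x)).
Proof. by move=> mD fi gi; apply: mintD => //; exact: mintN. Qed.

Lemma mint_norm (D : set R) f : measurable D -> mu.-integrable D (EFin \o f) ->
  mu.-integrable D (EFin \o (fun x => `|f x|)).
Proof. by move=> mD fi; exact: integrable_norm. Qed.

Lemma mint0 (D : set R) : measurable D -> mu.-integrable D (EFin \o (fun=> 0 : R)).
Proof. by move=> mD; apply: eq_integrable (integrable0 mu D). Qed.

Lemma mintS (D E : set R) f : measurable D -> measurable E -> E `<=` D ->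
  mu.-integrable D (EFin \o f) -> mu.-integrable E (EFin \o f).
Proof. by move=> mD mE ED; exact: integrableS. Qed.

Lemma ae_integrable (D : set R) (f g : R -> \bar R) : measurable D ->
  measurable_fun D g -> ae_eq mu D f g ->
  mu.-integrable D f -> mu.-integrable D g.
Proof.
move=> mD mg fg /integrableP[mf fi]; apply/integrableP; split => //.
rewrite (_ : (\int[mu]_(x in D) `|g x| = \int[mu]_(x in D) `|f x|)%E)//.
apply: ae_eq_integral => //; [exact: measurableT_comp..|].
by apply: ae_imp fg => x /= + Dx => ->.
Qed.

Lemma ae_Rintegral (D : set R) f g : measurable D ->
  measurable_fun D f -> measurable_fun D g ->
  {ae mu, forall x, D x -> f x = g x} ->
  \int[mu]_(x in D) f x = \int[mu]_(x in D) g x.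
Proof.
move=> mD mf mg fg; congr fine; apply: ae_eq_integral => //.
- exact/measurable_EFinP.
- exact/measurable_EFinP.
- by apply: ae_imp fg => x /= + Dx => ->.
Qed.

Lemma is_derive_derive1 f x a : derivable f x 1 -> derive1 f x = a ->
  is_derive x 1 f a.
Proof. by move=> df <-; apply: DeriveDef => //; rewrite derive1E. Qed.

Lemma derive1_is_derive f x a : is_derive x 1 f a -> derive1 f x = a.
Proof. by move=> df; rewrite derive1E; apply: derive_val. Qed.

Lemma rprim_ae u g : rprim u g ->
  {ae mu, forall x, derivable u x 1 /\ derive1 u x = g x}.
Proof.
move=> [gl ug].
(* [FTC1] differentiates integrals from a fixed base point. The base points - n are countable, so
   their exceptional sets form one null set, and every x lies to the right of one of them. *)
have H (n : nat) : {ae mu, forall x, - n%:R < x -> derivable u x 1 /\ derive1 u x = g x}.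
  have := @FTC1 R g (BLeft (- n%:R)) _ _.
  move/(_ (fun y => gl.2 _ _) (locint_open_ae gl)).
  apply: filterS; first exact: (ae_filter_ringOfSetsType mu).
  move=> x + nx; rewrite lte_fin => /(_ nx).
  set F := (fun x => Rintegral _ _ _) => -[dF F'].
  have Fu : {near x, F =1 (fun y => u y - u (- n%:R))}.
    near=> y; rewrite /F ug//; near: y.
    apply: filterS (lt_nbhsr nx) => z; exact: ltW.
  have Fu' : {near x, (fun y => F y + cst (u (- n%:R)) y) =1 u}.
    by near=> y; rewrite /= (near Fu y)//= subrK.
  have du : is_derive x 1 u (g x).
    apply: (near_eq_is_derive (f := fun y => F y + cst (u (- n%:R)) y) Fu').
    apply: (is_derive_eq (is_deriveD (is_derive_derive1 dF F') (is_derive_cst (u (- n%:R)) x 1))).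
    exact: addr0.
  by split; [exact: (@ex_derive _ _ _ _ _ _ _ du)|exact: derive1_is_derive du].
have : {ae mu, forall x (n : nat), - n%:R < x -> derivable u x 1 /\ derive1 u x = g x}.
  exact/ae_foralln.
apply: ae_imp => x Hx.
have [n xn] : exists n : nat, `|x| < n%:R.
  by exists (Num.bound `|x|); rewrite archi_boundP.
by apply: (Hx n); rewrite ltrNl (le_lt_trans _ xn)// -normrN ler_norm.
Unshelve. all: by end_near. Qed.

End LocalIntegrals.

(** * Absolute continuity and total variation *)

Section AbsoluteContinuity.
Context {R : realType}.
Local Notation mu := (@lebesgue_measure R).
Implicit Types (f g h u v F : R -> R) (a b c x y e d : R) (l : seq (R * R)) (p q r : R * R).

Definition rAC a b f := forall e, 0 < e -> exists2 d, 0 < d &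
  forall (n : nat) (s t : 'I_n -> R),
    (forall i, a <= s i /\ s i <= t i /\ t i <= b) ->
    trivIset [set: 'I_n] (fun i => `]s i, t i[%classic) ->
    \sum_(i < n) (t i - s i) < d ->
    \sum_(i < n) `|f (t i) - f (s i)| < e.

Lemma rprim_norm_le u g a b : rprim u g -> a <= b ->
  `|u b - u a| <= \int[mu]_(x in `]a, b[) `|g x|.
Proof.
move=> [[mg ig] ug] ab; rewrite ug//.
rewrite (le_trans (le_normr_Rintegral _ _))//.
have i2 (i j : bool) : mu.-integrable [set` Interval (BSide i a) (BSide j b)] (EFin \o (fun x => `|g x|)).
  apply: integrableS (integrable_norm (ig a b)) => //.
  by case: i; case: j; apply: subset_itv; rewrite bnd_simp.
rewrite (@Rintegral_itv_bndo_bndc _ (BRight a) b _ (i2 false true)).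
by rewrite (@Rintegral_itv_obnd_cbnd _ a (BRight b) _ (i2 false false)).
Qed.

(** The increments over disjoint intervals add up to at most the integral of |g| over their union,
    whose measure is the sum of the lengths; the integral is absolutely continuous with respect to
    that measure. *)
Lemma rprim_rAC u g a b : rprim u g -> rAC a b u.
Proof.
move=> ug e e0; have [[mg ig] _] := ug.
pose g1 := g \_ `[a, b].
have ig1 : mu.-integrable setT (EFin \o g1).
  by rewrite /g1 -restrict_EFin -integrable_mkcond.
have [d [d0 dA]] := integral_normr_continuous ig1 e0.
exists d => // n s t st tr std.
pose A := \big[setU/set0]_(i < n) `]s i, t i[%classic.
have mA : measurable A by apply: bigsetU_measurable.
have muA : (mu A < d%:E)%E.
  rewrite /A measure_semi_additive_ord//=.
  apply: le_lt_trans (_ : (\sum_(i < n) (t i - s i)%:E < _)%E); last first.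
    by rewrite sumEFin lte_fin.
  apply: lee_sum => i _; rewrite lebesgue_measure_itv/= lte_fin.
  by case: ifPn => // _; rewrite lee_fin subr_ge0; case: (st i) => _ [].
apply: le_lt_trans (dA _ mA muA).
rewrite -lee_fin -sumEFin /Rintegral fineK; last first.
  apply: integrable_fin_num => //.
  by apply: integrableS (integrable_norm ig1).
rewrite ge0_integral_bigsetU//=; last 3 first.
- exact: index_enum_uniq.
- by apply: sub_trivIset tr.
- apply/measurable_EFinP/measurable_funTS/measurableT_comp => //.
  by have /measurable_int/measurable_EFinP := ig1.
apply: lee_sum => i _.
have [asi [sti tib]] := st i.
apply: (@le_trans _ _ (\int[mu]_(x in `]s i, t i[) `|g x|)%:E).
  by rewrite lee_fin; exact: rprim_norm_le.
rewrite /Rintegral fineK; last first.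
  apply: integrable_fin_num => //; apply: integrableS (integrable_norm (ig a b)) => //.
  by apply: subset_itv; rewrite bnd_simp.
rewrite le_eqVlt; apply/orP; left; apply/eqP/eq_integral => x /[!inE] /= xst; rewrite /g1 patchE mem_set//=.
move: xst; rewrite /= !in_itv/= => /andP[sx xt].
by rewrite (le_trans asi (ltW sx)) (le_trans (ltW xt) tib).
Qed.

(** Clamping to [a, b]. It is nondecreasing and 1-Lipschitz, so it maps disjoint lists of intervals
    to disjoint ones of no larger total length; composing with it extends absolute continuity from
    [a, b] to the line. *)
Definition clip a b x := Num.max a (Num.min b x).

Lemma clip_itv a b x : a <= b -> a <= clip a b x <= b.
Proof. by rewrite /clip maxEle minEle; case: ifPn; case: ifPn; lra. Qed.

Lemma clip_id a b x : a <= x <= b -> clip a b x = x.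
Proof. by rewrite /clip maxEle minEle; case: ifPn; case: ifPn; lra. Qed.

Lemma clip_le a b x y : x <= y -> clip a b x <= clip a b y.
Proof. by rewrite /clip !maxEle !minEle; do 4! case: ifPn; lra. Qed.

Lemma clip_lip a b x y : x <= y -> clip a b y - clip a b x <= y - x.
Proof. by rewrite /clip !maxEle !minEle; do 4! case: ifPn; lra. Qed.

Definition disj p q := (p.2 <= q.1) || (q.2 <= p.1).
Definition ordered p := p.1 <= p.2.

Lemma disjC p q : disj p q = disj q p.
Proof. by rewrite /disj orbC. Qed.

(* Absolute continuity on the whole line, with lists of disjoint intervals,
   which can be refined and concatenated, in place of families over 'I_n. *)
Definition lac f := forall e, 0 < e -> exists2 d, 0 < d &
  forall l, all ordered l -> pairwise disj l ->
    \sum_(p <- l) (p.2 - p.1) < d -> \sum_(p <- l) `|f p.2 - f p.1| <= e.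

Lemma rAC_lac a b f : a <= b -> rAC a b f -> lac (f \o clip a b).
Proof.
move=> ab fAC e e0; have [d d0 H] := fAC e e0; exists d => // l ol dl ld.
pose s (i : 'I_(size l)) := clip a b (nth (0, 0) l i).1.
pose t (i : 'I_(size l)) := clip a b (nth (0, 0) l i).2.
have oi (i : 'I_(size l)) : (nth (0, 0) l i).1 <= (nth (0, 0) l i).2.
  by have /all_nthP := ol; apply.
rewrite (big_nth (0, 0)) big_mkord; apply/ltW/(H _ s t).
- move=> i; have /andP[] := clip_itv (nth (0, 0) l i).1 ab.
  have /andP[] := clip_itv (nth (0, 0) l i).2 ab.
  by have := clip_le a b (oi i).
- apply/trivIsetP => i j _ _ ij; rewrite -subset0 => x [] /=.
  rewrite !in_itv/= => /andP[si ti] /andP[sj tj].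
  have /pairwiseP Hp := dl.
  have lt_ij (k m : 'I_(size l)) : (k < m)%N ->
      t k <= s m \/ t m <= s k.
    move=> km; have /orP[] := Hp (0, 0) k m (ltn_ord k) (ltn_ord m) km.
      by move=> /(clip_le a b); left.
    by move=> /(clip_le a b); right.
  have [/lt_ij|/lt_ij|/val_inj/eqP] := ltngtP i j; last by rewrite (negbTE ij).
    by case; lra.
  by case; lra.
- apply: le_lt_trans ld; rewrite [leRHS](big_nth (0, 0)) big_mkord.
  by apply: ler_sum => i _; exact: clip_lip.
Qed.

(** The intervals of an [itv_partition], where s lists the nodes after x. The variation becomes a
    sum over a list of disjoint intervals, to which [lac] applies. *)
Fixpoint pairs x (s : seq R) : seq (R * R) :=
  if s is z :: s' then (x, z) :: pairs z s' else [::].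

Lemma pairs_itv x y s p : itv_partition x y s -> p \in pairs x s ->
  [/\ x <= p.1, p.1 <= p.2 & p.2 <= y].
Proof.
elim: s x => //= z s IH x [/= /andP[xz zs] /eqP zy].
have zs' : itv_partition z y s by split => //; apply/eqP.
rewrite in_cons => /orP[/eqP ->/=|ps].
  by split=> //; [exact: ltW|exact: (itv_partition_le zs')].
by have [? ? ?] := IH _ zs' ps; split => //; apply: le_trans (ltW xz) _.
Qed.

Lemma pairs_disj x y s : itv_partition x y s -> pairwise disj (pairs x s).
Proof.
elim: s x => //= z s IH x [/= /andP[xz zs] /eqP zy].
have zs' : itv_partition z y s by split => //; apply/eqP.
rewrite IH// andbT; apply/allP => p /(pairs_itv zs')[zp _ _].
by rewrite /disj/= zp.
Qed.

Lemma pairs_len x y s : itv_partition x y s ->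
  \sum_(p <- pairs x s) (p.2 - p.1) = y - x.
Proof.
elim: s x => /= [x [_ /eqP <-]|z s IH x [/= /andP[xz zs] /eqP zy]].
  by rewrite big_nil subrr.
have zs' : itv_partition z y s by split => //; apply/eqP.
by rewrite big_cons/= IH//; ring.
Qed.

Lemma pairs_variation f x y s : itv_partition x y s ->
  variation x y f s = \sum_(p <- pairs x s) `|f p.2 - f p.1|.
Proof.
elim: s x => /= [x _|z s IH x [/= /andP[xz zs] /eqP zy]].
  by rewrite variation_nil big_nil.
have zs' : itv_partition z y s by split => //; apply/eqP.
rewrite big_cons/= -IH// /variation big_nat_recl//=.
Qed.

(* Replacing, one interval at a time, the increment of F by its variation shows
   that the variation function of F is absolutely continuous with F. *)
Lemma TV_list F e d : (forall l, all ordered l -> pairwise disj l ->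
    \sum_(p <- l) (p.2 - p.1) < d -> \sum_(p <- l) `|F p.2 - F p.1| <= e) ->
  forall L l, all ordered (L ++ l) -> pairwise disj (L ++ l) ->
    \sum_(p <- L ++ l) (p.2 - p.1) < d ->
  (\sum_(p <- L) total_variation p.1 p.2 F + (\sum_(p <- l) `|F p.2 - F p.1|)%:E <= e%:E)%E.
Proof.
move=> H; elim=> [l ol dl sl|p L IH l].
  by rewrite big_nil add0e lee_fin H.
move=> /= /andP[op oL] /andP[dp dL]; rewrite big_cons => sL.
have IHl := IH l oL dL.
have sub_len : \sum_(q <- L ++ l) (q.2 - q.1) < d.
  by apply: le_lt_trans sL; rewrite lerDr subr_ge0.
have {}IHl := IHl sub_len.
set S := (\sum_(p <- L) _ + _)%E in IHl.
have S0 : (0 <= S)%E.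
  rewrite adde_ge0 ?lee_fin ?sumr_ge0// big_seq sume_ge0// => q qL.
  by apply: total_variation_ge0; have /allP := oL; apply; rewrite mem_cat qL.
have Sfin : S \is a fin_num by rewrite ge0_fin_numE// (le_lt_trans IHl)// ltry.
rewrite big_cons -addeA -/S -leeBrDr//.
apply: ge_ereal_sup => _ [_ [s ps <-] <-].
rewrite leeBrDr// /S addeCA -EFinD pairs_variation// -big_cat/=.
have pin q : q \in pairs p.1 s -> [/\ p.1 <= q.1, q.1 <= q.2 & q.2 <= p.2].
  exact: pairs_itv.
apply: IH.
- move: oL; rewrite !all_cat => /andP[-> ->]; rewrite andbT/=.
  by apply/allP => q /pin[].
- move: dL; rewrite !pairwise_cat => /and3P[Ll -> ->]; rewrite andbT/=.
  rewrite (pairs_disj ps) andbT/= allrel_catr Ll andbT/=; apply/andP; split.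
    apply/allrelP => q r qL /pin[p1 r12 p2].
    have /allP/(_ q) := dp; rewrite mem_cat qL/= => /(_ erefl).
    by rewrite /disj => /orP[]; lra.
  apply/allrelP => q r /pin[p1 r12 p2] rl.
  have /allP/(_ r) := dp; rewrite mem_cat rl orbT => /(_ erefl).
  by rewrite /disj => /orP[]; lra.
- move: sL; rewrite !big_cat/= (pairs_len ps); lra.
Qed.

End AbsoluteContinuity.

(** * Stieltjes measures of absolutely continuous functions *)

Section Density.
Context {R : realType}.
Local Notation mu := (@lebesgue_measure R).
Implicit Types (f g h u v F : R -> R) (a b c x y e d : R) (l m : seq (R * R)) (p q r : R * R).

Lemma disj_hull p q r : ordered r -> q.1 < p.2 -> p.1 < q.2 ->
  disj r p -> disj r q -> disj r (Num.min p.1 q.1, Num.max p.2 q.2).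
Proof.
rewrite /ordered /disj /= le_min ge_max => r12 qp pq /orP[a|a] /orP[b|b]; apply/orP.
- by left; rewrite a b.
- by have := lt_le_trans pq b; rewrite ltNge (le_trans r12 a).
- by have := lt_le_trans qp a; rewrite ltNge (le_trans r12 b).
- by right; rewrite a b.
Qed.

(** The interval p is absorbed into each member that it overlaps: the hull of two overlapping
    intervals is no longer than both together, and it is inserted into the rest. The last clause is
    the invariant that keeps the members already passed disjoint from the result. *)
Lemma merge_insert p l : ordered p -> all ordered l -> pairwise disj l ->
  exists m, [/\ all ordered m, pairwise disj m,
    \sum_(r <- m) (r.2 - r.1) <= (p.2 - p.1) + \sum_(r <- l) (r.2 - r.1),
    forall x q, q \in p :: l -> q.1 < x <= q.2 ->
      exists2 r, r \in m & r.1 < x <= r.2 &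
    forall r, ordered r -> disj r p -> all (disj r) l -> all (disj r) m].
Proof.
elim: l p => [|q l IH] p op.
  move=> _ _; exists [:: p]; rewrite /= op big_seq1 big_nil addr0; split => //.
    by move=> x q qp xq; exists q.
  by move=> r _ ->.
move=> /= /andP[oq ol] /andP[dq dl].
have [pq|npq] := boolP (disj p q).
  have [m [om dm lm cm im]] := IH p op ol dl; exists (q :: m); split => /=.
  - by rewrite oq.
  - by rewrite dm andbT im// disjC.
  - by rewrite !big_cons; lra.
  - move=> x s; rewrite !in_cons => /or3P[/eqP ->|/eqP ->|sl] xs.
    + by have [|r rm xr] := cm x p _ xs; rewrite ?mem_head//; exists r; rewrite // in_cons rm orbT.
    + by exists q; rewrite ?mem_head.
    + by have [|r rm xr] := cm x s _ xs; rewrite ?in_cons ?sl ?orbT//; exists r; rewrite // in_cons rm orbT.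
  - by move=> r or_ rp /andP[-> rl]/=; apply: im.
have [pq1 qp1] : q.1 < p.2 /\ p.1 < q.2.
  by move: npq; rewrite /disj negb_or -!ltNge => /andP[].
pose h := (Num.min p.1 q.1, Num.max p.2 q.2).
have [h1p h1q] : h.1 <= p.1 /\ h.1 <= q.1 by rewrite !ge_min !lexx orbT.
have [h2p h2q] : p.2 <= h.2 /\ q.2 <= h.2 by rewrite !le_max !lexx orbT.
have h1 : h.1 = p.1 \/ h.1 = q.1 by rewrite /h/= minEle; case: ifPn; [left|right].
have h2 : h.2 = p.2 \/ h.2 = q.2 by rewrite /h/= maxEle; case: ifPn; [right|left].
move: op oq; rewrite /ordered => op oq.
have oh : ordered h by rewrite /ordered; lra.
have [m [om dm lm cm im]] := IH h oh ol dl; exists m; split => //.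
- rewrite big_cons; apply: le_trans lm _; rewrite addrA lerD2r.
  by clear -h1 h2 op oq pq1 qp1; case: h1 => ->; case: h2 => ->; lra.
- move=> x s; rewrite !in_cons => /or3P[/eqP ->|/eqP ->|sl] xs.
  + by apply: (cm x h); rewrite ?mem_head//; lra.
  + by apply: (cm x h); rewrite ?mem_head//; lra.
  + by apply: (cm x s); rewrite ?in_cons ?sl ?orbT.
- move=> r or_ rp /andP[rq rl]; apply: im => //.
  exact: disj_hull.
Qed.

(** Coverings obtained from the outer measure may overlap, whereas [lac] speaks of disjoint
    intervals only. *)
Lemma merge l : all ordered l -> exists m, [/\ all ordered m, pairwise disj m,
    \sum_(r <- m) (r.2 - r.1) <= \sum_(r <- l) (r.2 - r.1) &
    forall x q, q \in l -> q.1 < x <= q.2 ->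
      exists2 r, r \in m & r.1 < x <= r.2].
Proof.
elim: l => [_|p l IH /= /andP[op ol]]; first by exists [::]; split.
have [m [om dm lm cm]] := IH ol.
have [k [ok dk lk ck _]] := merge_insert op om dm.
exists k; split => //; first by rewrite big_cons (le_trans lk)// lerD2l.
move=> x q; rewrite in_cons => /orP[/eqP ->|ql] xq.
  by apply: (ck x p) => //; rewrite mem_head.
have [r rm xr] := cm x q ql xq.
by apply: (ck x r) => //; rewrite in_cons rm orbT.
Qed.

Lemma lac_cont F : lac F -> continuous F.
Proof.
move=> Fl x; apply/cvgrPdist_le => e e0.
have [d d0 H] := Fl e e0.
near=> y; have xy : `|x - y| < d by near: y; exact: cvgr_dist_lt.
have [yx|xy'] := leP y x.
  have := H [:: (y, x)]; rewrite !big_seq1/= andbT; apply => //.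
  by apply: le_lt_trans xy; rewrite ler_norm.
have := H [:: (x, y)]; rewrite !big_seq1/= andbT distrC; apply => //; first exact: ltW.
by apply: le_lt_trans xy; rewrite distrC ler_norm.
Unshelve. all: by end_near. Qed.

Section Cumul.
Variables (Fc : cumulative R R).
Local Notation ls := (lebesgue_stieltjes_measure Fc).

Lemma ls_itv x y : x <= y -> ls `]x, y]%classic = (Fc y - Fc x)%:E.
Proof.
move=> xy; rewrite /lebesgue_stieltjes_measure /measure_extension measurable_mu_extE/=; last exact: is_ocitv.
by rewrite wlength_itv_bnd.
Qed.

Lemma ls_list l (A : set R) : all ordered l -> measurable A ->
  (forall x, A x -> exists2 p, p \in l & p.1 < x <= p.2) ->
  (ls A <= (\sum_(p <- l) (Fc p.2 - Fc p.1))%:E)%E.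
Proof.
move=> ol mA Al.
apply: (@le_trans _ _ (ls (\big[setU/set0]_(p <- l) `]p.1, p.2]%classic))).
  apply: le_measure; rewrite ?inE//.
    by apply: bigsetU_measurable => p _; exact: measurable_itv.
  by move=> x /Al[p pl xp]; rewrite -bigcup_seq; exists p => //=; rewrite in_itv.
elim: l ol {Al} => [|p l IH /= /andP[op ol]].
  by rewrite !big_nil measure0.
rewrite !big_cons EFinD (le_trans (measureU2 _ _ _))//.
- by apply: bigsetU_measurable => q _; exact: measurable_itv.
- by apply: leeD; [rewrite -ls_itv|exact: IH].
Qed.

(** A null set has a cover of total length below the modulus d of [lac]. Each finite part of the
    cover, once merged, has Stieltjes measure at most e, and continuity from below extends this to
    the whole cover. *)
Lemma ls_dominated (A : set R) : lac Fc -> measurable A -> mu A = 0%E -> ls A = 0%E.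
Proof.
move=> Fl mA A0.
apply/eqP; rewrite eq_le measure_ge0 andbT; apply/lee_addgt0Pr => e e0; rewrite add0e.
have [d d0 H] := Fl e e0.
have : (mu A < d%:E)%E by rewrite A0 lte_fin.
(* Unfolded to an outer measure, mu yields the cover by half-open intervals. *)
rewrite {1}/lebesgue_measure /lebesgue_stieltjes_measure /measure_extension /mu_ext.
move=> /ereal_inf_lt[_ [B [mB AB] <-] Bd].
have mB' n : measurable (B n : set R) by apply: sub_sigma_algebra; exact: mB.
have hB n : exists p, ordered p /\ B n = `]p.1, p.2]%classic.
  have := mB n; rewrite /measurable/= => -[p _ pB].
  have [p12|p21] := leP p.1 p.2; first by exists p.
  (* An interval with reversed endpoints is empty and is recoded as a degenerate one. *)
  exists (p.1, p.1); split; first by rewrite /ordered.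
  rewrite -pB [LHS]set_itv_ge; last by rewrite bnd_simp -leNgt ltW.
  by rewrite set_itv_ge// bnd_simp ltxx.
have [p hp] := choice hB.
have Bn n : (ls (\big[setU/set0]_(i < n) B i) <= e%:E)%E.
  pose l := [seq p i | i <- index_iota 0 n].
  have ol : all ordered l by apply/allP => _ /mapP[i _ ->]; exact: (hp i).1.
  have [m [om dm lm cm]] := merge ol.
  apply: (@le_trans _ _ (\sum_(p <- m) (Fc p.2 - Fc p.1))%:E).
    apply: ls_list => //; first by apply: bigsetU_measurable.
    move=> x; rewrite -bigcup_mkord => -[i /= iN]; rewrite (hp i).2/= in_itv/= => xi.
    by apply: (cm x (p i)) => //; apply/mapP; exists i => //; rewrite mem_index_iota.
  rewrite lee_fin; apply: le_trans (H m om dm _).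
    by apply: ler_sum => q _; exact: ler_norm.
  apply: le_lt_trans lm _; rewrite big_map -lte_fin -sumEFin.
  apply: le_lt_trans Bd.
  rewrite (eq_bigr (fun i => wlength idfun (B i))); last first.
    by move=> i _; rewrite (hp i).2 wlength_itv_bnd//; exact: (hp i).1.
  by apply: nneseries_lim_ge => i _ _; exact: wlength_ge0.
apply: (@le_trans _ _ (ls (\bigcup_n \big[setU/set0]_(i < n) B i))).
  apply: le_measure; rewrite ?inE//.
    by apply: bigcup_measurable => i _; apply: bigsetU_measurable => j _; exact: mB'.
  by move=> x /AB[k _ Bk]; exists k.+1 => //; rewrite -bigcup_mkord; exists k => /=.
have cv := @nondecreasing_cvg_mu _ _ _ ls (fun n => \big[setU/set0]_(i < n) B i).
apply: (cvge_le _ (cv _ _ _)).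
- by apply: nearW.
- by move=> i; apply: bigsetU_measurable => j _; exact: mB'.
- by apply: bigcup_measurable => i _; apply: bigsetU_measurable => j _; exact: mB'.
- by move=> i j ij; apply/subsetPset; exact: subset_bigsetU.
Qed.

End Cumul.

(** The density is the Radon-Nikodym derivative of the Lebesgue-Stieltjes measure of F, restricted
    to []a, b]] so as to be finite. *)
Lemma nd_lac_density F a b : {homo F : x y / x <= y} -> lac F ->
  exists g, mu.-integrable `[a, b] (EFin \o g) /\
    forall x y, a <= x -> x <= y -> y <= b -> F y - F x = \int[mu]_(t in `[x, y]) g t.
Proof.
move=> ndF Fl.
have rcF : right_continuous F by apply: right_continuousW; exact: lac_cont.
pose Fc : cumulative R R := HB.pack F (isCumulative.Build R _ R F ndF rcF).
have [ba|ab] := ltP b a.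
  exists (cst 0); split; first by rewrite set_itv_ge ?bnd_simp -?ltNge//; exact: integrable_set0.
  by move=> x y; lra.
pose ls := lebesgue_stieltjes_measure Fc.
have mE : measurable (`]a, b]%classic : set (measurableTypeR R)) by exact: measurable_itv.
have lsE : (ls `]a, b]%classic < +oo)%E by rewrite /ls ls_itv// ltry.
pose nu : {finite_measure set _ -> \bar R} := mfrestr mE lsE.
have numu : nu `<< mu.
  move=> N /= N0 A mA AN; rewrite /nu/= /mfrestr /mrestr.
  apply: ls_dominated => //; first exact: measurableI.
  by apply: N0 => //; [exact: measurableI|move=> x [/AN]].
have [g [g0 gfin ig gE]] := radon_nikodym_sigma_finite numu.
exists (fine \o g).
have gg : EFin \o (fine \o g) = g by apply/funext => x /=; rewrite fineK.
split; first by rewrite gg; exact: integrableS ig.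
move=> x y ax xy yb.
rewrite -Rintegral_itv_obnd_cbnd; last by rewrite gg; exact: integrableS ig.
have -> : \int[mu]_(t in `]x, y]) (fine \o g) t = fine (\int[mu]_(t in `]x, y]) g t)%E.
  by congr fine; apply: eq_integral => t _ /=; rewrite fineK.
rewrite -gE//.
rewrite /nu/= /mfrestr /mrestr setIidl; last by apply: subset_itv; rewrite bnd_simp.
by rewrite /ls ls_itv.
Qed.

End Density.

(** * Jordan decomposition and densities *)

Section ACDensity.
Context {R : realType}.
Local Notation mu := (@lebesgue_measure R).
Implicit Types (f g h u v F : R -> R) (a b c x y e d : R) (l m : seq (R * R)) (p q r : R * R).

Local Notation TV := total_variation.

(** With d the modulus for e = 1, every step of length d / 2 has variation at most 1, and finitely
    many steps lead from x past y. *)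
Lemma lac_TV_fin F x y : lac F -> x <= y -> TV x y F \is a fin_num.
Proof.
move=> Fl xy; have [d d0 H] := Fl 1 ltr01.
have small s t : s <= t -> t - s < d -> (TV s t F <= 1%:E)%E.
  move=> st std; have := @TV_list R F 1 d H [:: (s, t)] [::].
  by rewrite /= big_seq1 !big_seq1 big_nil adde0 /ordered/= st; apply.
have step n : (TV x (x + n%:R * (d / 2)) F <= n%:R%:E)%E.
  elim: n => [|n IH]; first by rewrite mul0r addr0 total_variationxx.
  have hS : n.+1%:R * (d / 2) = n%:R * (d / 2) + d / 2 by rewrite -natr1 mulrDl mul1r.
  have hn : 0 <= n%:R * (d / 2) by rewrite mulr_ge0// divr_ge0// ltW.
  rewrite (@total_variationD _ _ _ (x + n%:R * (d / 2))) ?lerDl//; last first.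
    by lra.
  rewrite -[in leRHS]natr1 EFinD leeD//; apply: small.
    by lra.
  by rewrite hS; lra.
have [n xn] : exists n : nat, y <= x + n%:R * (d / 2).
  exists (Num.bound ((y - x) / (d / 2))).
  rewrite -lerBlDl -ler_pdivrMr ?divr_gt0//; apply/ltW/archi_boundP.
  by rewrite divr_ge0 ?divr_ge0 ?subr_ge0// ltW.
rewrite ge0_fin_numE ?total_variation_ge0//.
apply: le_lt_trans (ltry n%:R); apply: le_trans (step n).
by rewrite [leRHS](@total_variationD _ _ _ y)// leeDl// total_variation_ge0.
Qed.

Section TVfun.
Variables (F : R -> R) (a b : R).
Hypotheses (ab : a <= b) (Fl : lac F) (Fc : forall x, F (clip a b x) = F x).

Definition tvf x := fine (TV a (clip a b x) F).

Let ac x : a <= clip a b x.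
Proof. by have /andP[] := clip_itv x ab. Qed.

Lemma tvfB x y : x <= y ->
  (tvf y - tvf x)%:E = TV (clip a b x) (clip a b y) F.
Proof.
move=> xy; rewrite /tvf (@total_variationD _ a (clip a b y) (clip a b x))//; last exact: clip_le.
rewrite fineD ?lac_TV_fin//; last exact: clip_le.
by rewrite addrAC subrr add0r fineK// lac_TV_fin// clip_le.
Qed.

Lemma tvf_ge x y : x <= y -> `|F y - F x| <= tvf y - tvf x.
Proof.
move=> xy; rewrite -lee_fin tvfB// -(Fc x) -(Fc y).
by apply: total_variation_ge; exact: clip_le.
Qed.

Lemma tvf_nd : {homo tvf : x y / x <= y}.
Proof. by move=> x y xy; rewrite -subr_ge0 (le_trans _ (tvf_ge xy)). Qed.

Lemma tvf_lac : lac tvf.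
Proof.
move=> e e0; have [d d0 H] := Fl e0; exists d => // l ol dl sl.
pose k p := (clip a b p.1, clip a b p.2).
have := TV_list H (L := map k l) (l := [::]); rewrite cats0 => H1.
rewrite -lee_fin -sumEFin.
apply: le_trans (H1 _ _ _).
- rewrite big_nil adde0 big_map big_seq [leRHS]big_seq; apply: lee_sum => p pl.
  have op : p.1 <= p.2 by have /allP := ol; apply.
  by rewrite -tvfB// ger0_norm// subr_ge0 tvf_nd.
- by rewrite all_map; apply: sub_all ol => p; exact: clip_le.
- rewrite pairwise_map; apply: sub_pairwise dl => p q /orP[] pq; rewrite /disj/=.
    by rewrite (clip_le a b pq).
  by rewrite (clip_le a b pq) orbT.
- apply: le_lt_trans sl; rewrite big_map big_seq [leRHS]big_seq; apply: ler_sum => p pl.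
  by apply: clip_lip; have /allP := ol; apply.
Qed.

Lemma tvfB_nd : {homo (fun x => tvf x - F x) : x y / x <= y}.
Proof.
by move=> x y /tvf_ge; rewrite ler_norml; lra.
Qed.

Lemma tvfB_lac : lac (fun x => tvf x - F x).
Proof.
move=> e e0; have e2 : 0 < e / 2 by rewrite divr_gt0.
have [d d0 H] := Fl e2; have [d' d'0 H'] := tvf_lac e2.
exists (Num.min d d') => [|l ol dl]; first by rewrite lt_min d0.
rewrite lt_min => /andP[ld ld'].
rewrite [leRHS](_ : e = e / 2 + e / 2); last by lra.
apply: le_trans (lerD (H' l ol dl ld') (H l ol dl ld)).
rewrite -big_split/=; apply: ler_sum => p _.
rewrite [X in `|X|](_ : _ = (tvf p.2 - tvf p.1) - (F p.2 - F p.1)); last by ring.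
exact: ler_normB.
Qed.

End TVfun.

(** Jordan decomposition: the clamped f is the difference of [tvf] and [tvf - F], which are both
    nondecreasing and absolutely continuous, hence have Radon-Nikodym densities. *)
Lemma rAC_density a b f : a <= b -> rAC a b f ->
  exists g, mu.-integrable `[a, b] (EFin \o g) /\
    forall x y, a <= x -> x <= y -> y <= b -> f y - f x = \int[mu]_(t in `[x, y]) g t.
Proof.
move=> ab fAC; set F := f \o clip a b.
have Fl : lac F by exact: rAC_lac.
have Fc x : F (clip a b x) = F x by rewrite /F/= (@clip_id _ _ _ (clip a b x))// clip_itv.
have [g [ig gE]] := nd_lac_density a b (tvf_nd ab Fl Fc) (tvf_lac ab Fl Fc).
have [h [ih hE]] := nd_lac_density a b (tvfB_nd ab Fl Fc) (tvfB_lac ab Fl Fc).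
exists (fun x => g x - h x); split.
  have := integrableB _ ig ih; exact.
move=> x y ax xy yb.
have sub : `[x, y]%classic `<=` `[a, b] by apply: subset_itv; rewrite bnd_simp.
rewrite RintegralB//; last 2 first.
  by apply: integrableS ig.
  by apply: integrableS ih.
rewrite -gE// -hE//.
have -> : f y = F y by rewrite /F/= clip_id// yb (le_trans ax).
have -> : f x = F x by rewrite /F/= clip_id// ax (le_trans xy).
by ring.
Qed.

(** The signed primitive vanishing at 0: for x other than 0, one of the two ranges of integration is
    empty. *)
Definition prim g x := \int[mu]_(t in `[0, x]) g t - \int[mu]_(t in `[x, 0]) g t.

Lemma Rintegral_segment0 g x : \int[mu]_(t in `[x, x]) g t = 0.
Proof. by rewrite set_itv1 Rintegral_set1. Qed.

Lemma Rintegral_segment_lt g x y : y < x -> \int[mu]_(t in `[x, y]) g t = 0.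
Proof.
by move=> yx; rewrite set_itv_ge ?Rintegral_set0// bnd_simp -ltNge.
Qed.

Lemma prim0 g : prim g 0 = 0.
Proof. by rewrite /prim subrr. Qed.

Lemma rprim_prim g : locint g -> rprim (prim g) g.
Proof.
move=> gl; split=> // a b ab; have [mg ig] := gl; rewrite /prim.
have [a0|a0] := leP 0 a.
  have b0 : 0 <= b by apply: le_trans ab.
  rewrite (Rintegral_split a0 ab (ig _ _)).
  have E x : 0 <= x -> \int[mu]_(t in `[x, 0]) g t = 0.
    by rewrite le_eqVlt => /predU1P[<-|/Rintegral_segment_lt//]; exact: Rintegral_segment0.
  by rewrite !E//; ring.
have [b0|b0] := leP b 0.
  rewrite (Rintegral_split ab b0 (ig _ _)).
  have E x : x <= 0 -> \int[mu]_(t in `[0, x]) g t = 0.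
    by rewrite le_eqVlt => /predU1P[->|/Rintegral_segment_lt//]; exact: Rintegral_segment0.
  by rewrite !E ?(ltW a0)//; ring.
rewrite (Rintegral_split (ltW a0) (ltW b0) (ig _ _)).
by rewrite (Rintegral_segment_lt _ a0) (Rintegral_segment_lt _ b0); ring.
Qed.

Lemma derivable_seq f x : derivable f x 1 ->
  (n.+1%:R * (f (x + n.+1%:R^-1) - f x)) @[n --> \oo] --> derive1 f x.
Proof.
move=> df.
have cv : h^-1 *: (f (h + x) - f x) @[h --> 0^'] --> derive1 f x.
  have E : (fun h : R => h^-1 *: (f (h + x) - f x)) = (fun h : R => h^-1 *: ((f \o shift x) (h *: 1) - f x)).
    by apply/funext => h; rewrite /= [h *: 1]mulr1.
  by rewrite /derive1 E; exact: df.
have /cvgr_dnbhsP/(_ (fun n => n.+1%:R^-1)) := cv.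
have -> : (fun n => n.+1%:R * (f (x + n.+1%:R^-1) - f x)) =
    (fun n => n.+1%:R^-1^-1 *: (f (n.+1%:R^-1 + x) - f x)).
  by apply/funext => n; rewrite invrK (addrC x).
apply; split => //; last exact: cvg_harmonic.
Qed.

(* A Borel function which is the derivative wherever that exists. *)
Definition lderiv f x :=
  fine (limn_esup (fun n => (n.+1%:R * (f (x + n.+1%:R^-1) - f x))%:E)).

Lemma lderivE f x : derivable f x 1 -> lderiv f x = derive1 f x.
Proof.
move=> /derivable_seq df; rewrite /lderiv.
have : (EFin \o (fun n => n.+1%:R * (f (x + n.+1%:R^-1) - f x))) n @[n --> \oo] --> (derive1 f x)%:E.
  by apply: cvg_EFin; [exact: nearW|exact: df].
by move=> /cvg_limn_einf_sup[_ ->].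
Qed.

Lemma measurable_lderiv f : continuous f -> measurable_fun [set: R] (lderiv f).
Proof.
move=> cf; apply: measurableT_comp => //.
apply: measurable_fun_limn_esup => n; apply/measurable_EFinP.
apply: measurable_funM => //; apply: measurable_funB => //; last exact: continuous_measurable_fun.
apply: measurableT_comp; first exact: continuous_measurable_fun.
exact: measurable_funD.
Qed.

Lemma rAC_cont f : (forall a b, a <= b -> rAC a b f) -> continuous f.
Proof.
move=> fAC x; have xx : x - 1 <= x + 1 by lra.
have /lac_cont/(_ x) := rAC_lac xx (fAC _ _ xx).
rewrite /continuous_at/= (@clip_id _ _ _ x); last by lra.
apply: cvg_trans; apply: near_eq_cvg; near=> y; rewrite /= clip_id//; apply/andP; split; near: y.
  by apply: filterS (lt_nbhsr (_ : x - 1 < x)) => [y|]; [exact: ltW|lra].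
by apply: filterS (lt_nbhsl (_ : x < x + 1)) => [y|]; [exact: ltW|lra].
Unshelve. all: by end_near. Qed.

(** The densities found on each [[- n, n]] agree almost everywhere there with the single Borel
    function [lderiv f], which therefore serves on all intervals at once. *)
Lemma rAC_rprim f : (forall a b, a <= b -> rAC a b f) -> rprim f (lderiv f).
Proof.
move=> fAC.
have cf := rAC_cont fAC.
have mlf := measurable_lderiv cf.
have H (n : nat) : exists g, [/\ locint g, 
    {ae mu, forall x, `]- n%:R, n%:R[%classic x -> lderiv f x = g x} &
    forall x y, - n%:R <= x -> x <= y -> y <= n%:R -> f y - f x = \int[mu]_(t in `[x, y]) g t].
  have nn : - n%:R <= n%:R :> R by rewrite (@le_trans _ _ 0)// oppr_le0.
  have [g0 [ig0 g0E]] := rAC_density nn (fAC _ _ nn).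
  pose g := g0 \_ `[- n%:R, n%:R].
  have gl : locint g by apply: locintP; exact: integrable_locally.
  have gE x y : - n%:R <= x -> x <= y -> y <= n%:R -> f y - f x = \int[mu]_(t in `[x, y]) g t.
    move=> nx xy yn; rewrite g0E//; apply: eq_Rintegral => t.
    rewrite inE/= in_itv/= => /andP[xt ty]; rewrite /g patchE mem_set//= in_itv/=.
    by rewrite (le_trans nx)// (le_trans ty).
  exists g; split => //.
  have := rprim_ae (rprim_prim gl); apply: ae_imp => x [dp pE].
  rewrite /= in_itv/= => /andP[nx xn].
  have dp' : is_derive x 1 (prim g) (g x).
    exact: is_derive_derive1.
  have df : is_derive x 1 f (g x).
    apply: (near_eq_is_derive (f := fun y => prim g y + cst (f (- n%:R) - prim g (- n%:R)) y)).
      near=> y; have ny : - n%:R <= y by near: y; apply: filterS (lt_nbhsr nx) => y; exact: ltW.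
      have yn : y <= n%:R by near: y; apply: filterS (lt_nbhsl xn) => y; exact: ltW.
      have := gE _ _ (lexx _) ny yn; rewrite -(rprim_prim gl).2//=; lra.
    by rewrite -[g x]addr0; apply: is_deriveD.
  by rewrite (lderivE (@ex_derive _ _ _ _ _ _ _ df)) (derive1_is_derive df).
have H2 (n : nat) x y : - n%:R < x -> x <= y -> y < n%:R ->
   mu.-integrable `[x, y] (EFin \o lderiv f) /\ f y - f x = \int[mu]_(t in `[x, y]) lderiv f t.
  move=> nx xy yn; have [g [[mg ig] gae gE]] := H n.
  have aee : ae_eq mu `[x, y]%classic (EFin \o g) (EFin \o lderiv f).
    apply: ae_imp gae => t + tI; rewrite /= => <-//.
    by move: tI; rewrite /= !in_itv/= => /andP[xt ty]; rewrite (lt_le_trans nx)// (le_lt_trans ty).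
  have mE : measurable_fun `[x, y] (EFin \o lderiv f).
    by apply/measurable_EFinP; exact: measurable_funTS.
  have mE' : measurable_fun `[x, y] (EFin \o g).
    by apply/measurable_EFinP; exact: measurable_funTS.
  split; first apply: ae_integrable (ig x y) => //.
  rewrite gE ?(ltW nx) ?(ltW yn)// /Rintegral; congr fine.
  exact: ae_eq_integral.
have bnd x y : exists n : nat, - n%:R < x /\ y < n%:R.
  exists (Num.bound (`|x| + `|y|)).
  have : `|x| + `|y| < (Num.bound (`|x| + `|y|))%:R.
    by apply: archi_boundP; rewrite addr_ge0.
  have := ler_norm (- x); have := ler_norm y; rewrite normrN.
  have := normr_ge0 x; have := normr_ge0 y; split; lra.
split.
  split=> // a b; have [ab|ba] := leP a b.
    by have [n [na bn]] := bnd a b; have [] := H2 n a b na ab bn.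
  by rewrite set_itv_ge ?bnd_simp -?ltNge//; exact: integrable_set0.
by move=> a b ab; have [n [na bn]] := bnd a b; have [] := H2 n a b na ab bn.
Unshelve. all: by end_near. Qed.

End ACDensity.

(** * Calculus of primitives *)

Section RealPrimitives.
Context {R : realType}.
Local Notation mu := (@lebesgue_measure R).
Implicit Types (f g h u v : R -> R) (a b c x y e : R).

Lemma rprim_cont u g : rprim u g -> continuous u.
Proof. by move=> ug; apply: rAC_cont => a b _; exact: rprim_rAC ug. Qed.

Lemma rACM a b f g : continuous f -> continuous g ->
  rAC a b f -> rAC a b g -> rAC a b (fun x => f x * g x).
Proof.
move=> cf cg Hf Hg e e0.
have [M M0 fM] := cont_bounded a b cf; have [N N0 gN] := cont_bounded a b cg.
have K0 : 0 < M + N + 1 by lra.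
have e1 : 0 < e / (M + N + 1) by rewrite divr_gt0.
have [d d0 Hd] := Hf _ e1; have [d' d'0 Hd'] := Hg _ e1.
exists (Num.min d d') => [|n s t st tr]; first by rewrite lt_min d0.
rewrite lt_min => /andP[/(Hd _ _ _ st tr) Hfs /(Hd' _ _ _ st tr) Hgs].
set S1 := \sum_(i < n) _ in Hfs; set S2 := \sum_(i < n) _ in Hgs.
have S10 : 0 <= S1 by exact: sumr_ge0.
have S20 : 0 <= S2 by exact: sumr_ge0.
apply: (@le_lt_trans _ _ (M * S2 + N * S1)).
  rewrite !mulr_sumr -big_split/=; apply: ler_sum => i _.
  have [asi [sti tib]] := st i.
  rewrite [X in `|X|](_ : _ = f (t i) * (g (t i) - g (s i)) + g (s i) * (f (t i) - f (s i))); last by ring.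
  rewrite (le_trans (ler_normD _ _))// !normrM lerD// ler_wpM2r//.
    by apply: fM; rewrite tib (le_trans asi).
  by apply: gN; rewrite asi (le_trans sti).
have : M * S2 + N * S1 <= (M + N) * (e / (M + N + 1)).
  by rewrite mulrDl lerD// ler_wpM2l// ltW.
move=> /le_lt_trans; apply.
rewrite mulrA ltr_pdivrMr// mulrC ltr_pM2l//; lra.
Qed.

Lemma rprim_aeeq u g h : rprim u g -> locint h ->
  {ae mu, forall x, g x = h x} -> rprim u h.
Proof.
move=> [[mg ig] ug] hl gh; split=> // a b ab; rewrite ug//.
apply: ae_Rintegral => //; [exact: measurable_funTS..| |].
  by apply: measurable_funTS; case: hl.
by apply: ae_imp gh => x.
Qed.

(** Absolute continuity of the product supplies some density, and the pointwise Leibniz rule, valid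
    almost everywhere, identifies it. All integrations by parts below are instances of this. *)
Lemma rprimM u g v h : rprim u g -> rprim v h ->
  rprim (fun x => u x * v x) (fun x => g x * v x + u x * h x).
Proof.
move=> ug vh; have cu := rprim_cont ug; have cv := rprim_cont vh.
have /rAC_rprim uvp : forall a b, a <= b -> rAC a b (fun x => u x * v x).
  by move=> a b _; apply: rACM => //; [exact: rprim_rAC ug|exact: rprim_rAC vh].
apply: rprim_aeeq uvp _ _.
  apply: locintD; last by apply: locintMl => //; case: vh.
  by under eq_fun do rewrite mulrC; apply: locintMl => //; case: ug.
apply: ae_imp2 (rprim_ae ug) (rprim_ae vh) => x [du gE] [dv hE].
have d1 := is_derive_derive1 du gE; have d2 := is_derive_derive1 dv hE.
have d3 : is_derive x 1 (fun x => u x * v x) (g x * v x + u x * h x).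
  have d4 : is_derive x (1 : R) (u * v) (u x *: h x + v x *: g x) by exact: is_deriveM.
  by rewrite addrC mulrC [X in _ + X]mulrC; rewrite (mulrC (h x)).
rewrite lderivE; first exact: derive1_is_derive.
by case: d3.
Qed.

Lemma rprimD u g v h : rprim u g -> rprim v h ->
  rprim (fun x => u x + v x) (fun x => g x + h x).
Proof.
move=> [gl ug] [hl vh]; split; first exact: locintD.
move=> a b ab; rewrite RintegralD//; [|exact: gl.2|exact: hl.2].
by rewrite -ug// -vh//; ring.
Qed.

Lemma rprimZ k u g : rprim u g -> rprim (fun x => k * u x) (fun x => k * g x).
Proof.
move=> [gl ug]; split; first exact: locintZ.
by move=> a b ab; rewrite RintegralZl//; [rewrite -ug//; ring|exact: gl.2].
Qed.

Lemma rprimN u g : rprim u g -> rprim (fun x => - u x) (fun x => - g x).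
Proof.
by move=> /(rprimZ (-1)); under eq_fun do rewrite mulN1r;
   under [X in rprim _ X]eq_fun do rewrite mulN1r.
Qed.

Lemma rprimB u g v h : rprim u g -> rprim v h ->
  rprim (fun x => u x - v x) (fun x => g x - h x).
Proof. by move=> ug /rprimN; exact: rprimD. Qed.

Lemma rprim_cst k : rprim (fun=> k) (fun=> 0 : R).
Proof.
split; first by apply: locint_cont => x; exact: cvg_cst.
by move=> a b ab; rewrite subrr Rintegral_cst// mul0r.
Qed.

Lemma rprim_C1 u g : (forall x, is_derive x 1 u (g x)) -> continuous g -> rprim u g.
Proof.
move=> du cg; split; first exact: locint_cont.
move=> a b; rewrite le_eqVlt => /predU1P[->|ab].
  by rewrite subrr Rintegral_segment0.
have cu : continuous u.
  by move=> x; apply: differentiable_continuous; apply/derivable1_diffP; case: (du x).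
rewrite /Rintegral (@continuous_FTC2 _ g u)//.
- exact: continuous_subspaceT.
- split.
  + by move=> x _; case: (du x).
  + by apply: cvg_at_right_filter; exact: cu.
  + by apply: cvg_at_left_filter; exact: cu.
- by move=> x _; exact: derive1_is_derive.
Qed.

End RealPrimitives.

(** * Complex-valued functions *)

Local Open Scope complex_scope.
Local Notation Re := complex.Re.
Local Notation Im := complex.Im.
Local Notation "z ^*" := (Num.conj z) : complex_scope.

Section ComplexNumbers.
Context {R : rcfType}.
Implicit Types z w : R[i].

Lemma cReD z w : Re (z + w) = Re z + Re w. Proof. by case: z; case: w. Qed.
Lemma cImD z w : Im (z + w) = Im z + Im w. Proof. by case: z; case: w. Qed.
Lemma cReN z : Re (- z) = - Re z. Proof. by case: z. Qed.
Lemma cImN z : Im (- z) = - Im z. Proof. by case: z. Qed.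
Lemma cReM z w : Re (z * w) = Re z * Re w - Im z * Im w.
Proof. by case: z; case: w. Qed.
Lemma cImM z w : Im (z * w) = Re z * Im w + Im z * Re w.
Proof. by case: z; case: w. Qed.
Lemma cReJ z : Re z^* = Re z. Proof. by case: z. Qed.
Lemma cImJ z : Im z^* = - Im z. Proof. by case: z. Qed.
Lemma cRe0 : Re (0 : R[i]) = 0. Proof. by []. Qed.
Lemma cIm0 : Im (0 : R[i]) = 0. Proof. by []. Qed.
Lemma cReC (x : R) : Re x%:C = x. Proof. by []. Qed.
Lemma cImC (x : R) : Im x%:C = 0. Proof. by []. Qed.
Definition ReImE := (cReD, cImD, cReN, cImN, cReM, cImM, cReJ, cImJ, cRe0, cIm0, cReC, cImC).

Lemma complex_eq z w : Re z = Re w -> Im z = Im w -> z = w.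
Proof. by case: z; case: w => /= ? ? ? ? -> ->. Qed.

Lemma conjcD z w : (z + w)^* = z^* + w^*. Proof. exact: rmorphD. Qed.
Lemma conjcM z w : (z * w)^* = z^* * w^*. Proof. exact: rmorphM. Qed.
Lemma conjcN z : (- z)^* = - z^*. Proof. exact: rmorphN. Qed.

(** The squared modulus as a real number: being a polynomial in the two parts, it is accessible to
    [ring] and [nra] and avoids square roots throughout. *)
Definition csq z : R := Re z ^+ 2 + Im z ^+ 2.

Lemma csq_ge0 z : 0 <= csq z. Proof. by rewrite addr_ge0// sqr_ge0. Qed.

Lemma normcE z : normc z = Num.sqrt (csq z). Proof. by case: z. Qed.

Lemma sqr_normc z : normc z ^+ 2 = csq z.
Proof. by rewrite normcE sqr_sqrtr// csq_ge0. Qed.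

Lemma normc_ge0 z : 0 <= normc z. Proof. by rewrite normcE sqrtr_ge0. Qed.

Lemma csq0 : csq 0 = 0. Proof. by rewrite /csq/= expr0n addr0. Qed.

Lemma csq_eq0 z : csq z = 0 -> z = 0.
Proof.
rewrite /csq => /eqP; rewrite paddr_eq0 ?sqr_ge0// !sqrf_eq0 => /andP[/eqP r /eqP i].
exact: complex_eq.
Qed.

Lemma csqM z w : csq (z * w) = csq z * csq w.
Proof. by rewrite /csq cReM cImM; ring. Qed.

Lemma csqN z : csq (- z) = csq z.
Proof. by rewrite /csq cReN cImN; ring. Qed.

Lemma csqJ z : csq z^* = csq z.
Proof. by rewrite /csq cReJ cImJ; ring. Qed.

Lemma csqC (x : R) : csq x%:C = x ^+ 2.
Proof. by rewrite /csq cReC cImC; ring. Qed.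

Lemma csqD_le z w : csq (z + w) <= 2 * csq z + 2 * csq w.
Proof.
rewrite /csq !cReD !cImD; have := sqr_ge0 (Re z - Re w); have := sqr_ge0 (Im z - Im w).
rewrite !expr2; lra.
Qed.

Lemma csqB_le z w : csq (z - w) <= 2 * csq z + 2 * csq w.
Proof. by rewrite -(csqN w); exact: csqD_le. Qed.

Lemma mulJc z : z * z^* = (csq z)%:C.
Proof. by apply: complex_eq; rewrite !ReImE /csq; ring. Qed.

Lemma Re_le_normc z : `|Re z| <= normc z.
Proof. by rewrite normcE -sqrtr_sqr ler_wsqrtr// lerDl sqr_ge0. Qed.

Lemma Im_le_normc z : `|Im z| <= normc z.
Proof. by rewrite normcE -sqrtr_sqr ler_wsqrtr// lerDr sqr_ge0. Qed.

Lemma normc_le z : normc z <= `|Re z| + `|Im z|.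
Proof.
rewrite -ler_sqr ?nnegrE ?normc_ge0 ?addr_ge0// sqr_normc /csq sqrrD.
by rewrite !real_normK ?num_real// addrAC lerDl mulrn_wge0// mulr_ge0.
Qed.

Lemma normcM z w : normc (z * w) = normc z * normc w.
Proof. exact: ComplexField.Normc.normcM. Qed.

Lemma normcJ z : normc z^* = normc z.
Proof. by rewrite !normcE csqJ. Qed.

Lemma normcN z : normc (- z) = normc z.
Proof. by rewrite !normcE csqN. Qed.

Lemma normcC (x : R) : normc x%:C = `|x|.
Proof. by rewrite normcE csqC sqrtr_sqr. Qed.

Lemma normcD z w : normc (z + w) <= normc z + normc w.
Proof. exact: le_normcD. Qed.

Lemma normcB z w : normc (z - w) <= normc z + normc w.
Proof. by rewrite -(normcN w); exact: normcD. Qed.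

Lemma normc_prod_le z w : normc (z * w) <= (csq z + csq w) / 2.
Proof.
rewrite normcM -!sqr_normc; have := sqr_ge0 (normc z - normc w); rewrite !expr2; lra.
Qed.

End ComplexNumbers.

(** * Integrals of complex-valued functions *)

Section ComplexIntegrals.
Context {R : realType}.
Local Notation mu := (@lebesgue_measure R).
Implicit Types (f g h u v : R -> R[i]) (G : R -> R) (a b : R) (D : set R).

Definition cintable D f :=
  mu.-integrable D (EFin \o (fun x => Re (f x))) /\
  mu.-integrable D (EFin \o (fun x => Im (f x))).

Definition cint D f : R[i] :=
  (\int[mu]_(x in D) Re (f x)) +i* (\int[mu]_(x in D) Im (f x)).

Lemma cRe_cint D f : Re (cint D f) = \int[mu]_(x in D) Re (f x).
Proof. by []. Qed.

Lemma cIm_cint D f : Im (cint D f) = \int[mu]_(x in D) Im (f x).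
Proof. by []. Qed.

Lemma cmeasD f g : cmeasurable f -> cmeasurable g -> cmeasurable (fun x => f x + g x).
Proof.
by move=> [f1 f2] [g1 g2]; split; [under eq_fun do rewrite cReD|under eq_fun do rewrite cImD];
  apply: measurable_funD.
Qed.

Lemma cmeasN f : cmeasurable f -> cmeasurable (fun x => - f x).
Proof.
by move=> [f1 f2]; split; [under eq_fun do rewrite cReN|under eq_fun do rewrite cImN];
  apply: measurableT_comp.
Qed.

Lemma cmeasB f g : cmeasurable f -> cmeasurable g -> cmeasurable (fun x => f x - g x).
Proof. by move=> mf mg; apply: cmeasD => //; exact: cmeasN. Qed.

Lemma cmeasM f g : cmeasurable f -> cmeasurable g -> cmeasurable (fun x => f x * g x).
Proof.
move=> [f1 f2] [g1 g2]; split; [under eq_fun do rewrite cReM|under eq_fun do rewrite cImM].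
  by apply: measurable_funB; apply: measurable_funM.
by apply: measurable_funD; apply: measurable_funM.
Qed.

Lemma cmeasJ f : cmeasurable f -> cmeasurable (fun x => (f x)^*).
Proof.
move=> [f1 f2]; split; [under eq_fun do rewrite cReJ|under eq_fun do rewrite cImJ] => //.
exact: measurableT_comp.
Qed.

Lemma cmeasC G : measurable_fun [set: R] G -> cmeasurable (fun x => (G x)%:C).
Proof. by move=> mG; split. Qed.

Lemma cmeas_cst (c : R[i]) : cmeasurable (fun _ : R => c).
Proof. by split. Qed.

Lemma meas_csq f : cmeasurable f -> measurable_fun [set: R] (fun x => csq (f x)).
Proof.
by move=> [f1 f2]; apply: measurable_funD; apply: measurable_funX.
Qed.

Lemma meas_normc f : cmeasurable f -> measurable_fun [set: R] (fun x => normc (f x)).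
Proof.
move=> mf; under eq_fun do rewrite normcE.
apply: (measurableT_comp (f := @Num.sqrt R)); last exact: meas_csq.
by apply: continuous_measurable_fun; exact: sqrt_continuous.
Qed.

Lemma integrable_le D G (H : R -> R) : measurable D -> measurable_fun [set: R] G ->
  mu.-integrable D (EFin \o H) -> (forall x, D x -> `|G x| <= H x) ->
  mu.-integrable D (EFin \o G).
Proof.
move=> mD mG iH GH; apply: le_integrable iH => //=.
  by apply/measurable_EFinP; exact: measurable_funTS.
by move=> x Dx; rewrite lee_fin (le_trans (GH x Dx))// ler_norm.
Qed.

Lemma cintable_le D f G : measurable D -> cmeasurable f ->
  mu.-integrable D (EFin \o G) -> (forall x, D x -> normc (f x) <= G x) ->
  cintable D f.
Proof.
move=> mD [f1 f2] iG fG; split; apply: integrable_le iG _ => // x Dx.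
  exact: le_trans (Re_le_normc _) (fG x Dx).
exact: le_trans (Im_le_normc _) (fG x Dx).
Qed.

Lemma cintable_normc D f : measurable D -> cmeasurable f -> cintable D f ->
  mu.-integrable D (EFin \o (fun x => normc (f x))).
Proof.
move=> mD mf [i1 i2].
apply: (@integrable_le _ _ (fun x => `|Re (f x)| + `|Im (f x)|)) => //.
- exact: meas_normc.
- by apply: mintD => //; exact: mint_norm.
- by move=> x _; rewrite ger0_norm ?normc_ge0// normc_le.
Qed.

Lemma cintableD D f g : measurable D -> cintable D f -> cintable D g ->
  cintable D (fun x => f x + g x).
Proof.
move=> mD [f1 f2] [g1 g2]; split.
  by under eq_fun do rewrite cReD; exact: mintD.
by under eq_fun do rewrite cImD; exact: mintD.
Qed.

Lemma cintableZ D (c : R[i]) f : measurable D -> cintable D f ->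
  cintable D (fun x => c * f x).
Proof.
move=> mD [f1 f2]; split.
  under eq_fun do rewrite cReM.
  by apply: mintB => //; exact: mintZ.
under eq_fun do rewrite cImM.
by apply: mintD => //; exact: mintZ.
Qed.

Lemma cintableN D f : measurable D -> cintable D f -> cintable D (fun x => - f x).
Proof.
by move=> mD /(cintableZ (-1) mD); under eq_fun do rewrite mulN1r.
Qed.

Lemma cintableB D f g : measurable D -> cintable D f -> cintable D g ->
  cintable D (fun x => f x - g x).
Proof. by move=> mD fi gi; apply: cintableD => //; exact: cintableN. Qed.

Lemma cintableC D G : measurable D -> mu.-integrable D (EFin \o G) ->
  cintable D (fun x => (G x)%:C).
Proof. by move=> mD iG; split => //=; exact: mint0. Qed.

Lemma eq_cint D f g : {in D, f =1 g} -> cint D f = cint D g.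
Proof.
by move=> fg; rewrite /cint; congr (_ +i* _); apply: eq_Rintegral => x /fg ->.
Qed.

Lemma cint_aeeq D f g : measurable D -> cmeasurable f -> cmeasurable g ->
  {ae mu, forall x, D x -> f x = g x} -> cint D f = cint D g.
Proof.
move=> mD [f1 f2] [g1 g2] fg; rewrite /cint; congr (_ +i* _); apply: ae_Rintegral => //;
  rewrite ?measurable_funTS//; try exact: measurable_funTS.
  by apply: ae_imp fg => x H /H ->.
by apply: ae_imp fg => x H /H ->.
Qed.

Lemma cintD D f g : measurable D -> cintable D f -> cintable D g ->
  cint D (fun x => f x + g x) = cint D f + cint D g.
Proof.
move=> mD [f1 f2] [g1 g2]; apply: complex_eq.
  by rewrite cReD !cRe_cint; under eq_Rintegral do rewrite cReD; rewrite RintegralD.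
by rewrite cImD !cIm_cint; under eq_Rintegral do rewrite cImD; rewrite RintegralD.
Qed.

Lemma cintZ D (c : R[i]) f : measurable D -> cintable D f ->
  cint D (fun x => c * f x) = c * cint D f.
Proof.
move=> mD [f1 f2]; apply: complex_eq.
  rewrite cReM !cRe_cint cIm_cint; under eq_Rintegral do rewrite cReM.
  rewrite RintegralB//; [|exact: mintZ..].
  by rewrite !RintegralZl.
rewrite cImM cRe_cint !cIm_cint; under eq_Rintegral do rewrite cImM.
rewrite RintegralD//; [|exact: mintZ..].
by rewrite !RintegralZl.
Qed.

Lemma cintN D f : measurable D -> cintable D f ->
  cint D (fun x => - f x) = - cint D f.
Proof.
by move=> mD fi; under eq_cint do rewrite -mulN1r; rewrite cintZ// mulN1r.
Qed.

Lemma cintB D f g : measurable D -> cintable D f -> cintable D g ->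
  cint D (fun x => f x - g x) = cint D f - cint D g.
Proof.
by move=> mD fi gi; rewrite cintD ?cintN//; exact: cintableN.
Qed.

Lemma cintJ D f : measurable D -> cintable D f ->
  cint D (fun x => (f x)^*) = (cint D f)^*.
Proof.
move=> mD [f1 f2]; apply: complex_eq.
  by rewrite cReJ !cRe_cint; under eq_Rintegral do rewrite cReJ.
rewrite cImJ !cIm_cint; under eq_Rintegral do rewrite cImJ -mulN1r.
by rewrite RintegralZl// mulN1r.
Qed.

Lemma Rintegral0 D : \int[mu]_(x in D) (0 : R) = 0.
Proof. by rewrite /Rintegral integral0. Qed.

Lemma cintC D G : cint D (fun x => (G x)%:C) = (\int[mu]_(x in D) G x)%:C.
Proof. by rewrite /cint/= Rintegral0. Qed.

(** Rotation: with z the integral of f, |z|^2 is the real part of the integral of conj z times f,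
    which is at most |z| times the integral of |f|. *)
Lemma normc_cint_le D f : measurable D -> cmeasurable f -> cintable D f ->
  normc (cint D f) <= \int[mu]_(x in D) normc (f x).
Proof.
move=> mD mf fi; set z := cint D f.
have I0 : 0 <= \int[mu]_(x in D) normc (f x).
  by apply: Rintegral_ge0 => x _; exact: normc_ge0.
have [->//|z0] := eqVneq (normc z) 0.
have {}z0 : 0 < normc z by rewrite lt_def z0 normc_ge0.
rewrite -(ler_pM2l z0) -expr2 sqr_normc.
have -> : csq z = Re (cint D (fun x => z^* * f x)).
  by rewrite cintZ// mulrC mulJc.
rewrite /cint/= -RintegralZl//; last exact: cintable_normc.
apply: le_Rintegral => //.
- by case: (cintableZ z^* mD fi).
- by apply: mintZ => //; exact: cintable_normc.
- move=> x _; rewrite (le_trans (ler_norm _))// (le_trans (Re_le_normc _))//.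
  by rewrite normcM normcJ.
Qed.

End ComplexIntegrals.

(** * Primitives of complex-valued functions *)

Section ComplexPrimitives.
Context {R : realType}.
Local Notation mu := (@lebesgue_measure R).
Implicit Types (f g h u v : R -> R[i]) (G : R -> R) (a b : R) (D : set R) (c : R[i]).

Definition clocint f := locint (fun x => Re (f x)) /\ locint (fun x => Im (f x)).

Definition cprim u g := rprim (fun x => Re (u x)) (fun x => Re (g x)) /\
  rprim (fun x => Im (u x)) (fun x => Im (g x)).

Definition ccont u := continuous (fun x => Re (u x)) /\ continuous (fun x => Im (u x)).

Lemma clocint_meas f : clocint f -> cmeasurable f.
Proof. by case=> [[? _] [? _]]. Qed.

Lemma clocint_itv f a b : clocint f -> cintable `[a, b] f.
Proof. by case=> [[_ ?] [_ ?]]; split. Qed.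

Lemma clocint_le f G : cmeasurable f -> locint G -> (forall x, normc (f x) <= G x) ->
  clocint f.
Proof.
move=> [f1 f2] Gl fG; split; apply: locint_le Gl _ => // x.
  exact: le_trans (Re_le_normc _) (fG x).
exact: le_trans (Im_le_normc _) (fG x).
Qed.

Lemma clocintP f : cmeasurable f -> (forall a b, cintable `[a, b] f) -> clocint f.
Proof. by move=> [f1 f2] H; split; split=> // a b; case: (H a b). Qed.

Lemma clocintD f g : clocint f -> clocint g -> clocint (fun x => f x + g x).
Proof.
move=> fl gl; apply: clocintP; first by apply: cmeasD; exact: clocint_meas.
by move=> a b; apply: cintableD => //; exact: clocint_itv.
Qed.

Lemma clocintZ c f : clocint f -> clocint (fun x => c * f x).
Proof.
move=> fl; apply: clocintP; first by apply: cmeasM; [exact: cmeas_cst|exact: clocint_meas].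
by move=> a b; apply: cintableZ => //; exact: clocint_itv.
Qed.

Lemma clocintN f : clocint f -> clocint (fun x => - f x).
Proof. by move=> /(clocintZ (-1)); under eq_fun do rewrite mulN1r. Qed.

Lemma clocintB f g : clocint f -> clocint g -> clocint (fun x => f x - g x).
Proof. by move=> fl gl; apply: clocintD => //; exact: clocintN. Qed.

Lemma clocint_normc f : clocint f -> locint (fun x => normc (f x)).
Proof.
move=> fl; split; first by apply: meas_normc; exact: clocint_meas.
by move=> a b; apply: cintable_normc => //; [exact: clocint_meas|exact: clocint_itv].
Qed.

Lemma clocintMl u f : ccont u -> clocint f -> clocint (fun x => u x * f x).
Proof.
move=> [u1 u2] [f1 f2]; split.
  by under eq_fun do rewrite cReM; apply: locintB; apply: locintMl.
by under eq_fun do rewrite cImM; apply: locintD; apply: locintMl.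
Qed.

Lemma clocint_cont u : ccont u -> clocint u.
Proof. by move=> [u1 u2]; split; exact: locint_cont. Qed.

Lemma clocint_csq f g : cmeasurable f -> cmeasurable g ->
  locint (fun x => csq (f x)) -> locint (fun x => csq (g x)) ->
  clocint (fun x => f x * g x).
Proof.
move=> mf mg fl gl.
apply: (clocint_le (cmeasM mf mg) (locintD fl gl)) => x.
rewrite (le_trans (normc_prod_le _ _))//.
by have := csq_ge0 (f x); have := csq_ge0 (g x); lra.
Qed.

Lemma cont_csq u : ccont u -> continuous (fun x => csq (u x)).
Proof.
move=> [u1 u2] x; rewrite /continuous_at /csq.
by apply: cvgD; under eq_fun do rewrite expr2; rewrite expr2; apply: cvgM; first [exact: u1|exact: u2].
Qed.

Lemma ccont_meas u : ccont u -> cmeasurable u.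
Proof. by move=> /clocint_cont/clocint_meas. Qed.

Lemma ccontM u v : ccont u -> ccont v -> ccont (fun x => u x * v x).
Proof.
move=> [u1 u2] [v1 v2]; split => x.
  have -> : (fun x => Re (u x * v x)) = (fun x => Re (u x) * Re (v x) - Im (u x) * Im (v x)).
    by apply/funext => y; rewrite cReM.
  by apply: cvgB; apply: cvgM; first [exact: u1|exact: u2|exact: v1|exact: v2].
have -> : (fun x => Im (u x * v x)) = (fun x => Re (u x) * Im (v x) + Im (u x) * Re (v x)).
  by apply/funext => y; rewrite cImM.
by apply: cvgD; apply: cvgM; first [exact: u1|exact: u2|exact: v1|exact: v2].
Qed.

Lemma ccontJ u : ccont u -> ccont (fun x => (u x)^*).
Proof.
move=> [u1 u2]; split => x; first by under eq_fun do rewrite cReJ; exact: u1.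
by under eq_fun do rewrite cImJ; apply: cvgN; exact: u2.
Qed.

Lemma cprim_cont u g : cprim u g -> ccont u.
Proof. by move=> [u1 u2]; split; [exact: rprim_cont u1|exact: rprim_cont u2]. Qed.

Lemma cprim_locint u g : cprim u g -> clocint g.
Proof. by move=> [[? _] [? _]]; split. Qed.

Lemma cprim_meas u g : cprim u g -> cmeasurable u.
Proof. by move=> /cprim_cont/ccont_meas. Qed.

Lemma cprimB_int u g a b : cprim u g -> a <= b -> u b - u a = cint `[a, b] g.
Proof.
by move=> [[_ u1] [_ u2]] ab; apply: complex_eq; rewrite !ReImE ?cRe_cint ?cIm_cint ?u1 ?u2.
Qed.

Lemma cprimP u g : clocint g -> (forall a b, a <= b -> u b - u a = cint `[a, b] g) ->
  cprim u g.
Proof.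
move=> [g1 g2] ug; split; split=> // a b ab.
  by rewrite -cReN -cReD ug.
by rewrite -cImN -cImD ug.
Qed.

Lemma cprimM u g v h : cprim u g -> cprim v h ->
  cprim (fun x => u x * v x) (fun x => g x * v x + u x * h x).
Proof.
move=> [u1 u2] [v1 v2]; split.
  under eq_fun do rewrite cReM; under [X in rprim _ X]eq_fun do rewrite cReD !cReM.
  have := rprimB (rprimM u1 v1) (rprimM u2 v2).
  by congr rprim; apply/funext => x /=; ring.
under eq_fun do rewrite cImM; under [X in rprim _ X]eq_fun do rewrite cImD !cImM.
have := rprimD (rprimM u1 v2) (rprimM u2 v1).
by congr rprim; apply/funext => x /=; ring.
Qed.

Lemma cprimD u g v h : cprim u g -> cprim v h ->
  cprim (fun x => u x + v x) (fun x => g x + h x).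
Proof.
move=> [u1 u2] [v1 v2]; split.
  by under eq_fun do rewrite cReD; under [X in rprim _ X]eq_fun do rewrite cReD; exact: rprimD.
by under eq_fun do rewrite cImD; under [X in rprim _ X]eq_fun do rewrite cImD; exact: rprimD.
Qed.

Lemma cprim_cst c : cprim (fun=> c) (fun=> 0 : R[i]).
Proof. by split; exact: rprim_cst. Qed.

Lemma cprimZ c u g : cprim u g -> cprim (fun x => c * u x) (fun x => c * g x).
Proof.
move=> ug; have := cprimM (cprim_cst c) ug.
by congr cprim; apply/funext => x /=; rewrite mul0r add0r.
Qed.

Lemma cprimJ u g : cprim u g -> cprim (fun x => (u x)^*) (fun x => (g x)^*).
Proof.
move=> [u1 u2]; split.
  by under eq_fun do rewrite cReJ; under [X in rprim _ X]eq_fun do rewrite cReJ.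
by under eq_fun do rewrite cImJ; under [X in rprim _ X]eq_fun do rewrite cImJ; exact: rprimN.
Qed.

Lemma cprimC (p q : R -> R) : rprim p q -> cprim (fun x => (p x)%:C) (fun x => (q x)%:C).
Proof. by move=> pq; split=> //=; exact: rprim_cst. Qed.

Lemma cprim_csq u g : cprim u g ->
  rprim (fun x => csq (u x)) (fun x => 2 * Re (g x * (u x)^*)).
Proof.
move=> ug; have [+ _] := cprimM ug (cprimJ ug).
by congr rprim; apply/funext => x /=; rewrite !ReImE /csq; ring.
Qed.

Definition cprimitive g : R -> R[i] :=
  fun x => prim (fun t => Re (g t)) x +i* prim (fun t => Im (g t)) x.

Lemma cprim_cprimitive g : clocint g -> cprim (cprimitive g) g.
Proof. by move=> [g1 g2]; split; exact: rprim_prim. Qed.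

Lemma cprimitive0 g : cprimitive g 0 = 0.
Proof. by rewrite /cprimitive !prim0. Qed.

Lemma cprim_cderive u g : cprim u g -> aeeq (cderive u) g.
Proof.
move=> [u1 u2]; apply: ae_imp2 (rprim_ae u1) (rprim_ae u2) => x [_ d1] [_ d2].
by rewrite /cderive d1 d2; case: (g x).
Qed.

Lemma cprim_AC u g : cprim u g -> AC_loc u.
Proof.
move=> [u1 u2] a b ab e e0; have e2 : 0 < e / 2 by rewrite divr_gt0.
have [d d0 H] := rprim_rAC a b u1 e2; have [d' d'0 H'] := rprim_rAC a b u2 e2.
exists (Num.min d d') => [|n s t st tr]; first by rewrite lt_min d0.
rewrite lt_min => /andP[/(H _ _ _ st tr) Hr /(H' _ _ _ st tr) Hi].
apply: (@le_lt_trans _ _ (\sum_(i < n) (`|Re (u (t i)) - Re (u (s i))| +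
    `|Im (u (t i)) - Im (u (s i))|))).
  by apply: ler_sum => i _; rewrite -cReN -cReD -cImN -cImD; exact: normc_le.
rewrite big_split/=; move: Hr Hi; set S1 := \sum_(_ < _) _; set S2 := \sum_(_ < _) _; lra.
Qed.

Lemma AC_cprim u : AC_loc u -> exists g, cprim u g.
Proof.
move=> uAC; exists (fun x => lderiv (fun t => Re (u t)) x +i* lderiv (fun t => Im (u t)) x).
split; apply: rAC_rprim => a b ab e e0; have [d d0 H] := uAC a b ab e e0;
  exists d => // n s t st tr ld; apply: le_lt_trans (H n s t st tr ld);
  apply: ler_sum => i _.
  by rewrite -cReN -cReD; exact: Re_le_normc.
by rewrite -cImN -cImD; exact: Im_le_normc.
Qed.

(** The difference integrates to 0 over every interval; by continuity it is the derivative of that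
    integral at each point, hence 0. This makes the continuous representatives in the domain of the
    maximal operator unique. *)
Lemma ccont_ae_eq u v : ccont u -> ccont v -> aeeq u v -> u = v.
Proof.
move=> cu cv uv.
have L (f1 f2 : R -> R) : continuous f1 -> continuous f2 ->
    {ae mu, forall x, f1 x = f2 x} -> f1 = f2.
  move=> c1 c2 f12.
  pose P := prim (fun x => f1 x - f2 x).
  have cB : continuous (fun x => f1 x - f2 x) by move=> x; apply: cvgB; [exact: c1|exact: c2].
  have P1 : rprim P (fun x => f1 x - f2 x) by apply: rprim_prim; exact: locint_cont.
  have P2 : rprim P (fun=> 0).
    apply: rprim_aeeq P1 _ _; first by apply: locint_cont => x; exact: cvg_cst.
    by apply: ae_imp f12 => x ->; rewrite subrr.
  have I0 a b : a <= b -> \int[mu]_(x in `[a, b]) (f1 x - f2 x) = 0.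
    by move=> ab; rewrite -P1.2// P2.2// Rintegral0.
  apply/funext => x.
  have := @continuous_FTC1_closed R (fun x => f1 x - f2 x) (x - 1) x (x + 1).
  have x1 : x < x + 1 by lra.
  have x2 : x - 1 < x by lra.
  move=> /(_ x1 (P1.1.2 _ _) x2 (cB x)) [_].
  set F := (fun y => _); move=> dF.
  have : derive1 F x = 0.
    apply: derive1_is_derive; apply: (near_eq_is_derive (f := cst 0)).
    near=> y; rewrite /F I0//; apply/ltW; near: y; exact: lt_nbhsr.
  by rewrite dF => /eqP; rewrite subr_eq0 => /eqP.
apply/funext => x; apply: complex_eq.
  suff : (fun y => Re (u y)) = (fun y => Re (v y)) by move=> E; exact: (congr1 (fun f : R -> R => f x) E).
  apply: L; [exact: cu.1|exact: cv.1|].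
  by apply: ae_imp uv => y ->.
suff : (fun y => Im (u y)) = (fun y => Im (v y)) by move=> E; exact: (congr1 (fun f : R -> R => f x) E).
apply: L; [exact: cu.2|exact: cv.2|].
by apply: ae_imp uv => y ->.
Unshelve. all: by end_near. Qed.

End ComplexPrimitives.

(** * Stepanov estimates and the energy identity *)

Section Stepanov.
Context {R : realType}.
Local Notation mu := (@lebesgue_measure R).
Implicit Types (f g h u v w k F Q tau : R -> R[i]) (G V : R -> R) (a b : R) (D E : set R).

Lemma cReBC (z : R[i]) (x : R) : Re (z - x%:C) = Re z - x.
Proof. by case: z. Qed.

Lemma cImBC (z : R[i]) (x : R) : Im (z - x%:C) = Im z.
Proof. by case: z => a b /=; rewrite oppr0 addr0. Qed.

Lemma Rint_subset G D E : measurable D -> measurable E -> E `<=` D ->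
  mu.-integrable D (EFin \o G) -> (forall x, D x -> 0 <= G x) ->
  \int[mu]_(x in E) G x <= \int[mu]_(x in D) G x.
Proof.
move=> mD mE ED iG G0; have iE := mintS mD mE ED iG.
rewrite -lee_fin /Rintegral !fineK; [|exact: integrable_fin_num..].
apply: ge0_subset_integral => //; by have /measurable_int := iG.
Qed.

Lemma locint_mint G a b : locint G -> mu.-integrable `[a, b] (EFin \o G).
Proof. by case. Qed.

Lemma ereal_sup_real_bound (f : R -> \bar R) : (forall t, (0 <= f t)%E) ->
  (ereal_sup (range f) < +oo)%E -> exists2 M, 0 <= M & forall t, (f t <= M%:E)%E.
Proof.
move=> f0 fb; set S := ereal_sup _ in fb.
have fS t : (f t <= S)%E by apply: ereal_sup_ubound; exists t.
have S0 : (0 <= S)%E by apply: le_trans (fS 0).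
have Sfin : S \is a fin_num by rewrite ge0_fin_numE.
exists (fine S); first by rewrite fine_ge0.
by move=> t; rewrite fineK.
Qed.

Lemma Lp_unif_bound (p : R) f G : (forall x, normc (f x) `^ p = G x) -> Lp_unif p f ->
  locint G /\ exists2 M, 0 <= M & forall t, \int[mu]_(x in `[t, t + 1]) G x <= M.
Proof.
move=> fG [[mf +] fb].
rewrite (_ : (fun x => _) = G); last by apply/funext => x; rewrite fG.
move=> /locintP Gl; split => //.
have G0 x : 0 <= G x by rewrite -fG powR_ge0.
have [|M M0 HM] := ereal_sup_real_bound _ fb.
  by move=> t; apply: integral_ge0 => x _; rewrite lee_fin powR_ge0.
exists M => // t; rewrite -lee_fin /Rintegral fineK; last first.
  by apply: integrable_fin_num => //; exact: locint_mint.
by apply: le_trans (HM t); under eq_integral do rewrite -fG.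
Qed.

Lemma Lp_unif2 f : Lp_unif 2 f ->
  locint (fun x => csq (f x)) /\
  exists2 M, 0 <= M & forall t, \int[mu]_(x in `[t, t + 1]) csq (f x) <= M.
Proof.
apply: Lp_unif_bound => x.
by rewrite (powR_mulrn 2)// ?normc_ge0// sqr_normc.
Qed.

Lemma Lp_unif1 f : Lp_unif 1 f ->
  locint (fun x => normc (f x)) /\
  exists2 M, 0 <= M & forall t, \int[mu]_(x in `[t, t + 1]) normc (f x) <= M.
Proof. by apply: Lp_unif_bound => x; rewrite powRr1// normc_ge0. Qed.

Lemma locint_cont_csq u : ccont u -> locint (fun x => csq (u x)).
Proof. by move=> cu; apply: locint_cont; exact: cont_csq. Qed.

Lemma ae_locint_csq g h : cmeasurable h -> aeeq g h ->
  locint (fun x => csq (g x)) -> locint (fun x => csq (h x)).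
Proof.
move=> mh gh [mg ig]; split; first exact: meas_csq.
move=> a b; apply: ae_integrable (ig a b) => //.
  by apply/measurable_EFinP; apply: measurable_funTS; exact: meas_csq.
by apply: ae_imp gh => x /= -> _.
Qed.

Section SupEstimate.
Variables (u g : R -> R[i]).
Hypotheses (ug : cprim u g) (gl : locint (fun x => csq (g x))).

(** The derivative of |u|^2 is 2 Re (g conj u), bounded by e |g|^2 + e^-1 |u|^2. *)
Lemma csq_oscillation t e x y : 0 < e -> t <= x <= t + 1 -> t <= y <= t + 1 ->
  csq (u x) <= csq (u y) + (e * \int[mu]_(s in `[t, t + 1]) csq (g s)
    + e^-1 * \int[mu]_(s in `[t, t + 1]) csq (u s)).
Proof.
move=> e0 xt yt; have ul := locint_cont_csq (cprim_cont ug).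
have du := cprim_csq ug; have [dl _] := du.
suff H a b : t <= a -> a <= b -> b <= t + 1 -> `|csq (u b) - csq (u a)| <=
    e * \int[mu]_(s in `[t, t + 1]) csq (g s) + e^-1 * \int[mu]_(s in `[t, t + 1]) csq (u s).
  move: xt yt => /andP[tx xt] /andP[ty yt]; rewrite addrC -lerBlDr.
  have [xy|/ltW yx] := leP x y.
    by rewrite (le_trans _ (H x y tx xy yt))// distrC ler_norm.
  by rewrite (le_trans _ (H y x ty yx xt))// ler_norm.
move=> ta ab bt; rewrite (le_trans (rprim_norm_le du ab))//.
apply: (@le_trans _ _ (\int[mu]_(s in `[t, t + 1]) `|2 * Re (g s * (u s)^*)|)).
  apply: Rint_subset => //.
    by apply: subset_itv; rewrite bnd_simp.
  by apply: locint_mint; exact: locint_norm.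
rewrite -!RintegralZl//; [|exact: locint_mint..].
rewrite -RintegralD//; [|by apply: mintZ => //; exact: locint_mint..].
apply: le_Rintegral => //.
- by apply: locint_mint; exact: locint_norm.
- by apply: mintD => //; apply: mintZ => //; exact: locint_mint.
move=> s _; rewrite normrM ger0_norm//.
have := Re_le_normc (g s * (u s)^*); rewrite normcM normcJ -!sqr_normc.
set p := normc (g s); set q := normc (u s).
have p0 : 0 <= p by exact: normc_ge0.
have q0 : 0 <= q by exact: normc_ge0.
have : 0 <= e^-1 * (e * p - q) ^+ 2 by rewrite mulr_ge0 ?sqr_ge0// invr_ge0 ltW.
have -> : e^-1 * (e * p - q) ^+ 2 = e * p ^+ 2 + e^-1 * q ^+ 2 - 2 * (p * q).
  by field; rewrite gt_eqF.
lra.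
Qed.

(** The oscillation bound averaged over y in the unit interval. *)
Lemma sup_estimate t e x : 0 < e -> t <= x <= t + 1 ->
  csq (u x) <= (1 + e^-1) * \int[mu]_(s in `[t, t + 1]) csq (u s)
    + e * \int[mu]_(s in `[t, t + 1]) csq (g s).
Proof.
move=> e0 xt; have ul := locint_cont_csq (cprim_cont ug).
set K := e * \int[mu]_(s in `[t, t + 1]) csq (g s) + e^-1 * \int[mu]_(s in `[t, t + 1]) csq (u s).
have m1 : fine (mu `[t, t + 1]%classic) = 1.
  by rewrite lebesgue_measure_itv/= lte_fin ltrDl ltr01/=; lra.
have ic c : mu.-integrable `[t, t + 1] (EFin \o (fun=> c : R)).
  by apply: locint_mint; apply: locint_cont => y; exact: cvg_cst.
have : \int[mu]_(y in `[t, t + 1]) csq (u x) <= \int[mu]_(y in `[t, t + 1]) (csq (u y) + K).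
  apply: le_Rintegral => //.
    by apply: mintD => //; exact: locint_mint.
  by move=> y; rewrite /= in_itv/= => yt; exact: csq_oscillation.
rewrite Rintegral_cst// [X in _ <= X]RintegralD//; last exact: locint_mint.
by rewrite Rintegral_cst// !m1 !mulr1 /K; lra.
Qed.

End SupEstimate.

Lemma locintM_csq V u : locint V -> ccont u -> locint (fun x => V x * csq (u x)).
Proof.
move=> Vl cu; under eq_fun do rewrite mulrC; apply: locintMl => //; exact: cont_csq.
Qed.

(** The value of M (1 + e^-1) for e = 1 / (4 (M + 1)) in [sup_estimate]. This e makes M e at most 1
    / 4, and the added 1 keeps it defined for M = 0. *)
Definition stepanov_cst (M : R) := M * (1 + 4 * (M + 1)).

Lemma potential_unit V M u g t : locint V -> (forall x, 0 <= V x) -> 0 <= M ->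
  \int[mu]_(x in `[t, t + 1]) V x <= M ->
  cprim u g -> locint (fun x => csq (g x)) ->
  \int[mu]_(x in `[t, t + 1]) (V x * csq (u x)) <=
    4^-1 * \int[mu]_(x in `[t, t + 1]) csq (g x)
    + stepanov_cst M * \int[mu]_(x in `[t, t + 1]) csq (u x).
Proof.
move=> Vl V0 M0 VM ug gl; have cu := cprim_cont ug.
have e0 : 0 < (4 * (M + 1))^-1 by rewrite invr_gt0; lra.
set N := \int[mu]_(x in `[t, t + 1]) csq (g x).
set U := \int[mu]_(x in `[t, t + 1]) csq (u x).
have N0 : 0 <= N by apply: Rintegral_ge0 => x _; exact: csq_ge0.
have U0 : 0 <= U by apply: Rintegral_ge0 => x _; exact: csq_ge0.
set S := (1 + 4 * (M + 1)) * U + (4 * (M + 1))^-1 * N.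
have S0 : 0 <= S by rewrite addr_ge0// mulr_ge0//; [lra|exact: ltW].
apply: (@le_trans _ _ (\int[mu]_(x in `[t, t + 1]) (V x * S))).
  apply: le_Rintegral => //.
  - by apply: locint_mint; exact: locintM_csq.
  - by apply: locint_mint; under eq_fun do rewrite mulrC; exact: locintZ.
  move=> x; rewrite /= in_itv/= => xt; rewrite ler_wpM2l//.
  by have := sup_estimate ug gl e0 xt; rewrite invrK.
rewrite RintegralZr//; last exact: locint_mint.
rewrite (le_trans (ler_wpM2r S0 VM))// /S /stepanov_cst mulrDr mulrA addrC lerD2r mulrA ler_wpM2r//.
by rewrite ler_pdivrMr; lra.
Qed.

Lemma potential_segment V M u g t (n : nat) : locint V -> (forall x, 0 <= V x) -> 0 <= M ->
  (forall s, \int[mu]_(x in `[s, s + 1]) V x <= M) ->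
  cprim u g -> locint (fun x => csq (g x)) ->
  \int[mu]_(x in `[t, t + n%:R]) (V x * csq (u x)) <=
    4^-1 * \int[mu]_(x in `[t, t + n%:R]) csq (g x)
    + stepanov_cst M * \int[mu]_(x in `[t, t + n%:R]) csq (u x).
Proof.
move=> Vl V0 M0 VM ug gl; have cu := cprim_cont ug.
elim: n => [|n IH]; first by rewrite addr0 !Rintegral_segment0; lra.
have h1 : t <= t + n%:R by rewrite lerDl.
have h2 : t + n%:R <= t + n.+1%:R by rewrite lerD2l ler_nat.
have := potential_unit Vl V0 M0 (VM (t + n%:R)) ug gl.
have -> : t + n%:R + 1 = t + n.+1%:R by rewrite -natr1; ring.
move=> H.
rewrite (Rintegral_split h1 h2); last by apply: locint_mint; exact: locintM_csq.
rewrite (Rintegral_split h1 h2); last exact: locint_mint.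
rewrite (Rintegral_split h1 h2); last by apply: locint_mint; exact: locint_cont_csq.
move: IH H; lra.
Qed.

End Stepanov.

(** * The form integrand and integration by parts *)

Section Energy.
Context {R : realType}.
Local Notation mu := (@lebesgue_measure R).
Implicit Types (f g h u v w k F : R -> R[i]) (G : R -> R) (a b : R) (D E : set R).
Variables (Q tau : R -> R[i]).

Definition potential x := 4 * csq (Q x) + normc (tau x).

Lemma pot_ge0 x : 0 <= potential x.
Proof. by rewrite addr_ge0 ?normc_ge0// mulr_ge0// csq_ge0. Qed.

(* The integrand of the form t at (u, v), with g, h standing for u', v'. *)
Definition form_integrand u g v h (x : R) : R[i] :=
  g x * (h x)^* - Q x * (g x * (v x)^* + u x * (h x)^*) + tau x * u x * (v x)^*.

(** A crude symmetric majorant, used for integrability and dominated convergence; the sector comes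
    from the sharper [eform_diag]. *)
Lemma normc_eform u g v h x : normc (form_integrand u g v h x) <=
  csq (g x) + csq (h x) + potential x * (csq (u x) + csq (v x)).
Proof.
rewrite /form_integrand (le_trans (normcD _ _))// (le_trans (lerD (normcB _ _) (lexx _)))//.
rewrite !normcM normcJ (le_trans (lerD (lerD (lexx _) (ler_wpM2l (normc_ge0 _) (normcD _ _))) (lexx _)))//.
rewrite !normcM !normcJ /potential -!sqr_normc.
set p := normc (g x); set q := normc (h x); set r := normc (u x); set s := normc (v x).
set m := normc (Q x); set n := normc (tau x).
have n0 : 0 <= n by exact: normc_ge0.
have h1 := sqr_ge0 (p - q); have h2 := sqr_ge0 (p - m * s); have h3 := sqr_ge0 (q - m * r).
have h4 : 0 <= n * (r - s) ^+ 2 by rewrite mulr_ge0// sqr_ge0.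
have h5 : 0 <= n * (r ^+ 2 + s ^+ 2) by rewrite mulr_ge0// addr_ge0// sqr_ge0.
have h6 := sqr_ge0 (m * r); have h7 := sqr_ge0 (m * s).
move: h1 h2 h3 h4 h5 h6 h7; nra.
Qed.

(** The factor 4 in [potential] is what 2 |Q| |g| |u| <= |g|^2 / 4 + 4 |Q|^2 |u|^2 requires. *)
Lemma eform_diag u g x : normc (form_integrand u g u g x - (csq (g x))%:C) <=
  4^-1 * csq (g x) + potential x * csq (u x).
Proof.
rewrite /form_integrand mulJc.
have -> : (csq (g x))%:C - Q x * (g x * (u x)^* + u x * (g x)^*) +
  tau x * u x * (u x)^* - (csq (g x))%:C =
  tau x * u x * (u x)^* - Q x * (g x * (u x)^* + u x * (g x)^*) by ring.
rewrite (le_trans (normcB _ _))// !normcM normcJ.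
rewrite (le_trans (lerD (lexx _) (ler_wpM2l (normc_ge0 _) (normcD _ _))))//.
rewrite !normcM !normcJ /potential -!sqr_normc.
set p := normc (g x); set r := normc (u x).
set m := normc (Q x); set n := normc (tau x).
have h1 := sqr_ge0 (p / 2 - 2 * m * r).
move: h1; rewrite !expr2; nra.
Qed.

Lemma cmeas_eform u g v h : cmeasurable Q -> cmeasurable tau -> cmeasurable u ->
  cmeasurable g -> cmeasurable v -> cmeasurable h -> cmeasurable (form_integrand u g v h).
Proof.
move=> mQ mt m1 m2 m3 m4; apply: cmeasD.
  apply: cmeasB; first by apply: cmeasM => //; exact: cmeasJ.
  by apply: cmeasM => //; apply: cmeasD; apply: cmeasM => //; exact: cmeasJ.
by apply: cmeasM; [exact: cmeasM|exact: cmeasJ].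
Qed.

Section FormBounds.
Variables (C : R) (D : set R) (u g : R -> R[i]).
Hypotheses (mD : measurable D) (mE : cmeasurable (form_integrand u g u g)) (mg : cmeasurable g).
Hypothesis ig : mu.-integrable D (EFin \o (fun x => csq (g x))).
Hypothesis iV : mu.-integrable D (EFin \o (fun x => potential x * csq (u x))).
Local Notation N := (\int[mu]_(x in D) csq (g x)).
Local Notation U := (\int[mu]_(x in D) csq (u x)).
Hypothesis VC : \int[mu]_(x in D) (potential x * csq (u x)) <= 4^-1 * N + C * U.

Lemma cintable_eform_diag : cintable D (form_integrand u g u g).
Proof.
apply: (@cintable_le _ _ _ (fun x => 2 * csq (g x) + 2 * (potential x * csq (u x)))) => //.
  by apply: mintD => //; exact: mintZ.
by move=> x _; rewrite (le_trans (normc_eform _ _ _ _ _))//; lra.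
Qed.

(** One quarter of N comes from the pointwise bound [eform_diag], the other from [VC]. As this is a
    bound on the modulus, it controls the real and the imaginary part alike. *)
Lemma eform_bound : normc (cint D (form_integrand u g u g) - N%:C) <= 2^-1 * N + C * U.
Proof.
have ic : cintable D (fun x => (csq (g x))%:C) by exact: cintableC.
rewrite -cintC -cintB//; last exact: cintable_eform_diag.
apply: le_trans (normc_cint_le _ _ _) _ => //.
- apply: cmeasB => //; apply: cmeasC; exact: meas_csq.
- by apply: cintableB => //; exact: cintable_eform_diag.
apply: (@le_trans _ _ (\int[mu]_(x in D) (4^-1 * csq (g x) + potential x * csq (u x)))).
  apply: le_Rintegral => //.
  - apply: cintable_normc => //.
      by apply: cmeasB => //; apply: cmeasC; exact: meas_csq.
    by apply: cintableB => //; exact: cintable_eform_diag.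
  - by apply: mintD => //; exact: mintZ.
  - by move=> x _; exact: eform_diag.
rewrite RintegralD//; last exact: mintZ.
rewrite RintegralZl//; move: VC; lra.
Qed.

Lemma Re_eform : Re (cint D (form_integrand u g u g)) >= 2^-1 * N - C * U.
Proof.
have := le_trans (Re_le_normc _) eform_bound.
rewrite cReBC ler_norml => /andP[]; set A := Re _; set N := \int[mu]_(x in D) _; lra.
Qed.

Lemma Im_eform : `|Im (cint D (form_integrand u g u g))| <= 2^-1 * N + C * U.
Proof.
have := le_trans (Im_le_normc _) eform_bound.
by rewrite cImBC.
Qed.

End FormBounds.

(** The product rule for w conj v. Inserting w = g - Q u and k = - F - Q g + tau u turns its density
    k conj v + w conj h into the form integrand minus F conj v, so that Q is never
    differentiated. *)
Lemma boundary_identity u g w k F v h a b :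
  cmeasurable Q -> locint (fun x => csq (Q x)) ->
  clocint tau ->
  cprim u g -> cprim w k -> clocint F -> cprim v h -> locint (fun x => csq (h x)) ->
  aeeq w (fun x => g x - Q x * u x) ->
  aeeq k (fun x => - F x - Q x * g x + tau x * u x) -> a <= b ->
  w b * (v b)^* - w a * (v a)^* =
  cint `[a, b] (form_integrand u g v h) - cint `[a, b] (fun x => F x * (v x)^*).
Proof.
move=> mQ Ql tl ug wk Fl vh hl wE kE ab.
have mu_ := cprim_meas ug; have mg := clocint_meas (cprim_locint ug).
have mv := cprim_meas vh; have mh := clocint_meas (cprim_locint vh).
have mw := cprim_meas wk; have mk := clocint_meas (cprim_locint wk).
have mF := clocint_meas Fl; have mt := clocint_meas tl.
have cv := ccontJ (cprim_cont vh).
have gl : locint (fun x => csq (g x)).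
  apply: (@ae_locint_csq _ (fun x => w x + Q x * u x)) => //.
    by apply: ae_imp wE => x ->; rewrite subrK.
  apply: (@locint_le _ _ (fun x => 2 * csq (w x) + 2 * (csq (Q x) * csq (u x)))).
  - by apply: meas_csq; apply: cmeasD => //; exact: cmeasM.
  - apply: locintD; apply: locintZ; first exact: locint_cont_csq (cprim_cont wk).
    by apply: locintM_csq => //; exact: cprim_cont ug.
  - by move=> x; rewrite ger0_norm ?csq_ge0// -csqM; exact: csqD_le.
have potl : locint potential by apply: locintD; [exact: locintZ|exact: clocint_normc].
have ml := cmeas_eform mQ mt mu_ mg mv mh.
have el : clocint (form_integrand u g v h).
  apply: (clocint_le (G := fun x => csq (g x) + csq (h x) + (potential x * csq (u x) + potential x * csq (v x)))) => //.
    apply: locintD; first exact: locintD.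
    by apply: locintD; apply: locintM_csq => //; [exact: cprim_cont ug|exact: cprim_cont vh].
  by move=> x; rewrite -mulrDr; exact: normc_eform.
have Fv : clocint (fun x => F x * (v x)^*).
  by under eq_fun do rewrite mulrC; exact: clocintMl.
rewrite -cintB//; [|exact: clocint_itv..].
rewrite (cprimB_int (cprimM wk (cprimJ vh)) ab).
apply: cint_aeeq => //.
- by apply: cmeasD; apply: cmeasM => //; exact: cmeasJ.
- by apply: cmeasB => //; apply: cmeasM => //; exact: cmeasJ.
apply: ae_imp2 wE kE => x -> -> _; rewrite /form_integrand; ring.
Qed.

End Energy.

(** * Complex limits and dominated convergence *)

Section DominatedConvergence.
Context {R : realType}.
Local Notation mu := (@lebesgue_measure R).
Implicit Types (D : set R) (z w : R[i]) (zs ws : nat -> R[i]).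

Lemma Rint_dct D (f_ : nat -> R -> R) (f G : R -> R) : measurable D ->
  (forall n, measurable_fun [set: R] (f_ n)) -> measurable_fun [set: R] f ->
  (forall x, D x -> f_ n x @[n --> \oo] --> f x) ->
  (forall n x, D x -> `|f_ n x| <= G x) -> mu.-integrable D (EFin \o G) ->
  mu.-integrable D (EFin \o f) /\
  \int[mu]_(x in D) f_ n x @[n --> \oo] --> \int[mu]_(x in D) f x.
Proof.
move=> mD mf_ mf f_f fG iG.
have H := @dominated_convergence _ _ _ mu D mD (fun n => EFin \o f_ n) (EFin \o f) (EFin \o G).
case: H => [|||||If _ cv].
- by move=> n; apply/measurable_EFinP; exact: measurable_funTS (mf_ n).
- by apply/measurable_EFinP; exact: measurable_funTS.
- by apply: aeW => x Dx; apply: cvg_EFin; [exact: nearW|exact: f_f].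
- exact: iG.
- by apply: aeW => x n Dx; rewrite lee_fin fG.
split => //.
apply: fine_cvg; rewrite fineK//.
exact: integrable_fin_num.
Qed.

Definition ccvg (zs : nat -> R[i]) z :=
  (Re (zs n) @[n --> \oo] --> (Re z : R)) /\ (Im (zs n) @[n --> \oo] --> (Im z : R)).

Lemma ccvgD zs z ws w : ccvg zs z -> ccvg ws w -> ccvg (fun n => zs n + ws n) (z + w).
Proof.
move=> [z1 z2] [w1 w2]; split; [under eq_fun do rewrite cReD|under eq_fun do rewrite cImD].
  by rewrite cReD; exact: cvgD.
by rewrite cImD; exact: cvgD.
Qed.

Lemma ccvgM zs z ws w : ccvg zs z -> ccvg ws w -> ccvg (fun n => zs n * ws n) (z * w).
Proof.
move=> [z1 z2] [w1 w2]; split; [under eq_fun do rewrite cReM|under eq_fun do rewrite cImM].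
  by rewrite cReM; apply: cvgB; exact: cvgM.
by rewrite cImM; apply: cvgD; exact: cvgM.
Qed.

Lemma ccvg_cst z : ccvg (fun=> z) z.
Proof. by split; exact: cvg_cst. Qed.

Lemma ccvgN zs z : ccvg zs z -> ccvg (fun n => - zs n) (- z).
Proof.
move=> [z1 z2]; split; [under eq_fun do rewrite cReN|under eq_fun do rewrite cImN].
  by rewrite cReN; exact: cvgN.
by rewrite cImN; exact: cvgN.
Qed.

Lemma ccvgB zs z ws w : ccvg zs z -> ccvg ws w -> ccvg (fun n => zs n - ws n) (z - w).
Proof. by move=> zz /ccvgN ww; exact: ccvgD. Qed.

Lemma ccvg_unique zs z w : ccvg zs z -> ccvg zs w -> z = w.
Proof.
move=> [z1 z2] [w1 w2]; apply: complex_eq.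
  exact: (cvg_unique _ z1 w1).
exact: (cvg_unique _ z2 w2).
Qed.

Lemma cmeas_cvg (f_ : nat -> R -> R[i]) f : (forall n, cmeasurable (f_ n)) ->
  (forall x, ccvg (f_ ^~ x) (f x)) -> cmeasurable f.
Proof.
move=> mf ff; split.
  apply: (@measurable_fun_cvg _ _ _ _ (fun n x => Re (f_ n x))) => [n|x _]; first by case: (mf n).
  by case: (ff x).
apply: (@measurable_fun_cvg _ _ _ _ (fun n x => Im (f_ n x))) => [n|x _]; first by case: (mf n).
by case: (ff x).
Qed.

Lemma cint_dct D (f_ : nat -> R -> R[i]) f (G : R -> R) : measurable D ->
  (forall n, cmeasurable (f_ n)) -> cmeasurable f ->
  (forall x, D x -> ccvg (f_ ^~ x) (f x)) ->
  (forall n x, D x -> normc (f_ n x) <= G x) -> mu.-integrable D (EFin \o G) ->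
  cintable D f /\ ccvg (fun n => cint D (f_ n)) (cint D f).
Proof.
move=> mD mf_ [mf1 mf2] ff fG iG.
have [i1 c1] := @Rint_dct D (fun n x => Re (f_ n x)) (fun x => Re (f x)) G mD
  (fun n => (mf_ n).1) mf1 (fun x Dx => (ff x Dx).1)
  (fun n x Dx => le_trans (Re_le_normc _) (fG n x Dx)) iG.
have [i2 c2] := @Rint_dct D (fun n x => Im (f_ n x)) (fun x => Im (f x)) G mD
  (fun n => (mf_ n).2) mf2 (fun x Dx => (ff x Dx).2)
  (fun n x Dx => le_trans (Im_le_normc _) (fG n x Dx)) iG.
by split.
Qed.

End DominatedConvergence.

(** * The initial value problem *)

Section Picard.
Context {R : realType}.
Local Notation mu := (@lebesgue_measure R).
Implicit Types (f g h u v w : R -> R[i]) (G H : R -> R) (x t L : R).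

(** The integral over the segment between 0 and x without orientation, so that the Picard bounds are
    nonnegative on both sides of 0. *)
Definition uint G x := \int[mu]_(t in `[Num.min 0 x, Num.max 0 x]) G t.

Lemma uint_pos G x : 0 <= x -> uint G x = \int[mu]_(t in `[0, x]) G t.
Proof. by move=> x0; rewrite /uint (min_idPl x0) (max_idPr x0). Qed.

Lemma uint_neg G x : x <= 0 -> uint G x = \int[mu]_(t in `[x, 0]) G t.
Proof. by move=> x0; rewrite /uint (min_idPr x0) (max_idPl x0). Qed.

Lemma uint_le G H x : locint G -> locint H ->
  (forall t, Num.min 0 x <= t <= Num.max 0 x -> G t <= H t) -> uint G x <= uint H x.
Proof.
move=> Gl Hl GH; apply: (le_Rintegral _ (locint_mint _ _ Gl) (locint_mint _ _ Hl)) => //.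
Qed.

Lemma rprim_pow p q n : rprim p q ->
  rprim (fun x => p x ^+ n.+1) (fun x => n.+1%:R * (q x * p x ^+ n)).
Proof.
move=> pq; elim: n => [|n IH].
  by congr rprim : pq; apply/funext => x; rewrite ?expr1// expr0 mulr1 mul1r.
have := rprimM pq IH; congr rprim; apply/funext => x.
by rewrite -[n.+2%:R]natr1 !exprS; ring.
Qed.

(** The power rule that produces the factorials of the Picard bound. It is read off from powers of
    [prim A], which equals - [uint A] to the left of 0; there the signs cancel. *)
Lemma uint_pow (A : R -> R) x n : locint A -> (forall t, 0 <= A t) ->
  uint (fun t => A t * uint A t ^+ n) x = uint A x ^+ n.+1 / n.+1%:R.
Proof.
move=> Al A0; have pA := rprim_prim Al; have pn := rprim_pow n pA.
have n1 : n.+1%:R != 0 :> R by rewrite pnatr_eq0.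
have E a b : a <= b -> \int[mu]_(t in `[a, b]) (A t * prim A t ^+ n) =
    (prim A b ^+ n.+1 - prim A a ^+ n.+1) / n.+1%:R.
  move=> ab; rewrite pn.2// RintegralZl//; last first.
    apply: locint_mint; under eq_fun do rewrite mulrC.
    apply: locintMl => //; have := rprim_cont pA => cA.
    case: n {pn n1} => [|n]; first by under eq_fun do rewrite expr0; move=> y; exact: cvg_cst.
    exact: rprim_cont (rprim_pow n pA).
  by rewrite mulrC mulKf.
have [x0|x0] := leP 0 x.
  rewrite !uint_pos//.
  have -> : \int[mu]_(t in `[0, x]) A t = prim A x.
    by rewrite -(subr0 (prim A x)) -[X in _ - X](prim0 A) pA.2.
  transitivity (\int[mu]_(t in `[0, x]) (A t * prim A t ^+ n)).
    apply: eq_Rintegral => t; rewrite inE/= in_itv/= => /andP[t0 _].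
    by rewrite uint_pos// -pA.2// prim0 subr0.
  by rewrite E// prim0 expr0n/= subr0.
have {}x0 := ltW x0.
rewrite !uint_neg//.
have -> : \int[mu]_(t in `[x, 0]) A t = - prim A x.
  by rewrite -(sub0r (prim A x)) -[X in X - _](prim0 A) pA.2.
transitivity (\int[mu]_(t in `[x, 0]) ((-1) ^+ n * (A t * prim A t ^+ n))).
  apply: eq_Rintegral => t; rewrite inE/= in_itv/= => /andP[_ t0].
  have -> : uint A t = - prim A t by rewrite uint_neg// -pA.2// prim0 sub0r.
  by rewrite (exprNn (prim A t)) mulrCA.
rewrite RintegralZl//; last first.
  apply: locint_mint; under eq_fun do rewrite mulrC.
  apply: locintMl => //; have := rprim_cont pA => cA.
  case: n {pn n1 E} => [|n]; first by under eq_fun do rewrite expr0; move=> y; exact: cvg_cst.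
  exact: rprim_cont (rprim_pow n pA).
by rewrite E// prim0 expr0n/= sub0r (exprNn (prim A x)) (exprS (-1)); ring.
Qed.

Lemma uint_cont (A : R -> R) : locint A -> (forall t, 0 <= A t) -> continuous (uint A).
Proof.
move=> Al A0; have cA := rprim_cont (rprim_prim Al).
have -> : uint A = fun x => `|prim A x|.
  apply/funext => x; have [x0|/ltW x0] := leP 0 x.
    have E : \int[mu]_(t in `[0, x]) A t = prim A x.
      by rewrite -(rprim_prim Al).2// prim0 subr0.
    by rewrite uint_pos// E ger0_norm// -E Rintegral_ge0.
  have E : \int[mu]_(t in `[x, 0]) A t = - prim A x.
    by rewrite -(rprim_prim Al).2// prim0 sub0r.
  by rewrite uint_neg// E -normrN ger0_norm// -E Rintegral_ge0.
by move=> x; apply: cvg_norm; exact: cA.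
Qed.

Lemma normc_cprimitive h x : clocint h ->
  normc (cprimitive h x) <= uint (fun t => normc (h t)) x.
Proof.
move=> hl; have ph := cprim_cprimitive hl; have mh := clocint_meas hl.
have [x0|/ltW x0] := leP 0 x.
  rewrite uint_pos// -(subr0 (cprimitive h x)) -[X in _ - X](cprimitive0 h) (cprimB_int ph x0).
  by apply: normc_cint_le => //; exact: clocint_itv.
rewrite uint_neg// -normcN -(sub0r (cprimitive h x)) -[X in X - _](cprimitive0 h) (cprimB_int ph x0).
by apply: normc_cint_le => //; exact: clocint_itv.
Qed.

End Picard.

(** * Picard iteration for linear systems *)

Section LinearSystem.
Context {R : realType}.
Local Notation mu := (@lebesgue_measure R).

Lemma cprimitive_pos (h : R -> R[i]) x : clocint h -> 0 <= x ->
  cprimitive h x = cint `[0, x] h.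
Proof.
by move=> hl x0; rewrite -(cprimB_int (cprim_cprimitive hl) x0) cprimitive0 subr0.
Qed.

Lemma cprimitive_neg (h : R -> R[i]) x : clocint h -> x <= 0 ->
  cprimitive h x = - cint `[x, 0] h.
Proof.
by move=> hl x0; rewrite -(cprimB_int (cprim_cprimitive hl) x0) cprimitive0 sub0r opprK.
Qed.

Lemma cprimitiveB (f g : R -> R[i]) x : clocint f -> clocint g ->
  cprimitive f x - cprimitive g x = cprimitive (fun t => f t - g t) x.
Proof.
move=> fl gl; have fgl := clocintB fl gl; have [x0|/ltW x0] := leP 0 x.
  by rewrite !cprimitive_pos// cintB//; exact: clocint_itv.
by rewrite !cprimitive_neg// cintB//; [ring|exact: clocint_itv..].
Qed.

Lemma cont_normc (u : R -> R[i]) : ccont u -> continuous (fun x => normc (u x)).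
Proof.
move=> cu; have -> : (fun x => normc (u x)) = (fun x => Num.sqrt (csq (u x))).
  by apply/funext => x; rewrite normcE.
move=> x; apply: (@continuous_comp _ _ _ (fun x => csq (u x)) Num.sqrt).
  exact: cont_csq.
exact: sqrt_continuous.
Qed.

Lemma cvg_of_summable_increments (a c : nat -> R) :
  (forall n, `|a n.+1 - a n| <= c n) -> cvgn (series c) -> cvgn a.
Proof.
move=> ac cc.
have ct : cvgn (series (telescope a)).
  apply: normed_cvg; apply: series_le_cvg cc => n; rewrite ?normr_ge0//.
    exact: le_trans (ac n).
  exact: ac.
have -> : a = (fun n => a 0%N + series (telescope a) n).
  by apply/funext => n; exact: eq_sum_telescope.
apply: is_cvgD => //; exact: is_cvg_cst.
Qed.

Variables (al be ga de p q : R -> R[i]) (u0 w0 : R[i]).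
Hypotheses (all : clocint al) (bel : clocint be) (gal : clocint ga) (del : clocint de).
Hypotheses (pl : clocint p) (ql : clocint q).

Definition lin1 (u w : R -> R[i]) t := al t * u t + be t * w t.
Definition lin2 (u w : R -> R[i]) t := ga t * u t + de t * w t.

Lemma clocint_lin1 u w : ccont u -> ccont w -> clocint (lin1 u w).
Proof.
move=> cu cw; apply: clocintD.
  by under eq_fun do rewrite mulrC; exact: clocintMl.
by under eq_fun do rewrite mulrC; exact: clocintMl.
Qed.

Lemma clocint_lin2 u w : ccont u -> ccont w -> clocint (lin2 u w).
Proof.
move=> cu cw; apply: clocintD.
  by under eq_fun do rewrite mulrC; exact: clocintMl.
by under eq_fun do rewrite mulrC; exact: clocintMl.
Qed.

Fixpoint picard n : (R -> R[i]) * (R -> R[i]) :=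
  if n is m.+1 then
    (fun x => u0 + cprimitive (fun t => lin1 (picard m).1 (picard m).2 t + p t) x,
     fun x => w0 + cprimitive (fun t => lin2 (picard m).1 (picard m).2 t + q t) x)
  else (fun=> u0, fun=> w0).

Local Notation pu n := (picard n).1.
Local Notation pw n := (picard n).2.

Lemma picard_cont n : ccont (pu n) /\ ccont (pw n).
Proof.
elim: n => [|n [cu cw]].
  by split; [exact: cprim_cont (cprim_cst u0)|exact: cprim_cont (cprim_cst w0)].
split; apply: cprim_cont.
  apply: cprimD; first exact: cprim_cst.
  by apply: cprim_cprimitive; apply: clocintD => //; exact: clocint_lin1.
apply: cprimD; first exact: cprim_cst.
by apply: cprim_cprimitive; apply: clocintD => //; exact: clocint_lin2.
Qed.

Let cu n := (picard_cont n).1.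
Let cw n := (picard_cont n).2.

Definition coefn t := normc (al t) + normc (be t) + normc (ga t) + normc (de t).

Lemma locint_coefn : locint coefn.
Proof. by do 3! (apply: locintD; last exact: clocint_normc); exact: clocint_normc. Qed.

Lemma coefn_ge0 t : 0 <= coefn t.
Proof. by rewrite !addr_ge0 ?normc_ge0. Qed.

Definition pdist n x := normc (pu n.+1 x - pu n x) + normc (pw n.+1 x - pw n x).

Lemma pdist_ge0 n x : 0 <= pdist n x.
Proof. by rewrite addr_ge0 ?normc_ge0. Qed.

Lemma ccontB (u v : R -> R[i]) : ccont u -> ccont v -> ccont (fun x => u x - v x).
Proof.
move=> [u1 u2] [v1 v2]; split => x.
  by under eq_fun do rewrite cReD cReN; apply: cvgB; [exact: u1|exact: v1].
by under eq_fun do rewrite cImD cImN; apply: cvgB; [exact: u2|exact: v2].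
Qed.

Lemma pdist_cont n : continuous (pdist n).
Proof.
by move=> x; apply: cvgD; apply: cont_normc; apply: ccontB.
Qed.

Lemma pdist_step n x : pdist n.+1 x <= uint (fun t => coefn t * pdist n t) x.
Proof.
have l1 m : clocint (fun t => lin1 (pu m) (pw m) t + p t).
  by apply: clocintD => //; exact: clocint_lin1.
have l2 m : clocint (fun t => lin2 (pu m) (pw m) t + q t).
  by apply: clocintD => //; exact: clocint_lin2.
have d1 := ccontB (cu n.+1) (cu n).
have d2 := ccontB (cw n.+1) (cw n).
have k1 := clocint_lin1 d1 d2; have k2 := clocint_lin2 d1 d2.
have -> : pdist n.+1 x =
  normc (cprimitive (lin1 (fun t => pu n.+1 t - pu n t) (fun t => pw n.+1 t - pw n t)) x) +
  normc (cprimitive (lin2 (fun t => pu n.+1 t - pu n t) (fun t => pw n.+1 t - pw n t)) x).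
  rewrite /pdist; congr (normc _ + normc _).
    rewrite -[pu n.+2 x]/(u0 + cprimitive (fun t => lin1 (pu n.+1) (pw n.+1) t + p t) x).
    rewrite -[pu n.+1 x]/(u0 + cprimitive (fun t => lin1 (pu n) (pw n) t + p t) x).
    rewrite opprD addrACA subrr add0r cprimitiveB//; congr cprimitive.
    by apply/funext => t; rewrite /lin1; ring.
  rewrite -[pw n.+2 x]/(w0 + cprimitive (fun t => lin2 (pu n.+1) (pw n.+1) t + q t) x).
  rewrite -[pw n.+1 x]/(w0 + cprimitive (fun t => lin2 (pu n) (pw n) t + q t) x).
  rewrite opprD addrACA subrr add0r cprimitiveB//; congr cprimitive.
  by apply/funext => t; rewrite /lin2; ring.
rewrite (le_trans (lerD (normc_cprimitive x k1) (normc_cprimitive x k2)))//.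
rewrite /uint -RintegralD//; [|by apply: locint_mint; exact: clocint_normc..].
apply: le_Rintegral => //.
- by apply: mintD => //; apply: locint_mint; exact: clocint_normc.
- apply: locint_mint; under eq_fun do rewrite mulrC.
  by apply: locintMl; [exact: pdist_cont|exact: locint_coefn].
move=> t _; rewrite /lin1 /lin2 (le_trans (lerD (normcD _ _) (normcD _ _)))//.
rewrite !normcM /coefn /pdist.
have := normc_ge0 (al t); have := normc_ge0 (be t); have := normc_ge0 (ga t).
have := normc_ge0 (de t); have := normc_ge0 (pu n.+1 t - pu n t).
have := normc_ge0 (pw n.+1 t - pw n t).
move: (normc (al t)) (normc (be t)) (normc (ga t)) (normc (de t)) (normc _) (normc _).
by move=> a b c d e f f0 e0 d0 c0 b0 a0; nra.
Qed.

(** The coefficients are only locally integrable, so [uint coefn] takes the place of the distance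
    from 0: iterating [pdist_step] gives K (uint coefn)^n / n!, where K bounds the first increment
    on [[- L, L]], and B bounds [uint coefn] there. *)
Lemma pdist_bound L : exists K B, [/\ 0 <= K, 0 <= B &
  forall n x, `|x| <= L -> pdist n x <= K * exp_coeff B n].
Proof.
have [K K0 HK] := cont_bounded (- L) L (@pdist_cont 0%N).
have [B B0 HB] := cont_bounded (- L) L (uint_cont locint_coefn coefn_ge0).
exists K, B; split => // n x xL.
have U0 t : 0 <= uint coefn t by apply: Rintegral_ge0 => s _; exact: coefn_ge0.
have contU n' : continuous (fun t => uint coefn t ^+ n').
  move=> t; apply: (@continuous_comp _ _ _ (uint coefn) (fun y => y ^+ n')).
    exact: uint_cont locint_coefn coefn_ge0 t.
  exact: exprn_continuous.
have H m y : `|y| <= L -> pdist m y <= K * (uint coefn y ^+ m / m`!%:R).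
  elim: m y => [|m IH] y yL.
    rewrite expr0 fact0 divr1 mulr1 -[pdist 0 y]ger0_norm ?pdist_ge0//.
    by apply: HK; rewrite -ler_norml.
  apply: (le_trans (pdist_step m y)).
  have -> : K * (uint coefn y ^+ m.+1 / m.+1`!%:R) =
    uint (fun t => K / m`!%:R * (coefn t * uint coefn t ^+ m)) y.
    rewrite /uint RintegralZl//; last first.
      apply: locint_mint; under eq_fun do rewrite mulrC.
      by apply: locintMl => //; exact: locint_coefn.
    rewrite -/(uint (fun t => coefn t * uint coefn t ^+ m) y) uint_pow//; last 2 first.
      exact: locint_coefn.
      exact: coefn_ge0.
    rewrite -/(uint coefn y) factS natrM.
    have : m`!%:R != 0 :> R by rewrite pnatr_eq0 -lt0n fact_gt0.
    have : m.+1%:R != 0 :> R by rewrite pnatr_eq0.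
    by move: (m.+1%:R) (m`!%:R) => a b a0 b0; field; rewrite a0 b0.
  apply: uint_le.
  - under eq_fun do rewrite mulrC.
    by apply: locintMl; [exact: pdist_cont|exact: locint_coefn].
  - apply: locintZ; under eq_fun do rewrite mulrC.
    by apply: locintMl => //; exact: locint_coefn.
  move=> t tI.
  have tL : `|t| <= L.
    move: tI yL; rewrite !ler_norml; by have [y0|y0] := leP 0 y; lra.
  rewrite (le_trans (ler_wpM2l (coefn_ge0 t) (IH t tL)))//.
  by rewrite le_eqVlt; apply/orP; left; apply/eqP; ring.
rewrite (le_trans (H n x xL))// ler_wpM2l// /exp_coeff ler_wpM2r// ?invr_ge0//.
apply: lerXn2r; rewrite ?nnegrE//.
by rewrite -[X in X <= _]ger0_norm//; apply: HB; rewrite -ler_norml.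
Qed.

(** Existence in the sense of Caratheodory: the Picard iterates converge pointwise by summable
    increments, and the limit is taken in the integrated equations. *)
Theorem linear_system_solution : exists u w,
  [/\ u 0 = u0, w 0 = w0, cprim u (fun t => lin1 u w t + p t) &
      cprim w (fun t => lin2 u w t + q t)].
Proof.
pose u x : R[i] := limn (fun n => Re (pu n x)) +i* limn (fun n => Im (pu n x)).
pose w x : R[i] := limn (fun n => Re (pw n x)) +i* limn (fun n => Im (pw n x)).
have cv x : ccvg (fun n => pu n x) (u x) /\ ccvg (fun n => pw n x) (w x).
  have [K [B [K0 B0 HK]]] := pdist_bound `|x|.
  have ce : cvgn (series (fun n => K * exp_coeff B n)).
    have -> : (fun n => K * exp_coeff B n) = K *: exp_coeff B by apply/funext.
    by rewrite seriesZ; apply: is_cvgZr; exact: is_cvg_series_exp_coeff.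
  have H (zs : nat -> R[i]) : (forall n, normc (zs n.+1 - zs n) <= K * exp_coeff B n) ->
      ccvg zs (limn (fun n => Re (zs n)) +i* limn (fun n => Im (zs n))).
    move=> Hz; split.
      apply: (cvg_of_summable_increments (a := fun n => Re (zs n))) ce => n.
      by rewrite -cReN -cReD (le_trans (Re_le_normc _)).
    apply: (cvg_of_summable_increments (a := fun n => Im (zs n))) ce => n.
    by rewrite -cImN -cImD (le_trans (Im_le_normc _)).
  split; apply: H => n; apply: le_trans (HK n x (lexx _)); rewrite /pdist.
    by rewrite lerDl normc_ge0.
  by rewrite lerDr normc_ge0.
(* A bound uniform in n supplies the dominating function; K [expR B] bounds the sum of all
   increments. *)
have bd L : exists S, forall n x, `|x| <= L -> normc (pu n x) <= S /\ normc (pw n x) <= S.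
  have [K [B [K0 B0 HK]]] := pdist_bound L.
  exists (normc u0 + normc w0 + K * expR B) => n x xL.
  have : normc (pu n x) + normc (pw n x) <= normc u0 + normc w0 + K * series (exp_coeff B) n.
    elim: n => [|n IH]; first by rewrite /series/= big_geq// mulr0 addr0.
    rewrite seriesSr mulrDr addrA.
    apply: le_trans (lerD IH (HK n x xL)).
    have := normcD (pu n x) (pu n.+1 x - pu n x).
    have := normcD (pw n x) (pw n.+1 x - pw n x).
    by rewrite ![_ + (_ - _)]addrC !subrK /pdist; lra.
  have : K * series (exp_coeff B) n <= K * expR B.
    rewrite ler_wpM2l//; apply: nondecreasing_cvgn_le.
      apply/nondecreasing_seqP => m; rewrite seriesSr lerDl.
      by rewrite /exp_coeff/= divr_ge0// exprn_ge0.
    exact: is_cvg_series_exp_coeff.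
  by have := normc_ge0 (pu n x); have := normc_ge0 (pw n x); split; lra.
have mu_ n : cmeasurable (pu n) by apply: ccont_meas.
have mw_ n : cmeasurable (pw n) by apply: ccont_meas.
have mu' : cmeasurable u by apply: cmeas_cvg mu_ _ => x; case: (cv x).
have mw' : cmeasurable w by apply: cmeas_cvg mw_ _ => x; case: (cv x).
(* Both equations have this shape, with vs the first or the second component of the iterates. *)
have main (a b r : R -> R[i]) (vs : nat -> R -> R[i]) v : clocint a -> clocint b -> clocint r ->
    (forall n, cprim (vs n.+1) (fun t => a t * pu n t + b t * pw n t + r t)) ->
    (forall x, ccvg (vs ^~ x) (v x)) ->
    cprim v (fun t => a t * u t + b t * w t + r t).
  move=> la lb lr vsP vsv.
  have ma := clocint_meas la; have mb := clocint_meas lb; have mr := clocint_meas lr.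
  have mf : cmeasurable (fun t => a t * u t + b t * w t + r t).
    by apply: cmeasD => //; apply: cmeasD; exact: cmeasM.
  have key c d : cintable `[c, d] (fun t => a t * u t + b t * w t + r t) /\
      ccvg (fun n => cint `[c, d] (fun t => a t * pu n t + b t * pw n t + r t))
        (cint `[c, d] (fun t => a t * u t + b t * w t + r t)).
    have [S HS] := bd (`|c| + `|d|).
    apply: (@cint_dct _ _ _ _ (fun t => normc (a t) * S + normc (b t) * S + normc (r t))) => //.
    - by move=> n; apply: cmeasD => //; apply: cmeasD; exact: cmeasM.
    - move=> t _; apply: ccvgD; last exact: ccvg_cst.
      by apply: ccvgD; apply: ccvgM; first [exact: ccvg_cst|exact: (cv t).1|exact: (cv t).2].
    - move=> n t; rewrite /= in_itv/= => tI.
      have tL : `|t| <= `|c| + `|d|.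
        by move: tI; have := ler_norm (- c); have := ler_norm d; rewrite normrN ler_norml; have := normr_ge0 c; have := normr_ge0 d; lra.
      have [h1 h2] := HS n t tL.
      rewrite (le_trans (normcD _ _))// lerD2r (le_trans (normcD _ _))// !normcM.
      by rewrite lerD// ler_wpM2l// normc_ge0.
    - apply: locint_mint; apply: locintD; last exact: clocint_normc.
      by apply: locintD; under eq_fun do rewrite mulrC; apply: locintZ; exact: clocint_normc.
  apply: cprimP; first by apply: clocintP => // c d; case: (key c d).
  move=> c d cd; have [_ kc] := key c d.
  apply: ccvg_unique kc; under eq_fun do rewrite -(cprimB_int (vsP _) cd).
  have [h1 h2] := ccvgB (vsv d) (vsv c).
  by split; [rewrite (cvg_shiftS (fun n => Re (vs n d - vs n c)))|rewrite (cvg_shiftS (fun n => Im (vs n d - vs n c)))].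
have p1 n : cprim (pu n.+1) (fun t => al t * pu n t + be t * pw n t + p t).
  have := cprimD (cprim_cst u0) (cprim_cprimitive (clocintD (clocint_lin1 (cu n) (cw n)) pl)).
  by congr cprim; apply/funext => t; rewrite add0r.
have p2 n : cprim (pw n.+1) (fun t => ga t * pu n t + de t * pw n t + q t).
  have := cprimD (cprim_cst w0) (cprim_cprimitive (clocintD (clocint_lin2 (cu n) (cw n)) ql)).
  by congr cprim; apply/funext => t; rewrite add0r.
have z1 n : pu n 0 = u0 by case: n => //= n; rewrite cprimitive0 addr0.
have z2 n : pw n 0 = w0 by case: n => //= n; rewrite cprimitive0 addr0.
exists u, w; split.
- by apply: ccvg_unique (cv 0).1 _; under eq_fun do rewrite z1; exact: ccvg_cst.
- by apply: ccvg_unique (cv 0).2 _; under eq_fun do rewrite z2; exact: ccvg_cst.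
- by apply: main p1 _ => // x; exact: (cv x).1.
- by apply: main p2 _ => // x; exact: (cv x).2.
Qed.

End LinearSystem.

(** * m-sectorial operators in L^2 *)

Section SquareIntegrable.
Context {R : realType}.
Local Notation mu := (@lebesgue_measure R).
Implicit Types (f g h u v : R -> R[i]) (a c z : R[i]).

(** The squared norm as a real number. An infinite integral would be read as 0, so [L2] accompanies
    it wherever its size matters. *)
Definition nrm2 f : R := \int[mu]_x csq (f x).

Lemma nrm2_ge0 f : 0 <= nrm2 f.
Proof. by apply: Rintegral_ge0 => x _; exact: csq_ge0. Qed.

Lemma L2norm_sqrte f : L2norm f = sqrte (\int[mu]_x (csq (f x))%:E)%E.
Proof.
have E : ((L2norm f) `^ 2 = \int[mu]_x (csq (f x))%:E)%E.
  rewrite /L2norm powR_Lnorm ?pnatr_eq0//; apply: eq_integral => x _.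
  by rewrite gee0_abs ?lee_fin ?normc_ge0// poweR_EFin (powR_mulrn 2) ?normc_ge0// sqr_normc.
rewrite -poweR12_sqrt ?integral_ge0//; last by move=> x _; rewrite lee_fin csq_ge0.
by rewrite -E -poweRrM divff ?pnatr_eq0// poweRe1// Lnorm_ge0.
Qed.

Lemma L2P f : L2 f <-> cmeasurable f /\ mu.-integrable setT (EFin \o (fun x => csq (f x))).
Proof.
have I0 : (0 <= \int[mu]_x (csq (f x))%:E)%E.
  by apply: integral_ge0 => x _; rewrite lee_fin csq_ge0.
have IE : (\int[mu]_x `|(csq (f x))%:E| = \int[mu]_x (csq (f x))%:E)%E.
  by apply: eq_integral => x _; rewrite gee0_abs// lee_fin csq_ge0.
rewrite /L2 L2norm_sqrte; split=> [[mf fi]|[mf /integrableP[_ b]]]; split => //.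
  apply/integrableP; split; first by apply/measurable_EFinP; exact: meas_csq.
  rewrite /= IE; move: fi I0; case: (\int[mu]_x (csq (f x))%:E)%E => [r _ _|//|//]; exact: ltry.
have {}b : (\int[mu]_x (csq (f x))%:E < +oo)%E by rewrite -IE.
by move: b I0; case: (\int[mu]_x (csq (f x))%:E)%E => [r _ _|//|//]; exact: ltry.
Qed.

Lemma L2_meas f : L2 f -> cmeasurable f. Proof. by case. Qed.

Lemma L2_int f : L2 f -> mu.-integrable setT (EFin \o (fun x => csq (f x))).
Proof. by move=> /L2P[]. Qed.

Lemma L2normE f : L2 f -> L2norm f = (Num.sqrt (nrm2 f))%:E.
Proof.
move=> /L2_int fi; rewrite L2norm_sqrte /nrm2 /Rintegral -[X in sqrte X]fineK//.
exact: integrable_fin_num fi.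
Qed.

Lemma L2_le f (G : R -> R) : cmeasurable f -> mu.-integrable setT (EFin \o G) ->
  (forall x, csq (f x) <= G x) -> L2 f.
Proof.
move=> mf iG fG; apply/L2P; split => //; apply: integrable_le iG _ => //.
  exact: meas_csq.
by move=> x _; rewrite ger0_norm ?csq_ge0.
Qed.

Lemma L2D f g : L2 f -> L2 g -> L2 (fun x => f x + g x).
Proof.
move=> fl gl; apply: (@L2_le _ (fun x => 2 * csq (f x) + 2 * csq (g x))).
- by apply: cmeasD; exact: L2_meas.
- by apply: mintD => //; apply: mintZ => //; exact: L2_int.
- by move=> x; exact: csqD_le.
Qed.

Lemma L2Z c f : L2 f -> L2 (fun x => c * f x).
Proof.
move=> fl; apply: (@L2_le _ (fun x => csq c * csq (f x))).
- by apply: cmeasM; [exact: cmeas_cst|exact: L2_meas].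
- by apply: mintZ => //; exact: L2_int.
- by move=> x; rewrite csqM.
Qed.

Lemma L2N f : L2 f -> L2 (fun x => - f x).
Proof. by move=> /(L2Z (-1)); under eq_fun do rewrite mulN1r. Qed.

Lemma L2B f g : L2 f -> L2 g -> L2 (fun x => f x - g x).
Proof. by move=> fl gl; apply: L2D => //; exact: L2N. Qed.

Lemma L2_0 : L2 (fun _ : R => 0 : R[i]).
Proof.
apply: (@L2_le _ (fun=> 0)); first exact: cmeas_cst.
  exact: mint0.
by move=> x; rewrite csq0.
Qed.

Lemma inner_int f g : L2 f -> L2 g -> cintable setT (fun x => f x * (g x)^*).
Proof.
move=> fl gl; apply: (@cintable_le _ _ _ (fun x => csq (f x) + csq (g x))) => //.
- by apply: cmeasM; [exact: L2_meas|apply: cmeasJ; exact: L2_meas].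
- by apply: mintD => //; exact: L2_int.
- move=> x _; rewrite (le_trans (normc_prod_le _ _))// csqJ.
  by have := csq_ge0 (f x); have := csq_ge0 (g x); lra.
Qed.

Lemma innerDl f g h : L2 f -> L2 g -> L2 h ->
  inner (fun x => f x + g x) h = inner f h + inner g h.
Proof.
move=> fl gl hl; rewrite -[LHS]/(cint setT _) -cintD//; [|exact: inner_int..].
by apply: eq_cint => x _; rewrite mulrDl.
Qed.

Lemma innerZl c f h : L2 f -> L2 h -> inner (fun x => c * f x) h = c * inner f h.
Proof.
move=> fl hl; rewrite -[LHS]/(cint setT _) -cintZ//; last exact: inner_int.
by apply: eq_cint => x _; rewrite mulrA.
Qed.

Lemma innerJ f g : L2 f -> L2 g -> inner g f = (inner f g)^*.
Proof.
move=> fl gl; rewrite -[LHS]/(cint setT _) -cintJ//; last exact: inner_int.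
by apply: eq_cint => x _; rewrite conjcM conjCK mulrC.
Qed.

Lemma innerDr f g h : L2 f -> L2 g -> L2 h ->
  inner h (fun x => f x + g x) = inner h f + inner h g.
Proof.
move=> fl gl hl; rewrite (innerJ (L2D fl gl) hl) innerDl// conjcD.
by rewrite -(innerJ fl hl) -(innerJ gl hl).
Qed.

Lemma innerZr c f h : L2 f -> L2 h -> inner h (fun x => c * f x) = c^* * inner h f.
Proof.
by move=> fl hl; rewrite (innerJ (L2Z c fl) hl) innerZl// conjcM -(innerJ fl hl).
Qed.

Lemma innerNl f h : L2 f -> L2 h -> inner (fun x => - f x) h = - inner f h.
Proof.
move=> fl hl; rewrite (_ : (fun x => - f x) = (fun x => -1 * f x)).
  by rewrite innerZl// mulN1r.
by apply/funext => x; rewrite mulN1r.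
Qed.

Lemma innerBl f g h : L2 f -> L2 g -> L2 h ->
  inner (fun x => f x - g x) h = inner f h - inner g h.
Proof. by move=> fl gl hl; rewrite innerDl ?innerNl//; exact: L2N. Qed.

Lemma innerNr f h : L2 f -> L2 h -> inner h (fun x => - f x) = - inner h f.
Proof.
by move=> fl hl; rewrite (innerJ (L2N fl) hl) innerNl// conjcN -(innerJ fl hl).
Qed.

Lemma innerBr f g h : L2 f -> L2 g -> L2 h ->
  inner h (fun x => f x - g x) = inner h f - inner h g.
Proof. by move=> fl gl hl; rewrite innerDr ?innerNr//; exact: L2N. Qed.

Lemma innerE f : inner f f = (nrm2 f)%:C.
Proof. by rewrite -[LHS]/(cint setT _) -cintC; apply: eq_cint => x _; rewrite mulJc. Qed.

Lemma nrm2D f g : L2 f -> L2 g ->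
  nrm2 (fun x => f x + g x) = nrm2 f + 2 * Re (inner f g) + nrm2 g.
Proof.
move=> fl gl; have fg := L2D fl gl.
have -> : nrm2 (fun x => f x + g x) = Re (inner (fun x => f x + g x) (fun x => f x + g x)).
  by rewrite innerE.
rewrite innerDl// !innerDr// !innerE (innerJ fl gl); move: (inner f g) => z.
by rewrite !cReD cReJ /=; ring.
Qed.

Lemma nrm2Z c f : L2 f -> nrm2 (fun x => c * f x) = csq c * nrm2 f.
Proof.
move=> fl; rewrite /nrm2 -RintegralZl//; last exact: L2_int.
by apply: eq_Rintegral => x _; rewrite csqM.
Qed.

Lemma nrm2N f : nrm2 (fun x => - f x) = nrm2 f.
Proof. by apply: eq_Rintegral => x _; rewrite csqN. Qed.

Lemma nrm2D_le f g : L2 f -> L2 g ->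
  nrm2 (fun x => f x + g x) <= 2 * nrm2 f + 2 * nrm2 g.
Proof.
move=> fl gl; have := nrm2_ge0 (fun x => f x - g x).
have := nrm2D fl gl; have := nrm2D fl (L2N gl).
rewrite nrm2N innerNr// cReN => -> ->; lra.
Qed.

(** The squared norm of f - s z g is a nonnegative quadratic polynomial in the real number s; its
    minimum is at s = 1 / nrm2 g. *)
Lemma cauchy_schwarz f g : L2 f -> L2 g -> csq (inner f g) <= nrm2 f * nrm2 g.
Proof.
move=> fl gl; set z := inner f g.
have H (s : R) : 0 <= nrm2 f - 2 * s * csq z + s ^+ 2 * csq z * nrm2 g.
  have := nrm2_ge0 (fun x => f x + (- s%:C * z) * g x).
  rewrite nrm2D//; last exact: L2Z.
  rewrite innerZr// nrm2Z// -/z csqM csqN csqC.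
  have -> : Re ((- s%:C * z)^* * z) = - s * csq z.
    move: z => z.
    by rewrite !(cReM, cImM, cReJ, cImJ, cReN, cImN, cReC, cImC) /csq; ring.
  move=> /le_trans; apply; rewrite le_eqVlt; apply/orP; left; apply/eqP; ring.
have z0 := csq_ge0 z; have f0 := nrm2_ge0 f; have g0 := nrm2_ge0 g.
have [g00|gn0] := eqVneq (nrm2 g) 0.
  have [->|zn0] := eqVneq (csq z) 0; first by rewrite mulr_ge0.
  (* With nrm2 g = 0 the polynomial is linear in s, and this s makes it negative unless z = 0. *)
  have := H ((nrm2 f + 1) / csq z); rewrite g00 mulr0 addr0 -mulrA mulfVK//; lra.
have gp : 0 < nrm2 g by rewrite lt_def gn0.
have := H (nrm2 g)^-1.
have -> : nrm2 f - 2 * (nrm2 g)^-1 * csq z + (nrm2 g)^-1 ^+ 2 * csq z * nrm2 g =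
  (nrm2 f * nrm2 g - csq z) / nrm2 g by field.
by rewrite pmulr_lge0 ?invr_gt0// subr_ge0.
Qed.

Lemma nrm2_eq0 f : L2 f -> nrm2 f = 0 -> aeeq f (fun=> 0).
Proof.
move=> fl f0; have fi := L2_int fl.
have : ae_eq mu setT (EFin \o (fun x => csq (f x))) (cst 0).
  apply/ae_eq_integral_abs => //; first by have /measurable_int := fi.
  have := f0; rewrite /nrm2 /Rintegral.
  have -> : (\int[mu]_x `|(EFin \o (fun x => csq (f x))) x| = \int[mu]_x (csq (f x))%:E)%E.
    by apply: eq_integral => x _ /=; rewrite ger0_norm// csq_ge0.
  by move=> E; rewrite -[LHS]fineK ?E//; exact: integrable_fin_num fi.
by apply: ae_imp => x /(_ I) /= [] /csq_eq0.
Qed.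

Lemma L2_aeeq f g : cmeasurable g -> aeeq f g -> L2 f -> L2 g.
Proof.
move=> mg fg /L2P[mf fi]; apply/L2P; split => //; apply: ae_integrable fi => //.
  by apply/measurable_EFinP; exact: meas_csq.
by apply: ae_imp fg => x /= -> _.
Qed.

Lemma aeeq_sym f g : aeeq f g -> aeeq g f.
Proof. by apply: ae_imp => x. Qed.

Lemma aeeq_trans f g h : aeeq f g -> aeeq g h -> aeeq f h.
Proof. by apply: ae_imp2 => x ->. Qed.

Lemma aeeq_refl f : aeeq f f.
Proof. exact: aeW. Qed.

Lemma nrm2_aeeq f g : cmeasurable f -> cmeasurable g -> aeeq f g -> nrm2 f = nrm2 g.
Proof.
move=> mf mg fg; apply: ae_Rintegral => //; [exact: meas_csq..|].
by apply: ae_imp fg => x ->.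
Qed.

Lemma aeeq_nrm2 f g : L2 f -> L2 g -> nrm2 (fun x => f x - g x) = 0 -> aeeq f g.
Proof.
move=> fl gl /(nrm2_eq0 (L2B fl gl)); apply: ae_imp => x /eqP.
by rewrite subr_eq0 => /eqP.
Qed.

Lemma inner_aeeq f f' g g' : cmeasurable f -> cmeasurable f' -> cmeasurable g ->
  cmeasurable g' -> aeeq f f' -> aeeq g g' -> inner f g = inner f' g'.
Proof.
move=> m1 m2 m3 m4 ff gg; apply: cint_aeeq => //.
- by apply: cmeasM => //; exact: cmeasJ.
- by apply: cmeasM => //; exact: cmeasJ.
- by apply: ae_imp2 ff gg => x -> ->.
Qed.

Lemma cvgL2P (us : nat -> R -> R[i]) u : (forall n, L2 (us n)) -> L2 u ->
  cvgL2 us u <-> (nrm2 (fun x => us n x - u x) @[n --> \oo] --> (0 : R)).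
Proof.
move=> usl ul; rewrite /cvgL2.
have -> : (fun n => L2norm (fun x => us n x - u x)) =
    EFin \o (fun n => Num.sqrt (nrm2 (fun x => us n x - u x))).
  by apply/funext => n /=; rewrite L2normE//; exact: L2B.
split=> [/fine_cvgP[_ H]|H].
  have -> : (fun n => nrm2 (fun x => us n x - u x)) =
      (fun n => Num.sqrt (nrm2 (fun x => us n x - u x)) * Num.sqrt (nrm2 (fun x => us n x - u x))).
    by apply/funext => n; rewrite -expr2 sqr_sqrtr// nrm2_ge0.
  by rewrite -[X in _ --> X](mulr0 (0 : R)); apply: cvgM; exact: H.
apply: cvg_EFin; first exact: nearW.
rewrite -[X in _ --> X]sqrtr0.
apply: (@cvg_comp _ _ _ (fun n => nrm2 (fun x => us n x - u x)) Num.sqrt) H _.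
exact: sqrt_continuous.
Qed.

Lemma ccvg_csq (zs : nat -> R[i]) z :
  csq (zs n - z) @[n --> \oo] --> (0 : R) -> ccvg zs z.
Proof.
move=> H.
have K (a : nat -> R) b : (forall n, (a n - b) ^+ 2 <= csq (zs n - z)) ->
    a n @[n --> \oo] --> b.
  move=> ab; apply/cvgrPdist_lt => e e0.
  have e2 : 0 < e ^+ 2 by rewrite exprn_gt0.
  have /cvgrPdist_lt/(_ _ e2) := H.
  apply: filterS => n; rewrite sub0r normrN ger0_norm ?csq_ge0// => He.
  rewrite distrC -ltr_sqr ?nnegrE ?normr_ge0//; last exact: ltW.
  by rewrite real_normK ?num_real// (le_lt_trans (ab n)).
by split; apply: K => n; rewrite /csq cReD cImD cReN cImN ?lerDl ?lerDr sqr_ge0.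
Qed.

Lemma csqD3 z1 z2 z3 : csq (z1 + z2 + z3) <= 4 * csq z1 + 4 * csq z2 + 2 * csq z3.
Proof.
by rewrite (le_trans (csqD_le _ _))// lerD2r; have := csqD_le z1 z2; lra.
Qed.

Lemma inner_cvg (fs gs : nat -> R -> R[i]) f g : (forall n, L2 (fs n)) ->
  (forall n, L2 (gs n)) -> L2 f -> L2 g -> cvgL2 fs f -> cvgL2 gs g ->
  ccvg (fun n => inner (fs n) (gs n)) (inner f g).
Proof.
move=> fsl gsl fl gl /cvgL2P H1 /cvgL2P H2.
have {}H1 := H1 fsl fl; have {}H2 := H2 gsl gl; apply: ccvg_csq.
apply: (@squeeze_cvgr _ _ _ _ (fun=> 0) (fun n =>
  4 * (nrm2 (fun x => fs n x - f x) * nrm2 (fun x => gs n x - g x)) +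
  4 * (nrm2 (fun x => fs n x - f x) * nrm2 g) +
  2 * (nrm2 f * nrm2 (fun x => gs n x - g x)))).
- apply: nearW => n; rewrite csq_ge0/=.
  have fd := L2B (fsl n) fl; have gd := L2B (gsl n) gl.
  have -> : inner (fs n) (gs n) - inner f g =
    inner (fun x => fs n x - f x) (fun x => gs n x - g x) +
    inner (fun x => fs n x - f x) g + inner f (fun x => gs n x - g x).
    by rewrite !innerBl// !innerBr//; ring.
  have := cauchy_schwarz fd gd; have := cauchy_schwarz fd gl; have := cauchy_schwarz fl gd.
  move=> h1 h2 h3; rewrite (le_trans (csqD3 _ _ _))//; lra.
- exact: cvg_cst.
- have E : (0 : R) = 4 * (0 * 0) + 4 * (0 * nrm2 g) + 2 * (nrm2 f * 0) by ring.
  rewrite [X in _ --> X]E; apply: cvgD; first apply: cvgD.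
  + by apply: cvgM; [exact: cvg_cst|exact: cvgM].
  + by apply: cvgM; [exact: cvg_cst|apply: cvgM => //; exact: cvg_cst].
  + by apply: cvgM; [exact: cvg_cst|apply: cvgM => //; exact: cvg_cst].
Qed.

End SquareIntegrable.

(** * Sectorial operators: resolvent bound, maximality, cores *)

Section OperatorTheory.
Context {R : realType}.
Local Notation mu := (@lebesgue_measure R).
Local Notation fn := (R -> R[i]).
Implicit Types (T S : @graph R) (u v f g h w : fn) (z : R[i]).

(** The part of [is_operator] without single-valuedness and invariance under almost everywhere
    equality. Only this part is shown directly for the form-sum and the Friedrichs extension; their
    equality with an operator supplies the rest. *)
Definition linear_graph T := [/\ forall u f, T (u, f) -> L2 u /\ L2 f,
  T (fun=> 0, fun=> 0) &
  forall (a : R[i]) u v f g, T (u, f) -> T (v, g) ->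
    T (fun x => a * u x + v x, fun x => a * f x + g x)].

(* The numerical range lies in the sector with vertex - K and half-angle pi / 4. *)
Definition sectorial K T := forall u f, T (u, f) ->
  `|Im (inner f u)| <= Re (inner f u) + K * nrm2 u.

Definition resolvent_onto K T := forall z, K < Re z -> forall g, L2 g ->
  exists u, op_shift T z (u, g).

Lemma is_operator_linear T : is_operator T -> linear_graph T.
Proof. by case. Qed.

Lemma linear_graphB T u v f g : linear_graph T -> T (u, f) -> T (v, g) ->
  T (fun x => u x - v x, fun x => f x - g x).
Proof.
move=> [_ _ lin] uf vg; have := lin (-1) _ _ _ _ vg uf.
by congr (T (_, _)); apply/funext => x; rewrite mulN1r addrC.
Qed.

(** The sector gives (Re z - K) |u|^2 <= Re (f + z u, u), and Cauchy-Schwarz bounds the right-hand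
    side. The statement is squared because norms enter through [nrm2]. *)
Lemma sectorial_resolvent_bound K T u f z : sectorial K T -> linear_graph T ->
  T (u, f) -> K < Re z ->
  (Re z - K) ^+ 2 * nrm2 u <= nrm2 (fun x => f x + z * u x).
Proof.
move=> secT [TL _ _] uf Kz; have [ul fl] := TL _ _ uf.
have gl := L2D fl (L2Z z ul); set g := fun x => f x + z * u x in gl *.
have s := secT _ _ uf.
have s0 : 0 <= Re (inner f u) + K * nrm2 u by apply: le_trans s.
have E : Re (inner g u) = Re (inner f u) + Re z * nrm2 u.
  by rewrite innerDl ?innerZl ?innerE//; [rewrite cReD cReM /=; ring|exact: L2Z].
have E2 : (Re z - K) * nrm2 u <= Re (inner g u) by rewrite E; lra.
have cs := cauchy_schwarz gl ul.
have u0 := nrm2_ge0 u.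
have E3 : ((Re z - K) * nrm2 u) ^+ 2 <= nrm2 g * nrm2 u.
  apply: le_trans cs; apply: (@le_trans _ _ (Re (inner g u) ^+ 2)).
    by apply: lerXn2r => //; rewrite nnegrE; [apply: mulr_ge0 => //; lra|apply: le_trans E2; apply: mulr_ge0 => //; lra].
  by rewrite /csq lerDl sqr_ge0.
have [->|un0] := eqVneq (nrm2 u) 0; first by rewrite mulr0 nrm2_ge0.
have up : 0 < nrm2 u by rewrite lt_def un0.
by rewrite -(ler_pM2r up); apply: le_trans E3; rewrite exprMn -mulrA -expr2.
Qed.

Lemma op_shift_comp T (a b : R[i]) u g : op_shift T (a + b) (u, g) -> is_operator T ->
  op_shift (op_shift T a) b (u, g).
Proof.
move=> [f /= uf [gl gE]] [TL _ _ _ _]; have [ul fl] := TL _ _ uf.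
exists (fun x => f x + a * u x) => /=.
  by exists f => //=; split; [apply: L2D => //; exact: L2Z|exact: aeeq_refl].
by split => //; apply: ae_imp gE => x ->; ring.
Qed.

Lemma is_operator_shift T (c : R[i]) : is_operator T -> is_operator (op_shift T c).
Proof.
move=> [TL Tae T0 Tlin Tuniq]; split.
- by move=> u f [h /= uh [fl _]]; have [] := TL _ _ uh.
- move=> u v f g [h /= uh [fl fE]] vl gl uv fg.
  have [ul hl] := TL _ _ uh.
  exists h => /=; first exact: (Tae _ _ _ _ uh vl hl uv (aeeq_refl h)).
  split => //; apply: ae_imp2 (aeeq_trans (aeeq_sym fg) fE) uv => x -> ->.
  by [].
- exists (fun=> 0) => //=; split; first exact: L2_0.
  by apply: aeW => x; rewrite mulr0 addr0.
- move=> a u v f g [h /= uh [fl fE]] [k /= vk [gl gE]].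
  exists (fun x => a * h x + k x) => /=; first exact: Tlin.
  split; first by apply: L2D => //; exact: L2Z.
  by apply: ae_imp2 fE gE => x -> ->; ring.
- move=> u f g [h /= uh [fl fE]] [k /= uk [gl gE]].
  have hk := Tuniq _ _ _ uh uk.
  apply: aeeq_trans fE _; apply: aeeq_trans _ (aeeq_sym gE).
  by apply: ae_imp hk => x ->.
Qed.

(** With the vertex moved to 0, a point x + i y of the numerical range satisfies |y| <= x; its polar
    angle is atan (y / x), of modulus at most pi / 4. The same shift by K makes the operator
    m-accretive. *)
Lemma m_sectorial_criterion K T : is_operator T -> sectorial K T ->
  resolvent_onto K T -> m_sectorial T.
Proof.
move=> opT secT ontoT; have linT := is_operator_linear opT.
have [TL _ _ _ _] := opT.
split => //.
  have pi4 : 0 <= pi / 4 :> R by rewrite divr_ge0// pi_ge0.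
  exists (- K), (pi / 4); split => //.
    by rewrite ltr_pM2l ?pi_gt0// ltf_pV2 ?posrE//; lra.
  move=> _ [u [f [uf u1 ->]]]; have [ul fl] := TL _ _ uf.
  have n1 : nrm2 u = 1.
    have : Num.sqrt (nrm2 u) = 1 by move: u1; rewrite L2normE// => -[].
    by move=> /(congr1 (fun t => t ^+ 2)); rewrite sqr_sqrtr ?nrm2_ge0// expr1n.
  have := secT _ _ uf; rewrite n1 mulr1.
  move: (inner f u) => z zK.
  set x := Re z + K; set y := Im z.
  have yx : `|y| <= x by [].
  have x0 : 0 <= x by apply: le_trans yx.
  have zE : z = (- K)%:C + (x +i* y).
    by apply: complex_eq; rewrite /= /x /y; ring.
  (* At the vertex the quotient y / x has no meaning; radius and angle 0 represent the point. *)
  rewrite zE; have [xz|xn0] := eqVneq x 0.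
    have y0 : y = 0 by apply/eqP; rewrite -normr_le0 -xz.
    by exists 0, 0; split; rewrite ?normr0// !mul0r xz y0.
  have xp : 0 < x by rewrite lt_def xn0.
  pose p := atan (y / x).
  have cp : 0 < cos p.
    by rewrite cos_atan invr_gt0 sqrtr_gt0 ltr_wpDr// ?sqr_ge0.
  have sp : sin p = y / x * cos p.
    have := atanK (y / x); rewrite -/p /tan => <-.
    by rewrite mulfVK// gt_eqF.
  exists (x / cos p), p; split.
  - by rewrite divr_ge0// ltW.
  - have yx1 : `|y / x| <= 1 by rewrite normrM normfV (gtr0_norm xp) ler_pdivrMr// mul1r.
    have monoA : {mono (@atan R) : a b / a <= b} by apply: le_mono; exact: lt_atan.
    move: yx1; rewrite !ler_norml => /andP[h1 h2].
    by rewrite -atan1 -atanN !monoA h1 h2.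
  - rewrite sp; congr (_ + (_ +i* _)); first by rewrite mulfVK// gt_eqF.
    by field; rewrite !gt_eqF.
exists K; split; first exact: is_operator_shift.
move=> l l0; split=> [g gl|u g].
  have Kl : K < Re (K%:C + l) by rewrite cReD /=; lra.
  by have [u uE] := ontoT _ Kl g gl; exists u; exact: op_shift_comp.
move=> [h /= [f /= uf [hl hE]] [gl gE]].
have [ul fl] := TL _ _ uf.
have Kl : K < Re (K%:C + l) by rewrite cReD /=; lra.
have := sectorial_resolvent_bound secT linT uf Kl.
have -> : Re (K%:C + l) - K = Re l by rewrite cReD /=; ring.
have -> : nrm2 (fun x => f x + (K%:C + l) * u x) = nrm2 g.
  apply: nrm2_aeeq; [|exact: L2_meas|].
    by apply: L2_meas; apply: L2D => //; exact: L2Z.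
  by apply: ae_imp2 hE gE => x -> ->; ring.
move=> H; rewrite !L2normE// -EFinM lee_fin mulrC ler_pdivlMr// mulrC.
rewrite -[Re l](ger0_norm (ltW l0)) -sqrtr_sqr -sqrtrM ?sqr_ge0//.
exact: ler_wsqrtr.
Qed.

(** Given (u, f) in S, solve T v + z v = f + z u. The difference u - v is annihilated by S + z, so
    the resolvent bound makes it 0. The choice z = K + 1 turns the constant of that bound into 1. *)
Lemma operator_maximal K T S : is_operator T -> resolvent_onto K T ->
  linear_graph S -> sectorial K S -> (forall p, T p -> S p) -> T = S.
Proof.
move=> opT ontoT linS secS TS; apply/seteqP; split => // -[u f] uf.
have [SL _ _] := linS; have [TL Tae _ _ _] := opT.
have [ul fl] := SL _ _ uf.
have z1 : K < Re (K + 1)%:C by rewrite /=; lra.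
set z := (K + 1)%:C in z1.
have [v [h /= vh [gl gE]]] := ontoT z z1 (fun x => f x + z * u x) (L2D fl (L2Z z ul)).
have [vl hl] := TL _ _ vh.
have d := linear_graphB linS uf (TS _ vh).
have := sectorial_resolvent_bound secS linS d z1.
have -> : nrm2 (fun x => f x - h x + z * (u x - v x)) = 0.
  rewrite -[RHS](_ : nrm2 (fun=> 0) = 0); last first.
    by rewrite /nrm2; under eq_Rintegral do rewrite csq0; exact: Rintegral0.
  apply: nrm2_aeeq; [|exact: cmeas_cst|].
    by apply: L2_meas; apply: L2D; [exact: L2B|apply: L2Z; exact: L2B].
  apply: ae_imp gE => x E.
  by have -> : f x - h x + z * (u x - v x) = (f x + z * u x) - (h x + z * v x); [ring|rewrite E subrr].
have -> : Re z - K = 1 by rewrite /z/=; ring.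
rewrite expr1n mul1r => n0.
have /aeeq_nrm2 uv : nrm2 (fun x => u x - v x) = 0.
  by apply/eqP; rewrite eq_le n0 nrm2_ge0.
have {}uv := uv ul vl.
apply: (Tae _ _ _ _ vh ul fl (aeeq_sym uv)).
apply: ae_imp2 gE uv => x E1 E2; move: E1; rewrite E2 => /eqP.
by rewrite eq_sym (inj_eq (addIr _)) => /eqP.
Qed.

Definition graph_core S T := forall u f, T (u, f) -> exists us fs : nat -> fn,
  [/\ forall n, S (us n, fs n), cvgL2 us u & cvgL2 fs f].

(** The core property puts T inside the closure. Conversely, for a limit (u, f) of pairs in S, solve
    T v + z v = f + z u; the resolvent bound forces the approximants of u to converge to v as well,
    so u = v almost everywhere. *)
Lemma op_closure_core K T S : is_operator T -> sectorial K T -> resolvent_onto K T ->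
  (forall p, S p -> T p) -> graph_core S T -> op_closure S = T.
Proof.
move=> opT secT ontoT ST core; apply/seteqP; split => -[u f]; last first.
  move=> uf; have [TL _ _ _ _] := opT; have [ul fl] := TL _ _ uf.
  by split => //; split => //; exact: core.
move=> [/= ul [fl [us [fs [usf cu cf]]]]].
have linT := is_operator_linear opT; have [TL Tae _ _ _] := opT.
have z1 : K < Re (K + 1)%:C by rewrite /=; lra.
set z := (K + 1)%:C in z1.
have [v [h /= vh [gl gE]]] := ontoT z z1 (fun x => f x + z * u x) (L2D fl (L2Z z ul)).
have [vl hl] := TL _ _ vh.
have usl n : L2 (us n) /\ L2 (fs n) by apply: TL; apply: ST.
have cu' : nrm2 (fun x => us n x - u x) @[n --> \oo] --> (0 : R).
  by apply/cvgL2P => // n; case: (usl n).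
have cf' : nrm2 (fun x => fs n x - f x) @[n --> \oo] --> (0 : R).
  by apply/cvgL2P => // n; case: (usl n).
have bnd n : nrm2 (fun x => us n x - v x) <=
    2 * nrm2 (fun x => fs n x - f x) + 2 * (csq z * nrm2 (fun x => us n x - u x)).
  have [unl fnl] := usl n.
  have d := linear_graphB linT (ST _ (usf n)) vh.
  have := sectorial_resolvent_bound secT linT d z1.
  have -> : Re z - K = 1 by rewrite /z/=; ring.
  rewrite expr1n mul1r => /le_trans; apply.
  rewrite -nrm2Z; last exact: L2B.
  apply: le_trans (nrm2D_le (L2B fnl fl) (L2Z z (L2B unl ul))).
  rewrite le_eqVlt; apply/orP; left; apply/eqP; apply: nrm2_aeeq.
  - by apply: L2_meas; apply: L2D; [exact: L2B|apply: L2Z; exact: L2B].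
  - by apply: L2_meas; apply: L2D; [exact: L2B|apply: L2Z; exact: L2B].
  - apply: ae_imp gE => x E.
    have -> : fs n x - h x + z * (us n x - v x) = (fs n x + z * us n x) - (h x + z * v x) by ring.
    by rewrite -E; ring.
have cv : cvgL2 us v.
  apply/cvgL2P => //; first by move=> n; case: (usl n).
  apply: (@squeeze_cvgr _ _ _ _ (fun=> 0) (fun n =>
    2 * nrm2 (fun x => fs n x - f x) + 2 * (csq z * nrm2 (fun x => us n x - u x)))).
  - by apply: nearW => n; rewrite nrm2_ge0 bnd.
  - exact: cvg_cst.
  - have E : (0 : R) = 2 * 0 + 2 * (csq z * 0) by ring.
    rewrite [X in _ --> X]E; apply: cvgD; first by apply: cvgM => //; exact: cvg_cst.
    by apply: cvgM; [exact: cvg_cst|apply: cvgM => //; exact: cvg_cst].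
have uv : aeeq u v.
  have cv' : nrm2 (fun x => us n x - v x) @[n --> \oo] --> (0 : R).
    by apply/cvgL2P => // n; case: (usl n).
  apply: aeeq_nrm2 => //; apply/eqP; rewrite eq_le nrm2_ge0 andbT.
  have E : (0 : R) = 2 * 0 + 2 * 0 by ring.
  have H : (2 * nrm2 (fun x => us n x - v x) + 2 * nrm2 (fun x => us n x - u x)) @[n --> \oo] --> (0 : R).
    by rewrite [X in _ --> X]E; apply: cvgD; apply: cvgM => //; exact: cvg_cst.
  rewrite -(cvg_lim (@Rhausdorff R) H); apply: limr_ge; first by apply/cvg_ex; exists 0.
  apply: nearW => n; have [unl _] := usl n.
  rewrite -(nrm2N (fun x => us n x - u x)).
  apply: le_trans (nrm2D_le (L2B unl vl) (L2N (L2B unl ul))).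
  rewrite le_eqVlt; apply/orP; left; apply/eqP; apply: eq_Rintegral => x _.
  by congr csq; ring.
apply: (Tae _ _ _ _ vh ul fl (aeeq_sym uv)).
apply: ae_imp2 gE uv => x E1 E2; move: E1; rewrite E2 => /eqP.
by rewrite eq_sym (inj_eq (addIr _)) => /eqP.
Qed.

End OperatorTheory.

(** * The Friedrichs extension of a sectorial operator *)

Section Friedrichs.
Context {R : realType}.
Local Notation mu := (@lebesgue_measure R).
Local Notation fn := (R -> R[i]).
Implicit Types (u v f g h w : fn) (z : R[i]) (us vs ws fs gs hs : nat -> fn).

(** Optimization over t, with optimum sqrt (b / a). If a or b vanishes, a large or a small t
    contradicts x > 0. *)
Lemma sqr_le_of_scaled_sum (x a b : R) : 0 <= x -> 0 <= a -> 0 <= b ->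
  (forall t, 0 < t -> x <= 2 * (t * a + t^-1 * b)) -> x ^+ 2 <= 16 * (a * b).
Proof.
move=> x0 a0 b0 H; have [->|xn0] := eqVneq x 0; first by rewrite expr0n/= !mulr_ge0.
have xp : 0 < x by rewrite lt_def xn0.
have [az|an0] := eqVneq a 0.
  have t0 : 0 < 4 * b / x + 1 by rewrite ltr_wpDl// divr_ge0 ?mulr_ge0// ltW.
  have h := H _ t0; rewrite az mulr0 add0r in h.
  have := ler_wpM2r (ltW t0) h.
  have -> : 2 * ((4 * b / x + 1)^-1 * b) * (4 * b / x + 1) = 2 * b.
    by rewrite -mulrA mulrAC mulVf ?mul1r// gt_eqF.
  have -> : x * (4 * b / x + 1) = 4 * b + x by rewrite mulrDr mulr1 (mulrC x) divfK.
  lra.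
have ap : 0 < a by rewrite lt_def an0.
have [bz|bn0] := eqVneq b 0.
  have t0 : 0 < x / (4 * a) by rewrite divr_gt0// mulr_gt0.
  have := H _ t0; rewrite bz mulr0 addr0.
  have -> : 2 * (x / (4 * a) * a) = x / 2 by field.
  lra.
have bp : 0 < b by rewrite lt_def bn0.
have sa : 0 < Num.sqrt a by rewrite sqrtr_gt0.
have sb : 0 < Num.sqrt b by rewrite sqrtr_gt0.
have := H _ (divr_gt0 sb sa).
rewrite -[X in _ / _ * X]sqr_sqrtr// -[X in _^-1 * X]sqr_sqrtr//.
have -> : 2 * (Num.sqrt b / Num.sqrt a * Num.sqrt a ^+ 2 +
  (Num.sqrt b / Num.sqrt a)^-1 * Num.sqrt b ^+ 2) = 4 * (Num.sqrt a * Num.sqrt b).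
  by field; rewrite !gt_eqF.
move=> xs; have -> : 16 * (a * b) = (4 * (Num.sqrt a * Num.sqrt b)) ^+ 2.
  by rewrite !exprMn !sqr_sqrtr//; ring.
by apply: lerXn2r => //; rewrite nnegrE// ?mulr_ge0// ltW.
Qed.

Lemma ccvg_normc (zs : nat -> R[i]) z : ccvg zs z <->
  normc (zs n - z) @[n --> \oo] --> (0 : R).
Proof.
split=> [[z1 z2]|H].
  apply: (@squeeze_cvgr _ _ _ _ (fun=> 0) (fun n => `|Re (zs n) - Re z| + `|Im (zs n) - Im z|)).
  - by apply: nearW => n; rewrite normc_ge0/= (le_trans (normc_le _))// cReD cImD cReN cImN.
  - exact: cvg_cst.
  - rewrite -[X in _ --> X](addr0 (0 : R)); apply: cvgD.
      by rewrite -(normr0 R) -(subrr (Re z)); apply: cvg_norm; apply: cvgB => //; exact: cvg_cst.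
    by rewrite -(normr0 R) -(subrr (Im z)); apply: cvg_norm; apply: cvgB => //; exact: cvg_cst.
have H2 : normc (zs n - z) * normc (zs n - z) @[n --> \oo] --> (0 : R).
  by rewrite -[X in _ --> X](mulr0 (0 : R)); exact: cvgM.
apply: ccvg_csq.
have -> : (fun n => csq (zs n - z)) = (fun n => normc (zs n - z) * normc (zs n - z)).
  by apply/funext => n; rewrite -expr2 sqr_normc.
exact: H2.
Qed.

(** The epsilon bookkeeping common to [bform_fcv_close] and [fcv_limit]; 32 is the constant of
    [bform_diff]. *)
Lemma two_products_lt (M M' e a b c d : R) : 0 <= M -> 0 <= M' -> 0 < e ->
  0 <= a <= M -> 0 <= b <= M' ->
  0 <= c < e / 2 / (32 * (M + M' + 1)) -> 0 <= d < e / 2 / (32 * (M + M' + 1)) ->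
  32 * (c * a) + 32 * (b * d) < e.
Proof.
move=> M0 M'0 e0 /andP[a0 aM] /andP[b0 bM] /andP[c0 cg] /andP[d0 dg].
have k0 : 0 < M + M' + 1 by lra.
have E : (M + M' + 1) * (e / 2 / (32 * (M + M' + 1))) = e / 64.
  by field; rewrite gt_eqF.
move: (e / 2 / _) cg dg E => g cg dg E.
have h2 : b * d <= (M + M' + 1) * g by apply: ler_pM => //; [lra|exact: ltW].
have h3 : c * a < (M + M' + 1) * g.
  apply: (@le_lt_trans _ _ (c * (M + M' + 1))); first by rewrite ler_wpM2l//; lra.
  by rewrite mulrC ltr_pM2l.
lra.
Qed.

Lemma ccvg_cauchy (zs : nat -> R[i]) :
  (forall e, 0 < e -> exists N, forall n m, (N <= n)%N -> (N <= m)%N ->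
     csq (zs n - zs m) < e) -> exists z, ccvg zs z.
Proof.
move=> H.
have K (a : nat -> R) : (forall n m, (a n - a m) ^+ 2 <= csq (zs n - zs m)) -> cvgn a.
  move=> ab; apply/cauchy_cvgP/cauchy_ballP => e e0; rewrite near_simpl.
  have [N HN] := H (e ^+ 2) (exprn_gt0 _ e0).
  exists ([set n | (N <= n)%N], [set n | (N <= n)%N]) => /=.
    by split; exists N.
  move=> [n m] /= [Nn Nm]; rewrite /ball/=.
  rewrite -ltr_sqr ?nnegrE ?normr_ge0//; last exact: ltW.
  by rewrite real_normK ?num_real// (le_lt_trans (ab n m))// HN.
have K1 : cvgn (fun n => Re (zs n)).
  by apply: K => n m; rewrite /csq cReD cReN lerDl sqr_ge0.
have K2 : cvgn (fun n => Im (zs n)).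
  by apply: K => n m; rewrite /csq cImD cImN lerDr sqr_ge0.
by exists (limn (fun n => Re (zs n)) +i* limn (fun n => Im (zs n))).
Qed.

Lemma normcD4_le (a b c d : R[i]) (p q r s : R) : normc a <= 2 * p -> normc b <= 2 * q ->
  normc c <= 2 * r -> normc d <= 2 * s -> normc (a + b + c + d) <= 2 * (p + q + r + s).
Proof.
have := normcD (a + b + c) d; have := normcD (a + b) c; have := normcD a b; lra.
Qed.

Lemma quarter_le (p q : R) : 4 * p <= 2 * (4 * q) -> p <= 2 * q.
Proof. lra. Qed.

Variables (K : R) (T S : @graph R).
Hypotheses (opT : is_operator T) (secT : sectorial K T) (ontoT : resolvent_onto K T).
Hypotheses (ST : forall p, S p -> T p) (core : graph_core S T) (linS : linear_graph S).

Let SL u f : S (u, f) -> L2 u /\ L2 f.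
Proof. by move=> /ST uf; have [TL _ _ _ _] := opT; exact: TL. Qed.

Let Suniq u f g : S (u, f) -> S (u, g) -> aeeq f g.
Proof. by move=> /ST uf /ST ug; have [_ _ _ _ Tu] := opT; exact: Tu uf ug. Qed.

(** The form of S shifted by K + 1, where f stands for S u; with this shift the real part [qform]
    dominates the squared norm. The image f is an explicit argument, so that the choice made by
    [op_app] does not interfere. *)
Definition bform f u v := inner f v + (K + 1)%:C * inner u v.
Definition qform f u := Re (inner f u) + (K + 1) * nrm2 u.

Lemma qformE f u : qform f u = Re (bform f u u).
Proof. by rewrite /qform /bform innerE cReD cReM /=; ring. Qed.

Lemma qform_ge u f : S (u, f) -> nrm2 u <= qform f u.
Proof.
move=> uf; have := secT (ST uf); rewrite /qform.
by have := normr_ge0 (Im (inner f u)); lra.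
Qed.

Lemma qform_ge0 u f : S (u, f) -> 0 <= qform f u.
Proof. by move=> /qform_ge; apply: le_trans; exact: nrm2_ge0. Qed.

Lemma bform_diag u f : S (u, f) -> normc (bform f u u) <= 2 * qform f u.
Proof.
move=> uf; rewrite (le_trans (normc_le _))// -qformE ger0_norm ?qform_ge0//.
have -> : Im (bform f u u) = Im (inner f u) by rewrite /bform innerE cImD cImM /=; ring.
have := secT (ST uf); have := nrm2_ge0 u; rewrite /qform; lra.
Qed.

Lemma bform_expand u f v h (c : R[i]) : S (u, f) -> S (v, h) ->
  bform (fun x => c * h x + f x) (fun x => c * v x + u x) (fun x => c * v x + u x) =
  bform f u u + c^* * bform f u v + c * bform h v u + (csq c)%:C * bform h v v.
Proof.
move=> /SL[ul fl] /SL[vl hl]; have cv := L2Z c vl; have ch := L2Z c hl.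
rewrite /bform !innerDl// ?innerDr//; [|exact: L2D..].
by rewrite !innerZl// !innerZr// -mulJc; ring.
Qed.

(* Polarization over the fourth roots of unity. *)
Lemma bform_sum u f v h : S (u, f) -> S (v, h) ->
  normc (bform f u v) <= 2 * (qform f u + qform h v).
Proof.
move=> uf vh.
pose B c := bform (fun x => c * h x + f x) (fun x => c * v x + u x) (fun x => c * v x + u x).
pose q c := qform (fun x => c * h x + f x) (fun x => c * v x + u x).
have Bq c : normc (B c) <= 2 * q c.
  by apply: bform_diag; have [_ _ lin] := linS; exact: lin.
have qB c : q c = Re (B c) by exact: qformE.
have BE c : B c = bform f u u + c^* * bform f u v + c * bform h v u + (csq c)%:C * bform h v v.
  exact: bform_expand.
have n1 c : csq c = 1 -> normc (c * B c) <= 2 * q c.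
  move=> c1; rewrite normcM; have -> : normc c = 1 by rewrite normcE c1 sqrtr1.
  by rewrite mul1r.
pose I : R[i] := 0 +i* 1.
have c1 : csq (1 : R[i]) = 1 by rewrite /csq /= expr1n expr0n addr0.
have c2 : csq (-1 : R[i]) = 1 by rewrite csqN.
have c3 : csq I = 1 by rewrite /csq /= expr1n expr0n add0r.
have c4 : csq (- I) = 1 by rewrite csqN.
have E : 4%:R * bform f u v = 1 * B 1 + (-1) * B (-1) + I * B I + (- I) * B (- I).
  rewrite !BE c1 c2 c3 c4.
  have -> : (1 : R[i])^* = 1 by rewrite rmorph1.
  have -> : (-1 : R[i])^* = -1 by rewrite rmorphN1.
  have -> : I^* = - I by apply: complex_eq; rewrite ?cReJ ?cImJ /= ?oppr0.
  have -> : (- I)^* = I by rewrite conjcN; apply: complex_eq; rewrite ?cReN ?cImN ?cReJ ?cImJ /= ?oppr0 ?opprK.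
  have II : I * I = -1 by apply: complex_eq; rewrite ?cReM ?cImM /=; ring.
  move: (bform f u u) (bform f u v) (bform h v u) (bform h v v) => x1 x2 x3 x4.
  have E1 : I * (x1 + - I * x2 + I * x3 + 1%:C * x4) =
     I * x1 - (I * I) * x2 + (I * I) * x3 + I * (1%:C * x4) by ring.
  have E2 : - I * (x1 + I * x2 + - I * x3 + 1%:C * x4) =
     - I * x1 - (I * I) * x2 + (I * I) * x3 - I * (1%:C * x4) by ring.
  by rewrite E1 E2 II; ring.
have Q : q 1 + q (-1) + q I + q (- I) = 4 * (qform f u + qform h v).
  rewrite !qB !BE c1 c2 c3 c4 !qformE.
  have -> : (1 : R[i])^* = 1 by rewrite rmorph1.
  have -> : (-1 : R[i])^* = -1 by rewrite rmorphN1.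
  have -> : I^* = - I by apply: complex_eq; rewrite ?cReJ ?cImJ /= ?oppr0.
  have -> : (- I)^* = I by rewrite conjcN; apply: complex_eq; rewrite ?cReN ?cImN ?cReJ ?cImJ /= ?oppr0 ?opprK.
  move: (bform f u u) (bform f u v) (bform h v u) (bform h v v) => x1 x2 x3 x4.
  rewrite !(cReD, cReM, cReN, cImN) /=; ring.
have n4 : normc (4%:R * bform f u v) = 4 * normc (bform f u v).
  by rewrite normcM; congr (_ * _); rewrite -(rmorph_nat (real_complex R)) normcC ger0_norm.
have : normc (4%:R * bform f u v) <= 2 * (q 1 + q (-1) + q I + q (- I)).
  by rewrite E; apply: normcD4_le; exact: n1.
by rewrite n4 Q; exact: quarter_le.
Qed.

Lemma S_scale (c : R[i]) u f : S (u, f) -> S (fun x => c * u x, fun x => c * f x).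
Proof.
move=> uf; have [_ S0 lin] := linS; have := lin c _ _ _ _ uf S0.
by congr (S (_, _)); apply/funext => x; rewrite addr0.
Qed.

Lemma qform_scale c u f : S (u, f) ->
  qform (fun x => c * f x) (fun x => c * u x) = csq c * qform f u.
Proof.
move=> /SL[ul fl]; rewrite /qform innerZl//; last exact: L2Z.
rewrite innerZr// nrm2Z// mulrA mulJc cReM /=; ring.
Qed.

(* The previous bound for s u and s^-1 v, with s > 0 arbitrary. *)
Lemma bform_bound u f v h : S (u, f) -> S (v, h) ->
  csq (bform f u v) <= 16 * (qform f u * qform h v).
Proof.
move=> uf vh; rewrite -sqr_normc; apply: sqr_le_of_scaled_sum.
- exact: normc_ge0.
- exact: qform_ge0.
- exact: qform_ge0.
move=> t t0; pose s := Num.sqrt t.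
have s0 : 0 < s by rewrite sqrtr_gt0.
have := bform_sum (S_scale s%:C uf) (S_scale s^-1%:C vh).
rewrite !qform_scale// !csqC exprVn (sqr_sqrtr (ltW t0)).
suff -> : bform (fun x => s%:C * f x) (fun x => s%:C * u x) (fun x => s^-1%:C * v x) = bform f u v by [].
have [ul fl] := SL uf; have [vl hl] := SL vh.
rewrite /bform !innerZl//; [|exact: L2Z..].
rewrite !innerZr//.
have -> : (s^-1%:C)^* = s^-1%:C by apply: complex_eq; rewrite ?cReJ ?cImJ //= oppr0.
have ss : s%:C * s^-1%:C = 1 by rewrite -rmorphM/= divff ?gt_eqF.
by rewrite !mulrA ss -[_ * s%:C * _]mulrA ss mulr1 mul1r.
Qed.

Lemma bformBl f g u v w : L2 f -> L2 g -> L2 u -> L2 v -> L2 w ->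
  bform (fun x => f x - g x) (fun x => u x - v x) w = bform f u w - bform g v w.
Proof. by move=> fl gl ul vl wl; rewrite /bform !innerBl//; ring. Qed.

Lemma bformBr f u v w : L2 f -> L2 u -> L2 v -> L2 w ->
  bform f u (fun x => v x - w x) = bform f u v - bform f u w.
Proof. by move=> fl ul vl wl; rewrite /bform !innerBr//; ring. Qed.

Lemma S_sub u v f g : S (u, f) -> S (v, g) ->
  S (fun x => u x - v x, fun x => f x - g x).
Proof. exact: linear_graphB linS. Qed.

Lemma bform_diff u f v h u' f' v' h' : S (u, f) -> S (v, h) -> S (u', f') -> S (v', h') ->
  csq (bform f u v - bform f' u' v') <=
  32 * (qform (fun x => f x - f' x) (fun x => u x - u' x) * qform h v) +
  32 * (qform f' u' * qform (fun x => h x - h' x) (fun x => v x - v' x)).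
Proof.
move=> uf vh uf' vh'.
have [ul fl] := SL uf; have [vl hl] := SL vh; have [ul' fl'] := SL uf'.
have [vl' hl'] := SL vh'.
have -> : bform f u v - bform f' u' v' =
  bform (fun x => f x - f' x) (fun x => u x - u' x) v + bform f' u' (fun x => v x - v' x).
  by rewrite bformBl// bformBr//; ring.
apply: le_trans (csqD_le _ _) _.
have h1 := bform_bound (S_sub uf uf') vh; have h2 := bform_bound uf' (S_sub vh vh').
lra.
Qed.

(** The parallelogram law for q, with q[u - v] >= 0. *)
Lemma qformD_le u f v h : S (u, f) -> S (v, h) ->
  qform (fun x => f x + h x) (fun x => u x + v x) <= 2 * qform f u + 2 * qform h v.
Proof.
move=> uf vh.
have [_ _ lin] := linS; have := qform_ge0 (lin (-1) _ _ _ _ vh uf).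
have E (c : R[i]) : csq c = 1 -> qform (fun x => c * h x + f x) (fun x => c * v x + u x) =
    qform f u + qform h v + Re (c^* * bform f u v + c * bform h v u).
  move=> c1; rewrite !qformE bform_expand// c1.
  move: (bform f u u) (bform f u v) (bform h v u) (bform h v v) => x1 x2 x3 x4.
  by rewrite !(cReD, cReM) /=; ring.
have c1 : csq (1 : R[i]) = 1 by rewrite /csq /= expr1n expr0n addr0.
have c2 : csq (-1 : R[i]) = 1 by rewrite csqN.
have -> : (fun x => f x + h x) = (fun x => 1 * h x + f x) by apply/funext => x; rewrite mul1r addrC.
have -> : (fun x => u x + v x) = (fun x => 1 * v x + u x) by apply/funext => x; rewrite mul1r addrC.
rewrite !E// rmorphN1 rmorph1 !mulN1r !mul1r.
move: (bform f u v) (bform h v u) => a b; rewrite !(cReD, cReN); lra.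
Qed.

Definition qcauchy us fs := forall e, 0 < e -> exists N, forall n m,
  (N <= n)%N -> (N <= m)%N ->
  qform (fun x => fs n x - fs m x) (fun x => us n x - us m x) < e.

(** The counterpart of [form_cvg] with explicit images fs, and with q in place of the modulus of the
    unshifted form. Both Cauchy conditions agree, because us converges in L^2 and the modulus of the
    shifted form is at most 2 q. *)
Definition fcv us fs u :=
  [/\ forall n, S (us n, fs n), L2 u, cvgL2 us u & qcauchy us fs].

Local Notation sform := (operator_form S).

Lemma op_appP u : op_dom S u -> S (u, op_app S u).
Proof. by move=> [f uf]; exact: (@xgetPex _ (fun=> 0) [set g | S (u, g)] (ex_intro _ f uf)). Qed.

Lemma op_dom_S u f : S (u, f) -> op_dom S u.
Proof. by exists f. Qed.

Lemma op_app_inner u f v : S (u, f) -> L2 v -> inner (op_app S u) v = inner f v.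
Proof.
move=> uf vl; have uo := op_appP (op_dom_S uf).
have [ul ol] := SL uo; have [_ fl] := SL uf.
apply: inner_aeeq; try exact: L2_meas; [exact: Suniq uo uf|exact: aeeq_refl].
Qed.

Lemma sformE u v : form_app sform u v = inner (op_app S u) v.
Proof. by []. Qed.

Lemma cvgL2_cauchy us u e : (forall n, L2 (us n)) -> L2 u -> cvgL2 us u -> 0 < e ->
  exists N, forall n m, (N <= n)%N -> (N <= m)%N -> nrm2 (fun x => us n x - us m x) < e.
Proof.
move=> usl ul /cvgL2P H e0; have {}H := H usl ul.
have e4 : 0 < e / 4 by rewrite divr_gt0.
have /cvgrPdist_lt/(_ _ e4)[N _ HN] := H.
exists N => n m Nn Nm.
have := HN _ Nn; have := HN _ Nm; rewrite /= !sub0r !normrN !ger0_norm ?nrm2_ge0// => h1 h2.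
apply: le_lt_trans (_ : 2 * nrm2 (fun x => us n x - u x) + 2 * nrm2 (fun x => us m x - u x) < _); last by lra.
rewrite -(nrm2N (fun x => us m x - u x)).
apply: le_trans (nrm2D_le (L2B (usl n) ul) (L2N (L2B (usl m) ul))).
by rewrite le_eqVlt; apply/orP; left; apply/eqP; apply: eq_Rintegral => x _; congr csq; ring.
Qed.

Lemma fcv_form_cvg us fs u : fcv us fs u -> form_cvg sform us u.
Proof.
move=> [usS ul cu qc]; split => //; first by move=> n; exact: op_dom_S (usS n).
move=> e e0; have e4 : 0 < e / 4 by rewrite divr_gt0.
have [N1 H1] := qc _ e4.
(* This accuracy controls the shift term; the added 1 keeps the divisor positive when K = -1. *)
have e5 : 0 < e / (4 * (`|K + 1| + 1)) by rewrite divr_gt0// mulr_gt0// ltr_wpDl.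
have usl n : L2 (us n) by case: (SL (usS n)).
have [N2 H2] := cvgL2_cauchy usl ul cu e5.
exists (maxn N1 N2) => n m; rewrite !geq_max => /andP[n1 n2] /andP[m1 m2].
have d := S_sub (usS n) (usS m).
rewrite sformE (op_app_inner d); last by case: (SL d).
have {}H1 := H1 n m n1 m1; have {}H2 := H2 n m n2 m2.
set w := fun x => us n x - us m x in d H1 H2 *.
set h := fun x => fs n x - fs m x in d H1 *.
have -> : inner h w = bform h w w - (K + 1)%:C * inner w w by rewrite /bform; ring.
rewrite (le_lt_trans (normcB _ _))// innerE normcM !normcC (ger0_norm (nrm2_ge0 w)).
have b := bform_diag d.
have : `|K + 1| * nrm2 w < e / 4.
  apply: (@le_lt_trans _ _ ((`|K + 1| + 1) * nrm2 w)).
    by rewrite ler_wpM2r ?nrm2_ge0// lerDl.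
  have k1 : 0 < `|K + 1| + 1 by rewrite ltr_wpDl.
  by rewrite mulrC -ltr_pdivlMr// -mulrA -invfM.
lra.
Qed.

Lemma form_cvg_fcv us u : form_cvg sform us u -> fcv us (fun n => op_app S (us n)) u.
Proof.
move=> [usd ul cu H].
have usS n : S (us n, op_app S (us n)) by exact: op_appP (usd n).
split => // e e0; have e4 : 0 < e / 2 by rewrite divr_gt0.
have [N1 H1] := H _ e4.
have e5 : 0 < e / (4 * (`|K + 1| + 1)) by rewrite divr_gt0// mulr_gt0// ltr_wpDl.
have usl n : L2 (us n) by case: (SL (usS n)).
have [N2 H2] := cvgL2_cauchy usl ul cu e5.
exists (maxn N1 N2) => n m; rewrite !geq_max => /andP[n1 n2] /andP[m1 m2].
have d := S_sub (usS n) (usS m).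
have := H1 n m n1 m1; rewrite sformE (op_app_inner d); last by case: (SL d).
have {}H2 := H2 n m n2 m2.
set w := fun x => us n x - us m x in d H2 *.
set h := fun x => _ - _ in d *.
move=> H3; rewrite /qform.
have r : Re (inner h w) < e / 2.
  by apply: le_lt_trans H3; rewrite (le_trans (ler_norm _))// Re_le_normc.
have : `|K + 1| * nrm2 w < e / 4.
  apply: (@le_lt_trans _ _ ((`|K + 1| + 1) * nrm2 w)).
    by rewrite ler_wpM2r ?nrm2_ge0// lerDl.
  have k1 : 0 < `|K + 1| + 1 by rewrite ltr_wpDl.
  by rewrite mulrC -ltr_pdivlMr// -mulrA -invfM.
have : (K + 1) * nrm2 w <= `|K + 1| * nrm2 w by rewrite ler_wpM2r ?nrm2_ge0// ler_norm.
lra.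
Qed.

Lemma fcv_bounded us fs u : fcv us fs u ->
  exists M N, 0 <= M /\ forall n, (N <= n)%N -> qform (fs n) (us n) <= M.
Proof.
move=> [usS ul cu qc]; have [N HN] := qc 1 ltr01.
exists (2 + 2 * qform (fs N) (us N)), N; split.
  by have := qform_ge0 (usS N); lra.
move=> n Nn; have := HN n N Nn (leqnn N).
have := qformD_le (S_sub (usS n) (usS N)) (usS N).
have -> : (fun x => fs n x - fs N x + fs N x) = fs n by apply/funext => x; rewrite subrK.
have -> : (fun x => us n x - us N x + us N x) = us n by apply/funext => x; rewrite subrK.
lra.
Qed.

(* q[w_n] = b[w_n, w_n - w_m] + b[w_n, w_m]: the first term is small because the
   sequence is q-Cauchy, the second as m tends to infinity for fixed n. *)
Lemma fcv_closable ws hs : fcv ws hs (fun=> 0) ->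
  forall e, 0 < e -> exists N, forall n, (N <= n)%N -> qform (hs n) (ws n) < e.
Proof.
move=> wc; have [wsS _ cw qc] := wc; move=> e e0.
have [M [N1 [M0 HM]]] := fcv_bounded wc.
pose d := (e / 4) ^+ 2 / (16 * (M + 1)).
have d0 : 0 < d by rewrite divr_gt0 ?exprn_gt0 ?divr_gt0// mulr_gt0//; lra.
have [N2 H2] := qc d d0.
exists (maxn N1 N2) => n; rewrite geq_max => /andP[n1 n2].
have [wl hl] := SL (wsS n).
have wsl m : L2 (ws m) by case: (SL (wsS m)).
pose F x := hs n x + (K + 1)%:C * ws n x.
have Fl : L2 F by apply: L2D => //; exact: L2Z.
have F1 : 0 < nrm2 F + 1 by rewrite ltr_wpDl// nrm2_ge0.
have e2 : 0 < (e / 4) ^+ 2 / (nrm2 F + 1) by rewrite divr_gt0 ?exprn_gt0 ?divr_gt0.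
have cw' : nrm2 (fun x => ws n x - 0) @[n --> \oo] --> (0 : R).
  by apply/cvgL2P => //; exact: L2_0.
have /cvgrPdist_lt/(_ _ e2)[N3 _ H3] := cw'.
pose m := maxn N2 N3.
have m2 : (N2 <= m)%N by rewrite leq_maxl.
have m3 : (N3 <= m)%N by rewrite leq_maxr.
have {}H2 := H2 n m n2 m2.
have {}H3 : nrm2 (ws m) < (e / 4) ^+ 2 / (nrm2 F + 1).
  have := H3 m m3; rewrite /= sub0r normrN ger0_norm ?nrm2_ge0//.
  by under eq_fun do rewrite subr0.
have HMn := HM n n1.
have q0 := qform_ge0 (wsS n).
have sq_lt (x y : R) : 0 <= y -> x ^+ 2 <= y ^+ 2 -> x <= y.
  move=> y0 xy; rewrite (le_trans (ler_norm x))// -ler_sqr ?nnegrE//.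
  by rewrite real_normK ?num_real.
have e40 : 0 <= e / 4 by rewrite divr_ge0// ltW.
have B1 : Re (bform (hs n) (ws n) (fun x => ws n x - ws m x)) <= e / 4.
  apply: sq_lt => //; apply: (@le_trans _ _ (csq (bform (hs n) (ws n) (fun x => ws n x - ws m x)))).
    by rewrite /csq lerDl sqr_ge0.
  apply: le_trans (bform_bound (wsS n) (S_sub (wsS n) (wsS m))) _.
  have k0 := qform_ge0 (S_sub (wsS n) (wsS m)).
  apply: (@le_trans _ _ (16 * ((M + 1) * d))).
    rewrite ler_wpM2l// ler_pM//; last exact: ltW.
    by rewrite (le_trans HMn)// lerDl.
  rewrite /d le_eqVlt; apply/orP; left; apply/eqP; field.
  by rewrite gt_eqF//; lra.
have B2 : Re (bform (hs n) (ws n) (ws m)) <= e / 4.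
  apply: sq_lt => //; apply: (@le_trans _ _ (csq (bform (hs n) (ws n) (ws m)))).
    by rewrite /csq lerDl sqr_ge0.
  have -> : bform (hs n) (ws n) (ws m) = inner F (ws m).
    by rewrite /bform innerDl ?innerZl//; exact: L2Z.
  apply: le_trans (cauchy_schwarz Fl (wsl m)) _.
  apply: (@le_trans _ _ ((nrm2 F + 1) * nrm2 (ws m))).
    by rewrite ler_wpM2r ?nrm2_ge0// lerDl.
  by rewrite mulrC -ler_pdivlMr// ltW.
have : qform (hs n) (ws n) = Re (bform (hs n) (ws n) (fun x => ws n x - ws m x)) +
    Re (bform (hs n) (ws n) (ws m)).
  rewrite qformE bformBr//; move: (bform _ _ (ws n)) (bform _ _ (ws m)) => a b.
  by rewrite cReD cReN subrK.
lra.
Qed.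

(** Differences of two sequences with the same limit are form-convergent to 0, hence q tends to 0
    along them by [fcv_closable]. Together with [bform_diff] this makes the limit of the form
    independent of the approximating sequences. *)
Lemma bform_fcv_close us fs us' fs' u vs hs vs' hs' v :
  fcv us fs u -> fcv us' fs' u -> fcv vs hs v -> fcv vs' hs' v ->
  forall e, 0 < e -> exists N, forall n, (N <= n)%N ->
    csq (bform (fs n) (us n) (vs n) - bform (fs' n) (us' n) (vs' n)) < e.
Proof.
have fcvB ws gs ws' gs' w : fcv ws gs w -> fcv ws' gs' w ->
    fcv (fun n x => ws n x - ws' n x) (fun n x => gs n x - gs' n x) (fun=> 0).
  move=> [S1 wl c1 q1] [S2 _ c2 q2]; split.
  - by move=> n; exact: S_sub.
  - exact: L2_0.
  - have l1 n : L2 (ws n) by case: (SL (S1 n)).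
    have l2 n : L2 (ws' n) by case: (SL (S2 n)).
    apply/cvgL2P => //; [by move=> n; exact: L2B|exact: L2_0|].
    have {}c1 : nrm2 (fun x => ws n x - w x) @[n --> \oo] --> (0 : R) by apply/cvgL2P.
    have {}c2 : nrm2 (fun x => ws' n x - w x) @[n --> \oo] --> (0 : R) by apply/cvgL2P.
    apply: (@squeeze_cvgr _ _ _ _ (fun=> 0) (fun n => 2 * nrm2 (fun x => ws n x - w x) +
       2 * nrm2 (fun x => ws' n x - w x))).
    + apply: nearW => n; rewrite nrm2_ge0/= -(nrm2N (fun x => ws' n x - w x)).
      apply: le_trans (nrm2D_le (L2B (l1 n) wl) (L2N (L2B (l2 n) wl))).
      rewrite le_eqVlt; apply/orP; left; apply/eqP; apply: eq_Rintegral => x _; congr csq; ring.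
    + exact: cvg_cst.
    + have E : (0 : R) = 2 * 0 + 2 * 0 by ring.
      by rewrite [X in _ --> X]E; apply: cvgD; apply: cvgM => //; exact: cvg_cst.
  - move=> e e0; have e4 : 0 < e / 4 by rewrite divr_gt0.
    have [N1 H1] := q1 _ e4; have [N2 H2] := q2 _ e4.
    exists (maxn N1 N2) => n m; rewrite !geq_max => /andP[n1 n2] /andP[m1 m2].
    have {}H1 := H1 n m n1 m1; have {}H2 := H2 n m n2 m2.
    have d1 := S_sub (S1 n) (S1 m); have d2 := S_sub (S2 n) (S2 m).
    have := qformD_le d1 (S_scale (-1) d2).
    rewrite (qform_scale _ d2) csqN.
    have -> : csq (1 : R[i]) = 1 by rewrite /csq /= expr1n expr0n addr0.
    rewrite (_ : (fun x => gs n x - gs m x + -1 * (gs' n x - gs' m x)) =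
      (fun x => gs n x - gs' n x - (gs m x - gs' m x))); last by apply/funext => x; ring.
    rewrite (_ : (fun x => ws n x - ws m x + -1 * (ws' n x - ws' m x)) =
      (fun x => ws n x - ws' n x - (ws m x - ws' m x))); last by apply/funext => x; ring.
    lra.
move=> cu cu' cv cv' e e0.
have du := fcvB _ _ _ _ _ cu cu'; have dv := fcvB _ _ _ _ _ cv cv'.
have [M [N1 [M0 HM]]] := fcv_bounded cv; have [M' [N2 [M'0 HM']]] := fcv_bounded cu'.
have k0 : 0 < 32 * (M + M' + 1) by rewrite mulr_gt0//; lra.
have e1 : 0 < e / 2 / (32 * (M + M' + 1)) by rewrite !divr_gt0.
have [N3 H3] := fcv_closable du e1; have [N4 H4] := fcv_closable dv e1.
have [uS _ _ _] := cu; have [uS' _ _ _] := cu'; have [vS _ _ _] := cv; have [vS' _ _ _] := cv'.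
exists (maxn (maxn N1 N2) (maxn N3 N4)) => n; rewrite !geq_max => /andP[/andP[n1 n2] /andP[n3 n4]].
have {}HM := HM n n1; have {}HM' := HM' n n2; have {}H3 := H3 n n3; have {}H4 := H4 n n4.
apply: le_lt_trans (bform_diff (uS n) (vS n) (uS' n) (vS' n)) _.
apply: two_products_lt M0 M'0 e0 _ _ _ _; apply/andP; split => //.
- exact: qform_ge0 (vS n).
- exact: qform_ge0 (uS' n).
- exact: qform_ge0 (S_sub (uS n) (uS' n)).
- exact: qform_ge0 (S_sub (vS n) (vS' n)).
Qed.

Lemma inner_bform us fs u vs hs v z : fcv us fs u -> fcv vs hs v ->
  ccvg (fun n => bform (fs n) (us n) (vs n)) z ->
  ccvg (fun n => inner (fs n) (vs n)) (z - (K + 1)%:C * inner u v).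
Proof.
move=> [uS ul cu _] [vS vl cv _] Hz.
have := inner_cvg (fun n => (SL (uS n)).1) (fun n => (SL (vS n)).1) ul vl cu cv.
move=> /(ccvgM (ccvg_cst (K + 1)%:C))/(ccvgB Hz).
by under eq_fun do rewrite /bform addrK.
Qed.

Lemma bform_inner us fs u vs hs v z : fcv us fs u -> fcv vs hs v ->
  ccvg (fun n => inner (fs n) (vs n)) z ->
  ccvg (fun n => bform (fs n) (us n) (vs n)) (z + (K + 1)%:C * inner u v).
Proof.
move=> [uS ul cu _] [vS vl cv _] Hz.
have := inner_cvg (fun n => (SL (uS n)).1) (fun n => (SL (vS n)).1) ul vl cu cv.
by move=> /(ccvgM (ccvg_cst (K + 1)%:C))/(ccvgD Hz).
Qed.

(** The values of [bform] are Cauchy by [bform_diff], since q is eventually bounded along both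
    sequences and small on their differences. The unshifted form differs from it by convergent inner
    products. *)
Lemma fcv_limit us fs u vs hs v : fcv us fs u -> fcv vs hs v ->
  exists z, ccvg (fun n => inner (fs n) (vs n)) z.
Proof.
move=> cu cv; suff [z Hz] : exists z, ccvg (fun n => bform (fs n) (us n) (vs n)) z.
  by exists (z - (K + 1)%:C * inner u v); exact: inner_bform cu cv Hz.
apply: ccvg_cauchy => e e0.
have [M [N1 [M0 HM]]] := fcv_bounded cv; have [M' [N2 [M'0 HM']]] := fcv_bounded cu.
have [uS _ _ qu] := cu; have [vS _ _ qv] := cv.
have k0 : 0 < 32 * (M + M' + 1) by rewrite mulr_gt0//; lra.
have e1 : 0 < e / 2 / (32 * (M + M' + 1)) by rewrite !divr_gt0.
have [N3 H3] := qu _ e1; have [N4 H4] := qv _ e1.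
exists (maxn (maxn N1 N2) (maxn N3 N4)) => n m.
rewrite !geq_max => /andP[/andP[n1 n2] /andP[n3 n4]] /andP[/andP[m1 m2] /andP[m3 m4]].
have {}HM := HM n n1; have {}HM' := HM' m m2; have {}H3 := H3 n m n3 m3; have {}H4 := H4 n m n4 m4.
apply: le_lt_trans (bform_diff (uS n) (vS n) (uS m) (vS m)) _.
apply: two_products_lt M0 M'0 e0 _ _ _ _; apply/andP; split => //.
- exact: qform_ge0 (vS n).
- exact: qform_ge0 (uS m).
- exact: qform_ge0 (S_sub (uS n) (uS m)).
- exact: qform_ge0 (S_sub (vS n) (vS m)).
Qed.

Local Notation cl := (form_app (form_closure sform)).

(** [xget] selects the limit along some pair of sequences; any other pair has the same limit by
    [bform_fcv_close]. *)
Lemma closure_form_limit us fs u vs hs v : fcv us fs u -> fcv vs hs v ->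
  ccvg (fun n => inner (fs n) (vs n)) (cl u v).
Proof.
move=> cu cv.
pose P := [set z | exists us vs, [/\ form_cvg sform us u, form_cvg sform vs v &
  normc (form_app sform (us n) (vs n) - z) @[n --> \oo] --> (0 : R)]].
have [z0 Hz0] := fcv_limit cu cv.
have P0 : P z0.
  exists us, vs; split; [exact: fcv_form_cvg cu|exact: fcv_form_cvg cv|].
  apply/ccvg_normc.
  have [uS _ _ _] := cu; have [vS _ _ _] := cv.
  by under eq_fun do rewrite sformE (op_app_inner (uS _) (SL (vS _)).1).
have : P (cl u v) by exact: (@xgetPex _ 0 P (ex_intro _ z0 P0)).
move=> [us' [vs' [cu' cv' /ccvg_normc Hz]]].
have {}cu' := form_cvg_fcv cu'; have {}cv' := form_cvg_fcv cv'.
suff -> : cl u v = z0 by [].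
have B0 := bform_inner cu cv Hz0.
have B1 := bform_inner cu' cv' Hz.
apply: (addIr ((K + 1)%:C * inner u v)); apply: ccvg_unique B1 _.
have d := bform_fcv_close cu cu' cv cv'.
set z := z0 + _ in B0 *.
have B2 : ccvg (fun n => bform (fs n) (us n) (vs n) - bform (op_app S (us' n)) (us' n) (vs' n)) 0.
  apply: ccvg_csq; apply/cvgrPdist_lt => e e0; have [N HN] := d e e0.
  exists N => // n Nn; rewrite /= sub0r normrN subr0 ger0_norm ?csq_ge0//.
  exact: HN.
have := ccvgB B0 B2; rewrite subr0.
by under eq_fun do rewrite opprB addrC subrK.
Qed.

Lemma fcv_lin (a : R[i]) us fs u vs hs v : fcv us fs u -> fcv vs hs v ->
  fcv (fun n x => a * us n x + vs n x) (fun n x => a * fs n x + hs n x)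
      (fun x => a * u x + v x).
Proof.
move=> [uS ul cu qu] [vS vl cv qv].
have l1 n : L2 (us n) by case: (SL (uS n)).
have l2 n : L2 (vs n) by case: (SL (vS n)).
split.
- by move=> n; have [_ _ lin] := linS; exact: lin.
- by apply: L2D => //; exact: L2Z.
- apply/cvgL2P; [by move=> n; apply: L2D => //; exact: L2Z|by apply: L2D => //; exact: L2Z|].
  have {}cu : nrm2 (fun x => us n x - u x) @[n --> \oo] --> (0 : R) by apply/cvgL2P.
  have {}cv : nrm2 (fun x => vs n x - v x) @[n --> \oo] --> (0 : R) by apply/cvgL2P.
  apply: (@squeeze_cvgr _ _ _ _ (fun=> 0) (fun n => 2 * (csq a * nrm2 (fun x => us n x - u x)) +
       2 * nrm2 (fun x => vs n x - v x))).
  + apply: nearW => n; rewrite nrm2_ge0/= -nrm2Z; last exact: L2B.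
    apply: le_trans (nrm2D_le (L2Z a (L2B (l1 n) ul)) (L2B (l2 n) vl)).
    rewrite le_eqVlt; apply/orP; left; apply/eqP; apply: eq_Rintegral => x _; congr csq; ring.
  + exact: cvg_cst.
  + have E : (0 : R) = 2 * (csq a * 0) + 2 * 0 by ring.
    rewrite [X in _ --> X]E; apply: cvgD; last by apply: cvgM => //; exact: cvg_cst.
    by apply: cvgM; [exact: cvg_cst|apply: cvgM => //; exact: cvg_cst].
- move=> e e0; have e4 : 0 < e / 4 by rewrite divr_gt0.
  have k0 : 0 < csq a + 1 by rewrite ltr_wpDl// csq_ge0.
  have e5 : 0 < e / 4 / (csq a + 1) by rewrite !divr_gt0.
  have [N1 H1] := qu _ e5; have [N2 H2] := qv _ e4.
  exists (maxn N1 N2) => n m; rewrite !geq_max => /andP[n1 n2] /andP[m1 m2].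
  have {}H1 := H1 n m n1 m1; have {}H2 := H2 n m n2 m2.
  have d1 := S_sub (uS n) (uS m); have d2 := S_sub (vS n) (vS m).
  have := qformD_le (S_scale a d1) d2.
  rewrite (qform_scale _ d1).
  rewrite (_ : (fun x => a * (fs n x - fs m x) + (hs n x - hs m x)) =
    (fun x => a * fs n x + hs n x - (a * fs m x + hs m x))); last by apply/funext => x; ring.
  rewrite (_ : (fun x => a * (us n x - us m x) + (vs n x - vs m x)) =
    (fun x => a * us n x + vs n x - (a * us m x + vs m x))); last by apply/funext => x; ring.
  have q0 := qform_ge0 d1.
  have : csq a * qform (fun x => fs n x - fs m x) (fun x => us n x - us m x) <= e / 4.
    apply: (@le_trans _ _ ((csq a + 1) * qform (fun x => fs n x - fs m x) (fun x => us n x - us m x))).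
      by rewrite ler_wpM2r// lerDl.
    by rewrite mulrC -ler_pdivlMr// ltW.
  lra.
Qed.

(** An instance of [operator_maximal], with the Friedrichs extension in the role of the larger
    graph. *)
Lemma friedrichs_closure : friedrichs S = T.
Proof.
apply/esym/(operator_maximal opT ontoT).
- split.
  + by move=> u f [[us [_ ul _ _]] [fl _]].
  + have fcv0 : fcv (fun _ _ => 0) (fun _ _ => 0) (fun=> 0).
      have [_ S0 _] := linS; split => //; first exact: L2_0.
        apply/cvgL2P => //; [by move=> _; exact: L2_0|exact: L2_0|].
        have -> : (fun n : nat => nrm2 (fun x : R => 0 - 0)) = (fun=> 0).
          apply/funext => _; rewrite /nrm2; under eq_Rintegral do rewrite subrr csq0.
          exact: Rintegral0.
        exact: cvg_cst.
      move=> e e0; exists 0%N => n m _ _.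
      have n0 : nrm2 (fun=> 0) = 0 :> R.
        by rewrite /nrm2; under eq_Rintegral do rewrite csq0; exact: Rintegral0.
      have E : (fun x : R => (0 : R[i]) - 0) = (fun=> 0) by apply/funext => x; rewrite subrr.
      by rewrite /qform E innerE n0 mulr0 addr0.
    split; first by exists (fun _ _ => 0); exact: fcv_form_cvg fcv0.
    split; first exact: L2_0.
    move=> v [vs /form_cvg_fcv cv]; have [vS vl _ _] := cv.
    have := closure_form_limit fcv0 cv.
    have z w : L2 w -> inner (fun=> 0) w = 0.
      move=> wl; transitivity (0 * inner (fun=> 0) w); last by rewrite mul0r.
      rewrite -(innerZl 0 L2_0 wl) (_ : (fun _ : R => 0 * (0 : R[i])) = (fun=> 0))//.
      by apply/funext => x; rewrite mul0r.
    move=> H; apply: (ccvg_unique H); rewrite z//.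
    by under eq_fun do rewrite (z _ (SL (vS _)).1); exact: ccvg_cst.
  + move=> a u v f g [[us /form_cvg_fcv cu] [fl Hf]] [[vs /form_cvg_fcv cv] [gl Hg]].
    have cl_ := fcv_lin a cu cv.
    split; first by eexists; exact: fcv_form_cvg cl_.
    split; first by apply: L2D => //; exact: L2Z.
    move=> w [ws cw']; have cw := form_cvg_fcv cw'; have [wS wl _ _] := cw.
    have [uS _ _ _] := cu; have [vS _ _ _] := cv.
    rewrite innerDl ?innerZl//; last exact: L2Z.
    rewrite -Hf; last by exists ws.
    rewrite -Hg; last by exists ws.
    have H1 := closure_form_limit cu cw; have H2 := closure_form_limit cv cw.
    have H3 := closure_form_limit cl_ cw.
    apply: ccvg_unique H3 _.
    have := ccvgD (ccvgM (ccvg_cst a) H1) H2.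
    have E n : inner (fun x => a * op_app S (us n) x + op_app S (vs n) x) (ws n) =
        a * inner (op_app S (us n)) (ws n) + inner (op_app S (vs n)) (ws n).
      have [_ l1] := SL (uS n); have [_ l2] := SL (vS n); have [l3 _] := SL (wS n).
      by rewrite innerDl ?innerZl//; exact: L2Z.
    by under [X in _ -> ccvg X _]eq_fun do rewrite E.
(* The sector inequality is closed, so it passes to the limit along a form-convergent sequence in
   the domain of S. *)
- move=> u f [[us cu'] [fl Hf]]; have cu := form_cvg_fcv cu'.
  have [uS ul cL _] := cu.
  have := closure_form_limit cu cu; rewrite Hf; last by exists us.
  move=> [Hr Hi].
  have l1 n : L2 (us n) by case: (SL (uS n)).
  have [Hn _] := inner_cvg l1 l1 ul ul cL cL.
  have Hn' : nrm2 (us n) @[n --> \oo] --> nrm2 u.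
    by have -> : (fun n => nrm2 (us n)) = (fun n => Re (inner (us n) (us n)));
      [apply/funext => n; rewrite innerE|move: Hn; rewrite [inner u u]innerE].
  rewrite -subr_ge0.
  have H : (Re (inner (op_app S (us n)) (us n)) + K * nrm2 (us n) -
       `|Im (inner (op_app S (us n)) (us n))|) @[n --> \oo] -->
     (Re (inner f u) + K * nrm2 u - `|Im (inner f u)|).
    apply: cvgB; last exact: cvg_norm.
    by apply: cvgD => //; apply: cvgM => //; exact: cvg_cst.
  rewrite -(cvg_lim (@Rhausdorff R) H); apply: limr_ge; first by apply/cvg_ex; eexists; exact: H.
  by apply: nearW => n; rewrite subr_ge0; apply: secT; apply: ST; exact: uS.
- move=> [u f] uf; have [TL _ _ _ _] := opT; have [ul fl] := TL _ _ uf.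
  have [us [fs [usS cu cf]]] := core uf.
  have l1 n : L2 (us n) by case: (SL (usS n)).
  have l2 n : L2 (fs n) by case: (SL (usS n)).
  (* Graph convergence implies form convergence, since Re (h, w) <= (|h|^2 + |w|^2) / 2 for the
     differences h and w. *)
  have fu : fcv us fs u.
    split => // e e0.
    have e4 : 0 < e / (4 * (`|K + 1| + 1)) by rewrite divr_gt0// mulr_gt0// ltr_wpDl.
    have e1 : 0 < e / 4 by rewrite divr_gt0.
    have [N1 H1] := cvgL2_cauchy l1 ul cu e4.
    have [N2 H2] := cvgL2_cauchy l2 fl cf e1.
    exists (maxn N1 N2) => n m; rewrite !geq_max => /andP[n1 n2] /andP[m1 m2].
    have {}H1 := H1 n m n1 m1; have {}H2 := H2 n m n2 m2.
    have w1 := L2B (l1 n) (l1 m); have w2 := L2B (l2 n) (l2 m).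
    set w := fun x => us n x - us m x in H1 w1 *.
    set h := fun x => fs n x - fs m x in H2 w2 *.
    have r : Re (inner h w) <= (nrm2 h + nrm2 w) / 2.
      have := nrm2_ge0 (fun x => h x - w x).
      rewrite nrm2D//; last exact: L2N.
      rewrite innerNr// nrm2N cReN; lra.
    have k1 : 0 < `|K + 1| + 1 by rewrite ltr_wpDl.
    have : (`|K + 1| + 1) * nrm2 w < e / 4.
      by rewrite mulrC -ltr_pdivlMr// -mulrA -invfM.
    have : (K + 1) * nrm2 w <= `|K + 1| * nrm2 w by rewrite ler_wpM2r ?nrm2_ge0// ler_norm.
    have := nrm2_ge0 w.
    rewrite /qform mulrDl mul1r; lra.
  split; first by exists us; exact: fcv_form_cvg fu.
  split => // v [vs /form_cvg_fcv cv]; have [vS vl cvL _] := cv.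
  have H1 := closure_form_limit fu cv.
  apply: (ccvg_unique H1); apply: inner_cvg => // n.
  by case: (SL (vS n)).
Qed.

End Friedrichs.

(** * Test functions and H^1 *)

Section SmoothFunctions.
Context {R : realType}.
Implicit Types (f g : R -> R) (p q : {poly R}) (a b c t x y : R).

(** For n > 0, raise t <= n e^(t / n), a consequence of 1 + s <= e^s, to the n-th power. *)
Lemma pow_expR_bound (n : nat) t : 0 <= t -> t ^+ n * expR (- t) <= n%:R ^+ n.
Proof.
move=> t0; rewrite expRN -ler_pdivlMr ?invr_gt0 ?expR_gt0// invrK.
case: n => [|n]; first by rewrite !expr0 mul1r -[leLHS]expR0 ler_expR.
have -> : expR t = expR (t / n.+1%:R) ^+ n.+1.
  by rewrite -expRM_natr divfK// pnatr_eq0.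
rewrite -exprMn; apply: lerXn2r; rewrite ?nnegrE//.
apply: (@le_trans _ _ (n.+1%:R * (1 + t / n.+1%:R))).
  by rewrite mulrDr mulr1 mulrC divfK ?pnatr_eq0// lerDr ler0n.
by rewrite ler_wpM2l ?ler0n// expR_ge1Dx.
Qed.

Lemma poly_expR_bound p : exists2 C, 0 <= C & forall t, 0 <= t -> `|p.[t] * expR (- t)| <= C.
Proof.
exists (\sum_(i < size p) `|p`_i| * (i%:R ^+ i)).
  by apply: sumr_ge0 => i _; rewrite mulr_ge0// exprn_ge0// ler0n.
move=> t t0; rewrite horner_coef mulr_suml (le_trans (ler_norm_sum _ _ _))//.
apply: ler_sum => i _; rewrite -mulrA normrM ler_wpM2l//.
by rewrite ger0_norm ?mulr_ge0 ?exprn_ge0 ?expR_ge0// pow_expR_bound.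
Qed.

(** The classical smooth function exp (- 1 / x), flat at 0, times a polynomial in 1 / x. The
    polynomial factor makes the family closed under differentiation: p becomes X^2 (p - p'). *)
Definition flat p x := if 0 < x then p.[x^-1] * expR (- x^-1) else 0.

Lemma flat_bounded p : exists2 C, 0 <= C & forall x, `|flat p x| <= C.
Proof.
have [C C0 H] := poly_expR_bound p; exists C => // x.
rewrite /flat; case: ifP => x0; last by rewrite normr0.
by apply: H; rewrite invr_ge0 ltW.
Qed.

Lemma is_derive_flat p x : is_derive x 1 (flat p) (flat ('X^2 * (p - p^`())) x).
Proof.
case: (ltrgtP 0 x) => [x0|x0|<-].
- have xn0 : x != 0 by rewrite gt_eqF.
  have D : is_derive x 1 (fun y => p.[y^-1] * expR (- y^-1)) (flat ('X^2 * (p - p^`())) x).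
    have d1 : is_derive x 1 (fun y : R => y^-1) (- (x ^- 2)).
      by apply: is_derive_eq (is_deriveV xn0 (is_derive_id x (1 : R))) _; rewrite /GRing.scale /= mulr1.
    have d2 := is_derive1_comp (is_derive_poly p x^-1) d1.
    have d3 := @is_derive1_comp _ expR (fun y : R => - y^-1) x _ _ (is_derive_expR (- x^-1)) (is_deriveN d1).
    apply: (is_derive_eq (is_deriveM d2 d3)).
    rewrite /flat x0 !hornerE /GRing.scale /= -!exprVn; ring.
  apply: near_eq_is_derive D.
  near=> y; rewrite /flat ifT//; near: y; exact: lt_nbhsr.
- have -> : flat ('X^2 * (p - p^`())) x = 0 by rewrite /flat ltNge (ltW x0).
  apply: near_eq_is_derive (is_derive_cst (0 : R) x 1).
  near=> y; rewrite /flat ltNge ltW//=; near: y; exact: lt_nbhsl.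
- have -> : flat ('X^2 * (p - p^`())) 0 = 0 by rewrite /flat ltxx.
  have [C C0 H] := flat_bounded ('X^2 * p).
  have F : (fun h => h^-1 *: ((flat p \o shift 0) (h *: (1 : R)) - flat p 0)) @ 0^' --> (0 : R).
    apply/cvgr0Pnorm_lt => e e0.
    have eC : 0 < e / (C + 1) by rewrite divr_gt0// ltr_wpDl.
    near=> h; have hn0 : h != 0 by near: h; exact: nbhs_dnbhs_neq.
    have hs : `|h| < e / (C + 1).
      by near: h; apply: dnbhs0_lt.
    rewrite /= addr0 [flat p 0]/flat ltxx subr0 /GRing.scale /= mulr1.
    apply: (@le_lt_trans _ _ (`|h| * C)); last first.
      apply: (@le_lt_trans _ _ (`|h| * (C + 1))); first by rewrite ler_wpM2l// lerDl.
      by rewrite -ltr_pdivlMr// ltr_wpDl.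
    (* At 0 the difference quotient is h times another member of the family, which is bounded. *)
    have -> : h^-1 * flat p h = h * flat ('X^2 * p) h.
      rewrite /flat; case: ifP => // h0; last by rewrite !mulr0.
      have -> : ('X^2 * p).[h^-1] = h^-1 * h^-1 * p.[h^-1] by rewrite !hornerE; ring.
      by rewrite !mulrA divff// mul1r.
    by rewrite normrM ler_wpM2l.
  apply: DeriveDef; first by apply/cvg_ex; exists 0.
  exact: (cvg_lim (@Rhausdorff R) F).
Unshelve. all: by end_near. Qed.

(* Closed under differentiation, so that smoothness follows by induction. *)
Inductive bump : (R -> R) -> Prop :=
| bump_flat p a b : bump (fun x => flat p (a * x + b))
| bump_cst c : bump (fun=> c)
| bumpD f g : bump f -> bump g -> bump (fun x => f x + g x)
| bumpM f g : bump f -> bump g -> bump (fun x => f x * g x).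

Lemma is_derive_affine a b x : is_derive x 1 (fun y => a * y + b) a.
Proof.
apply: (is_derive_eq (is_deriveD (is_deriveZ a (is_derive_id x (1 : R))) (is_derive_cst b x (1 : R)))).
by rewrite addr0 /GRing.scale /= mulr1.
Qed.

Lemma bump_derive f : bump f -> exists2 g, bump g & forall x, is_derive x 1 f (g x).
Proof.
elim=> [p a b|c|{}f g _ [f' bf' Hf] _ [g' bg' Hg]|{}f g bf [f' bf' Hf] bg [g' bg' Hg]].
- exists (fun x => a * flat ('X^2 * (p - p^`())) (a * x + b)).
    by apply: bumpM; [exact: bump_cst|exact: bump_flat].
  move=> x; rewrite mulrC.
  exact: (@is_derive1_comp _ (flat p) (fun y => a * y + b) x _ _ (is_derive_flat p (a * x + b)) (is_derive_affine a b x)).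
- by exists (fun=> 0); [exact: bump_cst|move=> x; exact: is_derive_cst].
- exists (fun x => f' x + g' x); first exact: bumpD.
  by move=> x; exact: is_deriveD.
- exists (fun x => f' x * g x + f x * g' x); first by apply: bumpD; exact: bumpM.
  move=> x; apply: (is_derive_eq (is_deriveM (Hf x) (Hg x))).
  by rewrite /GRing.scale /= addrC [g x * _]mulrC.
Qed.

Lemma bump_bounded f : bump f -> exists2 C, 0 <= C & forall x, `|f x| <= C.
Proof.
elim=> [p a b|c|{}f g _ [C1 C10 H1] _ [C2 C20 H2]|{}f g _ [C1 C10 H1] _ [C2 C20 H2]].
- by have [C C0 H] := flat_bounded p; exists C.
- by exists `|c|.
- exists (C1 + C2); first exact: addr_ge0.
  by move=> x; rewrite (le_trans (ler_normD _ _))// lerD.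
- exists (C1 * C2); first exact: mulr_ge0.
  by move=> x; rewrite normrM ler_pM.
Qed.

Lemma bump_cont f : bump f -> continuous f.
Proof.
move=> /bump_derive[g _ H] x; apply: differentiable_continuous.
by apply/derivable1_diffP; have [] := H x.
Qed.

Definition rsmooth f := forall n x, derivable (derive1n n f) x 1.

Lemma rsmooth_derive1 f : (forall x, derivable f x 1) -> rsmooth (derive1 f) -> rsmooth f.
Proof. by move=> d H [|n] x; [exact: d|rewrite derive1Sn; exact: H]. Qed.

Lemma rsmooth_bump f : bump f -> rsmooth f.
Proof.
move=> bf n; elim: n f bf => [|n IH] f bf x; have [g bg H] := bump_derive bf.
  by have [] := H x.
rewrite derive1Sn; have -> : derive1 f = g by apply/funext => y; exact: derive1_is_derive.
exact: IH.
Qed.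

End SmoothFunctions.

(** * The fundamental lemma and the du Bois-Reymond lemma *)

Section DuBoisReymond.
Context {R : realType}.
Local Notation mu := (@lebesgue_measure R).
Implicit Types (f g h v : R -> R) (a b c t x y A : R).

Lemma Rint_supp (D : set R) f : (forall x, ~ D x -> f x = 0) ->
  \int[mu]_x f x = \int[mu]_(x in D) f x.
Proof.
move=> H; rewrite [RHS]Rintegral_mkcond; apply: eq_Rintegral => x _.
rewrite patchE; case: ifPn => // xD; apply: H => Dx.
by move: xD; rewrite mem_set.
Qed.

Lemma integrable_supp (D : set R) f : measurable D -> (forall x, ~ D x -> f x = 0) ->
  mu.-integrable D (EFin \o f) -> mu.-integrable setT (EFin \o f).
Proof.
move=> mD H fi; have := (integrable_mkcond (mu := mu) (EFin \o f) mD).1 fi.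
have -> // : (EFin \o f) \_ D = EFin \o f.
apply/funext => x; rewrite patchE; case: ifPn => //= xD; rewrite H// => Dx.
by move: xD; rewrite mem_set.
Qed.

Definition supported A f := forall x, A < `|x| -> f x = 0.

Lemma supported_itv A f x : supported A f -> ~ `[- A, A]%classic x -> f x = 0.
Proof.
move=> H /= /negP; rewrite in_itv/= => xA; apply: H.
by rewrite ltNge ler_norml.
Qed.

Lemma supported_le A B f : A <= B -> supported A f -> supported B f.
Proof. by move=> AB H x Bx; apply: H; exact: le_lt_trans Bx. Qed.

Lemma flat1_itv x : 0 <= flat 1 x <= 1.
Proof.
rewrite /flat; case: ifP => x0; last by rewrite lexx ler01.
by rewrite hornerE mul1r expR_ge0/= -[leRHS]expR0 ler_expR oppr_le0 invr_ge0 ltW.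
Qed.

Lemma flat1_cvg x : 0 < x -> flat 1 (n.+1%:R * x) @[n --> \oo] --> (1 : R).
Proof.
move=> x0.
have -> : (fun n => flat 1 (n.+1%:R * x)) = (fun n => expR (- (n.+1%:R^-1 * x^-1))).
  by apply/funext => n; rewrite /flat mulr_gt0 ?ltr0Sn// hornerE mul1r invfM.
have H : (- (n.+1%:R^-1 * x^-1)) @[n --> \oo] --> (- (0 * x^-1)).
  by apply: cvgN; apply: cvgM; [exact: cvg_harmonic|exact: cvg_cst].
rewrite mul0r oppr0 in H; rewrite -[X in _ --> X](@expR0 R).
by apply: continuous_cvg => //; exact: continuous_expR.
Qed.

(** Smooth functions that vanish outside []a, b[] and tend to its indicator: the steepness of both
    flanks grows with n. *)
Definition plateau a b (n : nat) x := flat 1 (n.+1%:R * x + - (n.+1%:R * a)) *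
  flat 1 (- n.+1%:R * x + n.+1%:R * b).

Lemma bump_plateau a b n : bump (plateau a b n).
Proof. by apply: bumpM; exact: bump_flat. Qed.

Lemma plateau_itv a b n x : 0 <= plateau a b n x <= 1.
Proof.
rewrite /plateau; have /andP[h1 h2] := flat1_itv (n.+1%:R * x + - (n.+1%:R * a)).
have /andP[h3 h4] := flat1_itv (- n.+1%:R * x + n.+1%:R * b).
by rewrite mulr_ge0//= -[leRHS]mulr1 ler_pM.
Qed.

Lemma plateau_out a b n x : ~ (a < x < b) -> plateau a b n x = 0.
Proof.
move=> H; rewrite /plateau /flat.
have -> : n.+1%:R * x + - (n.+1%:R * a) = n.+1%:R * (x - a) by ring.
have -> : - n.+1%:R * x + n.+1%:R * b = n.+1%:R * (b - x) by ring.
rewrite !pmulr_rgt0 ?ltr0Sn// !subr_gt0.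
case: ifP => ax; last by rewrite mul0r.
case: ifP => xb; last by rewrite mulr0.
by exfalso; apply: H; rewrite ax xb.
Qed.

Lemma plateau_cvg a b x : a < x < b -> plateau a b n x @[n --> \oo] --> (1 : R).
Proof.
move=> /andP[ax xb]; rewrite -[X in _ --> X](mulr1 (1 : R)); apply: cvgM.
  under eq_fun do rewrite -mulrBr; apply: flat1_cvg; lra.
have -> : (fun n => flat 1 (- n.+1%:R * x + n.+1%:R * b)) = (fun n => flat 1 (n.+1%:R * (b - x))).
  by apply/funext => n; congr flat; ring.
apply: flat1_cvg; lra.
Qed.

Lemma plateau_supported a b n : supported (Num.max `|a| `|b|) (plateau a b n).
Proof.
move=> x; rewrite gt_max => /andP[h1 h2]; apply: plateau_out => /andP[ax xb].
case: (leP 0 x) => x0.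
  by move: h2; rewrite ltNge ger0_norm// (le_trans (ltW xb))// ler_norm.
move: h1; rewrite ltNge ltr0_norm// => /negP; apply.
by rewrite -normrN (le_trans _ (ler_norm _))// lerN2 ltW.
Qed.

Lemma plateau_integral v a b : locint v -> a < b ->
  \int[mu]_x (v x * plateau a b n x) @[n --> \oo] --> \int[mu]_(x in `[a, b]) v x.
Proof.
move=> vl ab.
have i1 : mu.-integrable `]a, b[ (EFin \o v).
  apply: (mintS _ _ _ (vl.2 a b)) => //; by apply: subset_itv; rewrite bnd_simp.
have i2 : mu.-integrable `]a, b] (EFin \o v).
  by apply: (mintS _ _ _ (vl.2 a b)) => //; by apply: subset_itv; rewrite bnd_simp.
rewrite -(@Rintegral_itv_obnd_cbnd _ a (BRight b))//.
rewrite -(@Rintegral_itv_bndo_bndc _ (BRight a) b)//.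
have -> : (fun n => \int[mu]_x (v x * plateau a b n x)) =
    (fun n => \int[mu]_(x in `]a, b[) (v x * plateau a b n x)).
  apply/funext => n; apply: Rint_supp => x; rewrite /= in_itv/= => H.
  by rewrite plateau_out ?mulr0.
apply: (@Rint_dct _ _ _ _ (fun x => `|v x|) _ _ _ _ _ _).2 => //.
- move=> n; apply: measurable_funM; first exact: locint_meas vl.
  exact: continuous_measurable_fun (bump_cont (bump_plateau a b n)).
- exact: locint_meas vl.
- move=> x; rewrite /= in_itv/= => xab.
  by rewrite -[X in _ --> X](mulr1 (v x)); apply: cvgM; [exact: cvg_cst|exact: plateau_cvg].
- move=> n x _; have /andP[p0 p1] := plateau_itv a b n x.
  by rewrite normrM (ger0_norm p0) -[leRHS]mulr1 ler_wpM2l.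
- exact: mint_norm.
Qed.

(** The zero function is then a primitive of v, and a primitive determines its density almost
    everywhere. *)
Lemma locint_zero v : locint v -> (forall a b, a < b -> \int[mu]_(x in `[a, b]) v x = 0) ->
  {ae mu, forall x, v x = 0}.
Proof.
move=> vl H; have : rprim (fun=> 0) v.
  split => // a b; rewrite le_eqVlt => /orP[/eqP->|ab]; rewrite subrr; last by rewrite H.
  by rewrite Rintegral_segment0.
move=> /rprim_ae; apply: ae_imp => x [_ <-].
by have := derive1_cst (0 : R) x.
Qed.

(** Testing against the plateaus of []a, b[] yields, in the limit, the integral of v over that
    interval. *)
Lemma bump_orthogonal v : locint v ->
  (forall f A, bump f -> supported A f -> \int[mu]_x (v x * f x) = 0) ->
  {ae mu, forall x, v x = 0}.
Proof.
move=> vl H; apply: locint_zero => // a b ab.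
have := plateau_integral vl ab.
have -> : (fun n => \int[mu]_x (v x * plateau a b n x)) = (fun=> 0).
  by apply/funext => n; apply: H; [exact: bump_plateau|exact: plateau_supported].
by move=> /(cvg_lim (@Rhausdorff R)) <-; rewrite lim_cst.
Qed.

Lemma rprim_derive f g x : rprim f g -> continuous g -> is_derive x 1 f (g x).
Proof.
move=> fg cg; pose a := x - 1.
have ax : a < x by rewrite /a; lra.
have xx : x < x + 1 by lra.
have [d1 d2] := @continuous_FTC1 R g (BLeft a) x (x + 1) xx (fg.1.2 a (x + 1)) ax (cg x).
have D : is_derive x 1 (fun y => f a + \int[mu]_(t in `[a, y]) g t) (g x).
  apply: (is_derive_eq (is_deriveD (is_derive_cst (f a) x (1 : R)) (is_derive_derive1 d1 d2))).
  by rewrite add0r.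
apply: near_eq_is_derive D.
near=> y; rewrite -(fg.2 a y) ?subrKC//; apply: ltW; near: y; exact: lt_nbhsr.
Unshelve. all: by end_near. Qed.

Lemma locint_bump v f : locint v -> bump f -> locint (fun x => v x * f x).
Proof.
move=> vl /bump_cont cf; have := locintMl cf vl.
by congr locint; apply/funext => x; rewrite mulrC.
Qed.

Lemma integrable_bump v f A : locint v -> bump f -> supported A f ->
  mu.-integrable setT (EFin \o (fun x => v x * f x)).
Proof.
move=> vl bf sf; apply: (@integrable_supp `[- A, A]) => //.
  by move=> x H; rewrite (supported_itv sf)// mulr0.
exact: (locint_bump vl bf).2.
Qed.

(** Subtracting a multiple of a fixed bump eta of nonzero mean turns any bump into one of mean zero,
    that is, into the derivative of a compactly supported function. Only the derivative g is
    required to be in [bump], because that function is obtained by integration and not by the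
    constructors of [bump]. *)
Lemma du_bois_reymond v : locint v ->
  (forall f g A, bump g -> (forall x, is_derive x 1 f (g x)) -> supported A f -> supported A g ->
     \int[mu]_x (v x * g x) = 0) ->
  exists c, {ae mu, forall x, v x = c}.
Proof.
move=> vl H.
have one : locint (fun=> 1 : R) by apply: locint_cont => x; exact: cst_continuous.
(* The integrals of the plateaus of []0, 1[] tend to 1, so one of them is nonzero. *)
have [n n0] : exists n, \int[mu]_x (1 * plateau 0 1 n x) != 0.
  apply/not_existsP => N.
  have := plateau_integral one ltr01.
  have -> : (fun n => \int[mu]_x (1 * plateau 0 1 n x)) = (fun=> 0).
    by apply/funext => n; apply/eqP; apply/negPn/negP => /N.
  have -> : \int[mu]_(x in `[(0 : R), 1]) (1 : R) = 1.
    by rewrite Rintegral_cst//= lebesgue_measure_itv/= lte_fin ltr01 oppr0 adde0 mulr1.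
  move=> /(cvg_lim (@Rhausdorff R)); rewrite lim_cst// => /esym/eqP.
  by rewrite oner_eq0.
set eta := plateau 0 1 n in n0.
have beta : bump eta by exact: bump_plateau.
have seta : supported 1 eta.
  by have := @plateau_supported 0 1 n; rewrite normr0 normr1 max_r// ler01.
set m := \int[mu]_x eta x.
have {}n0 : m != 0.
  by move: n0; have -> : (fun x => 1 * eta x) = eta by apply/funext => x; rewrite mul1r.
exists (\int[mu]_x (v x * eta x) / m); set c := _ / m.
suff : {ae mu, forall x, v x - c = 0} by apply: ae_imp => x /eqP; rewrite subr_eq0 => /eqP.
have cl : locint (fun=> c) by apply: locint_cont => x; exact: cst_continuous.
apply: bump_orthogonal; first exact: locintB.
move=> f A0 bf sf0; pose A := Num.max A0 1.
have sf : supported A f by apply: supported_le sf0; rewrite le_max lexx.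
have sA : supported A eta by apply: supported_le seta; rewrite le_max lexx orbT.
have A1 : 0 < A by rewrite lt_max ltr01 orbT.
(* This k makes the mean of g zero, so the primitive of g vanishing at - A also vanishes beyond
   A. *)
pose k := \int[mu]_x f x / m.
pose g x := f x + - k * eta x.
have bg : bump g by apply: bumpD => //; apply: bumpM => //; exact: bump_cst.
have sg : supported A g by move=> x xA; rewrite /g sf// sA// mulr0 addr0.
have gl : locint g by exact: locint_cont (bump_cont bg).
have If : mu.-integrable setT (EFin \o f).
  by have := integrable_bump one bf sf; under eq_fun do rewrite mul1r.
have Ie : mu.-integrable setT (EFin \o eta).
  by have := integrable_bump one beta sA; under eq_fun do rewrite mul1r.
have g0 : \int[mu]_(x in `[- A, A]) g x = 0.
  rewrite -Rint_supp; last by move=> x; exact: supported_itv sg.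
  rewrite RintegralD//; last exact: mintZ.
  by rewrite RintegralZl// -/m /k mulNr divfK// subrr.
pose F x := prim g x - prim g (- A).
have Fg : rprim F g.
  by have := rprimB (rprim_prim gl) (rprim_cst (prim g (- A))); under [X in rprim _ X]eq_fun do rewrite subr0.
have sF : supported A F.
  move=> x xA; case: (leP 0 x) => x0.
    move: xA; rewrite ger0_norm// => xA.
    have xA' : - A <= x by lra.
    rewrite /F (rprim_prim gl).2// (Rintegral_split (b := A)) ?(ltW xA)//; last 2 first.
    - lra.
    - exact: gl.2.
    rewrite g0 add0r; apply: (etrans _ (Rintegral0 `[A, x])).
    rewrite -[LHS](@Rintegral_itv_obnd_cbnd _ A (BRight x)); last first.
      by apply: mintS (gl.2 A x) => //; apply: subset_itv; rewrite bnd_simp.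
    rewrite -[RHS](@Rintegral_itv_obnd_cbnd _ A (BRight x)); last exact: mint0.
    apply: eq_Rintegral => y; rewrite inE/= in_itv/= => /andP[Ay _]; apply: sg.
    by rewrite (lt_le_trans Ay)// ler_norm.
  move: xA; rewrite ltr0_norm// => xA.
  have xA' : x <= - A by lra.
  apply/eqP; rewrite /F -oppr_eq0 opprB (rprim_prim gl).2//.
  apply/eqP; apply: (etrans _ (Rintegral0 `[x, - A])).
  rewrite -[LHS](@Rintegral_itv_bndo_bndc _ (BLeft x) (- A)); last first.
    by apply: mintS (gl.2 x (- A)) => //; apply: subset_itv; rewrite bnd_simp.
  rewrite -[RHS](@Rintegral_itv_bndo_bndc _ (BLeft x) (- A)); last exact: mint0.
  apply: eq_Rintegral => y; rewrite inE/= in_itv/= => /andP[_ Ay]; apply: sg.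
  by rewrite -normrN (lt_le_trans _ (ler_norm _))// ltrNr.
have := H F g A bg (fun x => rprim_derive x Fg (bump_cont bg)) sF sg.
have Ivf := integrable_bump vl bf sf; have Ive := integrable_bump vl beta sA.
have -> : (fun x => v x * g x) = (fun x => v x * f x + - k * (v x * eta x)).
  by apply/funext => x; rewrite /g; ring.
rewrite RintegralD//; last exact: mintZ.
rewrite RintegralZl//.
have -> : (fun x => (v x - c) * f x) = (fun x => v x * f x + - c * f x).
  by apply/funext => x; ring.
rewrite RintegralD//; last exact: mintZ.
rewrite RintegralZl// => <-; rewrite /k /c; field.
exact: n0.
Qed.

End DuBoisReymond.

(** * Weak derivatives and representatives of H^1 functions *)

Section WeakDerivatives.
Context {R : realType}.
Local Notation mu := (@lebesgue_measure R).
Implicit Types (u v f g h phi : R -> R[i]) (a b x A : R) (D : set R).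

Lemma cintegralE f : cintegral f = cint setT f. Proof. by []. Qed.

Lemma cint_supp D f : (forall x, ~ D x -> f x = 0) -> cint setT f = cint D f.
Proof.
by move=> H; apply: complex_eq; rewrite ?cRe_cint ?cIm_cint; apply: Rint_supp => x /H ->.
Qed.

Lemma cintable_supp D f : measurable D -> (forall x, ~ D x -> f x = 0) ->
  cintable D f -> cintable setT f.
Proof. by move=> mD H [i1 i2]; split; (apply: integrable_supp; [exact: mD| |eassumption]) => x /H ->. Qed.

Lemma L2_locint_csq f : L2 f -> locint (fun x => csq (f x)).
Proof.
move=> /L2P[mf fi]; split; first exact: meas_csq.
by move=> a b; apply: mintS fi.
Qed.

Lemma L2_clocint f : L2 f -> clocint f.
Proof.
move=> fl; apply: (@clocint_le _ _ (fun x => 1 + csq (f x))); first exact: L2_meas.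
  apply: locintD; last exact: L2_locint_csq.
  by apply: locint_cont => x; exact: cst_continuous.
move=> x; rewrite -sqr_normc; have := sqr_ge0 (normc (f x) - 1).
by have := normc_ge0 (f x); nra.
Qed.

Lemma test_function_bump (f : R -> R) A : rsmooth f -> supported A f ->
  test_function (fun x => (f x)%:C).
Proof.
move=> sf Af; split.
  move=> n x; split => /=; first exact: sf.
  exact: rsmooth_bump (bump_cst 0) _ _.
apply: (subclosed_compact _ (@segment_compact _ (- A) A)); first exact: closed_closure.
rewrite [X in _ `<=` X](closure_id _).1; last exact: itv_closed.
apply: closureS => x /=; apply: contraTT => xA; rewrite negbK.
by rewrite (supported_itv Af) //; apply/negP.
Qed.

Lemma derivable_continuous (f : R -> R) : (forall x, derivable f x 1) -> continuous f.
Proof. by move=> H x; apply: differentiable_continuous; apply/derivable1_diffP. Qed.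

Lemma test_function_facts phi : test_function phi ->
  cprim phi (cderive phi) /\ ccont (cderive phi) /\
  exists2 A, 0 <= A & forall x, ~ `[- A, A]%classic x -> phi x = 0 /\ cderive phi x = 0.
Proof.
move=> [sm cpt].
have D1 x : is_derive x 1 (fun t => Re (phi t)) (derive1 (fun t => Re (phi t)) x).
  exact: is_derive_derive1 (sm 0%N x).1 erefl.
have D2 x : is_derive x 1 (fun t => Im (phi t)) (derive1 (fun t => Im (phi t)) x).
  exact: is_derive_derive1 (sm 0%N x).2 erefl.
have C1 : continuous (derive1 (fun t => Re (phi t))).
  exact: derivable_continuous (fun x => (sm 1%N x).1).
have C2 : continuous (derive1 (fun t => Im (phi t))).
  exact: derivable_continuous (fun x => (sm 1%N x).2).
split; first by split; exact: rprim_C1.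
split; first by split.
have /compact_bounded[M [_ HM]] := cpt.
exists (`|M| + 1); first by rewrite addr_ge0.
have M1 : M < `|M| + 1 by rewrite (le_lt_trans (ler_norm _))// ltrDl.
have z x : `|M| + 1 < `|x| -> phi x = 0.
  move=> xM; apply/eqP/negPn/negP => p0.
  have := HM _ M1 x (@subset_closure _ [set y | phi y != 0] x p0) => /=.
  by rewrite leNgt xM.
move=> x /= /negP; rewrite in_itv/= => xA.
have {}xA : `|M| + 1 < `|x| by rewrite ltNge ler_norml.
split; first exact: z.
have nz : \near x, phi x = 0.
  near=> y; apply: z; near: y.
  exact: (cvgr_gt _ (@norm_continuous _ R x)) xA.
have E (P : R[i] -> R) : P 0 = 0 -> derive1 (fun t => P (phi t)) x = 0.
  move=> P0; apply: derive1_is_derive.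
  apply: near_eq_is_derive (is_derive_cst (0 : R) x (1 : R)).
  by near=> y; rewrite (near nz y)// P0.
by apply: complex_eq => /=; apply: E.
Unshelve. all: by end_near. Qed.

Lemma weak_derivative_cprim u g : cprim u g -> weak_derivative u g.
Proof.
move=> ug phi tp; have [pp [pc [A A0 HA]]] := test_function_facts tp.
have cu := cprim_cont ug; have gl := cprim_locint ug.
have pl := cprim_cont pp.
(* The test function is known to vanish only outside the closed interval, hence the endpoints are
   taken at distance A + 1. *)
have B : ~ `[- A, A]%classic (A + 1) by rewrite /= in_itv/= => /andP[_]; rewrite leNgt ltrDl ltr01.
have B' : ~ `[- A, A]%classic (- (A + 1)) by rewrite /= in_itv/= lerN2 => /andP[]; rewrite leNgt ltrDl ltr01.
have AB : - (A + 1) <= A + 1 by lra.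
have sub : forall x, ~ `[- (A + 1), A + 1]%classic x -> ~ `[- A, A]%classic x.
  by move=> x H K; apply: H; move: K; rewrite /= !in_itv/= => /andP[h1 h2]; apply/andP; split; lra.
have := cprimB_int (cprimM ug pp) AB.
rewrite (HA _ B).1 (HA _ B').1 !mulr0 subr0 => /esym.
have l1 : clocint (fun x => g x * phi x).
  by have := clocintMl pl gl; under eq_fun do rewrite mulrC.
have l2 : clocint (fun x => u x * cderive phi x).
  by apply: clocintMl => //; exact: clocint_cont.
rewrite cintD//; [|exact: clocint_itv..].
rewrite !cintegralE (@cint_supp `[- (A + 1), A + 1]); last first.
  by move=> x /sub/HA[_ ->]; rewrite mulr0.
rewrite (@cint_supp `[- (A + 1), A + 1] (fun x => g x * phi x)); last first.
  by move=> x /sub/HA[-> _]; rewrite mulr0.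
by move=> /eqP; rewrite addrC addr_eq0 => /eqP.
Qed.

Lemma cderive_real (f g : R -> R) : (forall x, is_derive x 1 f (g x)) ->
  cderive (fun x => (f x)%:C) = (fun x => (g x)%:C).
Proof.
move=> H; apply/funext => x; apply: complex_eq => /=; first exact: derive1_is_derive.
by have := derive1_cst (0 : R) x.
Qed.

Lemma cintable_test u phi : clocint u -> ccont phi ->
  (exists2 A, 0 <= A & forall x, ~ `[- A, A]%classic x -> phi x = 0) ->
  cintable setT (fun x => u x * phi x).
Proof.
move=> ul cp [A _ H]; apply: (@cintable_supp `[- A, A]) => //; first by move=> x /H->; rewrite mulr0.
apply: clocint_itv; have := clocintMl cp ul; by under eq_fun do rewrite mulrC.
Qed.

Lemma bump_test (f : R -> R) A : bump f -> supported A f -> 0 <= A ->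
  test_function (fun x => (f x)%:C) /\ ccont (fun x => (f x)%:C) /\
  exists2 B, 0 <= B & forall x, ~ `[- B, B]%classic x -> (f x)%:C = 0.
Proof.
move=> bf sf A0; split; first exact: test_function_bump (rsmooth_bump bf) sf.
split; first by split => /=; [exact: bump_cont|move=> x; exact: cst_continuous].
by exists A => // x /(supported_itv sf) ->.
Qed.

Lemma weak_derivative_unique u g h : weak_derivative u g -> weak_derivative u h ->
  clocint g -> clocint h -> aeeq g h.
Proof.
move=> ug uh gl hl; have l := clocintB gl hl.
have E (f : R -> R) A : bump f -> supported A f -> cint setT (fun x => (g x - h x) * (f x)%:C) = 0.
  move=> bf sf; pose B := Num.max A 0.
  have sB : supported B f by apply: supported_le sf; rewrite le_max lexx.
  have B0 : 0 <= B by rewrite le_max lexx orbT.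
  have [tf [cf Bf]] := bump_test bf sB B0.
  have := ug _ tf; rewrite uh// => /oppr_inj/esym e.
  under eq_fun do rewrite mulrBl.
  rewrite cintB//; [|exact: cintable_test..].
  by apply/eqP; rewrite subr_eq0; apply/eqP; exact: e.
have z1 : {ae mu, forall x, Re (g x - h x) = 0}.
  apply: bump_orthogonal; first exact: l.1.
  move=> f A bf sf; have := congr1 (@complex.Re R) (E f A bf sf); rewrite cRe_cint cRe0 => <-.
  by apply: eq_Rintegral => x _; rewrite cReM cImC cReC mulr0 subr0.
have z2 : {ae mu, forall x, Im (g x - h x) = 0}.
  apply: bump_orthogonal; first exact: l.2.
  move=> f A bf sf; have := congr1 (@complex.Im R) (E f A bf sf); rewrite cIm_cint cIm0 => <-.
  by apply: eq_Rintegral => x _; rewrite cImM cImC cReC mulr0 add0r.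
apply: ae_imp2 z1 z2 => x e1 e2; apply/eqP; rewrite -subr_eq0; apply/eqP.
by apply: complex_eq; rewrite ?e1 ?e2.
Qed.

(** Minus a primitive of g, the function u has weak derivative 0, so it is constant almost
    everywhere by [du_bois_reymond]. *)
Lemma weak_derivative_primitive u g : clocint u -> clocint g -> weak_derivative u g ->
  exists2 v, cprim v g & aeeq u v.
Proof.
move=> ul gl ug; have pg := cprim_cprimitive gl; have wg := weak_derivative_cprim pg.
set G := cprimitive g in pg wg.
have Gl := clocint_cont (cprim_cont pg).
have l := clocintB ul Gl.
have E (f h : R -> R) A : bump h -> (forall x, is_derive x 1 f (h x)) -> supported A f ->
    supported A h -> cint setT (fun x => (u x - G x) * (h x)%:C) = 0.
  move=> bh fh sf sh; pose B := Num.max A 0.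
  have B0 : 0 <= B by rewrite le_max lexx orbT.
  have sB : supported B f by apply: supported_le sf; rewrite le_max lexx.
  have shB : supported B h by apply: supported_le sh; rewrite le_max lexx.
  (* The primitive f is not itself given as a [bump]; its smoothness is inherited from its
     derivative h. *)
  have sm : rsmooth f.
    apply: rsmooth_derive1; first by move=> x; have [] := fh x.
    have -> : derive1 f = h by apply/funext => x; exact: derive1_is_derive.
    exact: rsmooth_bump.
  have tf := test_function_bump sm sB.
  have [_ [ch Bh]] := bump_test bh shB B0.
  have := ug _ tf; rewrite -(wg _ tf) (cderive_real fh) => e.
  under eq_fun do rewrite mulrBl.
  rewrite cintB//; [|exact: cintable_test..].
  by apply/eqP; rewrite subr_eq0; apply/eqP; exact: e.
have [c1 z1] : exists c, {ae mu, forall x, Re (u x - G x) = c}.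
  apply: du_bois_reymond; first exact: l.1.
  move=> f h A bh fh sf sh; have := congr1 (@complex.Re R) (E f h A bh fh sf sh); rewrite cRe_cint cRe0 => <-.
  by apply: eq_Rintegral => x _; rewrite cReM cImC cReC mulr0 subr0.
have [c2 z2] : exists c, {ae mu, forall x, Im (u x - G x) = c}.
  apply: du_bois_reymond; first exact: l.2.
  move=> f h A bh fh sf sh; have := congr1 (@complex.Im R) (E f h A bh fh sf sh); rewrite cIm_cint cIm0 => <-.
  by apply: eq_Rintegral => x _; rewrite cImM cImC cReC mulr0 add0r.
exists (fun x => G x + (c1 +i* c2)).
  by have := cprimD pg (cprim_cst (c1 +i* c2)); under [X in cprim _ X]eq_fun do rewrite addr0.
apply: ae_imp2 z1 z2 => x e1 e2; rewrite -[u x](subrKC (G x)); congr (_ + _).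
by apply: complex_eq; rewrite ?e1 ?e2.
Qed.

Lemma wderivP u : H1 u -> L2 (wderiv u) /\ weak_derivative u (wderiv u).
Proof.
move=> [_ [g gl ug]].
exact: (@xgetPex _ (fun=> 0) [set h | L2 h /\ weak_derivative u h] (ex_intro _ g (conj gl ug))).
Qed.

Lemma H1_representative u : H1 u ->
  exists v, [/\ cprim v (wderiv u), aeeq u v & L2 v].
Proof.
move=> Hu; have [ul _] := Hu; have [wl wd] := wderivP Hu.
have [v vw uv] := weak_derivative_primitive (L2_clocint ul) (L2_clocint wl) wd.
exists v; split => //; exact: L2_aeeq (cprim_meas vw) uv ul.
Qed.

Lemma weak_derivative_aeeq u v g : cmeasurable u -> cmeasurable v -> aeeq u v ->
  weak_derivative u g -> weak_derivative v g.
Proof.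
move=> um vm uv ug phi tp; rewrite -(ug _ tp) !cintegralE.
have [_ [[c1 c2] _]] := test_function_facts tp.
have mp : cmeasurable (cderive phi) by exact: ccont_meas.
apply: cint_aeeq => //; [exact: cmeasM..|].
by apply: ae_imp uv => x -> .
Qed.

End WeakDerivatives.

(** * Exhaustion of the line and cutoff functions *)

Section Cutoff.
Context {R : realType}.
Local Notation mu := (@lebesgue_measure R).
Implicit Types (f g G : R -> R) (a b c x B : R).

Lemma locint_exhaustion G B : locint G -> (forall x, 0 <= G x) ->
  (forall n : nat, \int[mu]_(x in `[- n%:R, n%:R]) G x <= B) ->
  mu.-integrable setT (EFin \o G) /\ \int[mu]_x G x <= B.
Proof.
move=> [mG iG] G0 H.
have E : \bigcup_(n in [set: nat]) `[- n%:R, n%:R]%classic = [set: R].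
  apply/seteqP; split=> // x _; exists (Num.truncn `|x|).+1 => //=.
  by rewrite in_itv/= -ler_norml ltW// truncnS_gt.
pose I (n : nat) : set R := `[- n%:R, n%:R]%classic.
have cv : (\int[mu]_(x in I n) (G x)%:E)%E @[n --> \oo] --> (\int[mu]_x (G x)%:E)%E.
  rewrite -E; refine (@ge0_nondecreasing_set_cvg_integral _ (measurableTypeR R) R I (EFin \o G) mu _ _ _ _).
  - move=> n m nm; apply/subsetPset; apply: subset_itv; rewrite bnd_simp ?lerN2 ler_nat//.
  - by move=> i; exact: measurable_itv.
  - by move=> i; apply/measurable_EFinP; apply: measurable_funTS.
  - by move=> i x _; rewrite /= lee_fin.
have le : (\int[mu]_x (G x)%:E <= B%:E)%E.
  rewrite -(cvg_lim _ cv)//; apply: lime_le; first by apply/cvg_ex; eexists; exact: cv.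
  apply: nearW => n; have := H n; rewrite /Rintegral -lee_fin fineK//.
  by apply: integrable_fin_num => //; exact: iG.
have ge : (0 <= \int[mu]_x (G x)%:E)%E by apply: integral_ge0 => x _; rewrite lee_fin.
have fin : (\int[mu]_x (G x)%:E)%E \is a fin_num.
  by rewrite ge0_fin_numE// (le_lt_trans le)// ltry.
split; last by rewrite /Rintegral -lee_fin fineK.
apply/integrableP; split; first exact/measurable_EFinP.
under eq_integral do rewrite /= ger0_norm//.
by rewrite (le_lt_trans le)// ltry.
Qed.

Lemma derive_out f g A x : (forall x, is_derive x 1 f (g x)) -> supported A f ->
  A < `|x| -> g x = 0.
Proof.
move=> fg sf xA; rewrite -(derive1_is_derive (fg x)); apply: derive1_is_derive.
apply: near_eq_is_derive (is_derive_cst (0 : R) x (1 : R)).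
near=> y; rewrite sf//; near: y.
exact: (cvgr_gt _ (@norm_continuous _ R x)) xA.
Unshelve. all: by end_near. Qed.

(** The factor [expR 2] makes rho 0 = 1, as [flat 1 1] is e^-1. The profile has no flat top:
    convergence of its rescalings to 1 and the lower bound [rho_ge] take its place. *)
Definition rho x := expR 2 * (flat 1 (1 * x + 1) * flat 1 (-1 * x + 1)).

Lemma bump_rho : bump rho.
Proof. by apply: bumpM; [exact: bump_cst|apply: bumpM; exact: bump_flat]. Qed.

Lemma rho_supported : supported 1 rho.
Proof.
move=> x; rewrite /rho /flat mul1r mulN1r; case: ifP => h1; last by rewrite mul0r mulr0.
case: ifP => h2; last by rewrite !mulr0.
move=> h; exfalso; move: h; rewrite ltNge ler_norml; move/negP; apply.
by apply/andP; split; lra.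
Qed.

Lemma rho0 : rho 0 = 1.
Proof.
have f1 : flat 1 1 = expR (-1) :> R by rewrite /flat ltr01 invr1 hornerE mul1r.
rewrite /rho !mulr0 !add0r f1 -!expRD.
by rewrite (_ : 2 + (-1 + -1) = 0) ?expR0//; ring.
Qed.

Lemma rho_ge x : `|x| <= 2^-1 -> expR (- 2) <= rho x.
Proof.
rewrite ler_norml => /andP[x1 x2]; rewrite /rho mul1r mulN1r.
have fl y : 2^-1 <= y -> expR (- 2) <= flat 1 y.
  move=> y2; have y0 : 0 < y by lra.
  by rewrite /flat y0 hornerE mul1r ler_expR lerN2 -[leRHS]invrK lef_pV2// posrE invr_gt0.
have -> : expR (- 2) = expR 2 * (expR (- 2) * expR (- 2)) :> R.
  by rewrite -!expRD; congr expR; ring.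
rewrite ler_wpM2l ?expR_ge0// ler_pM ?expR_ge0// fl//; lra.
Qed.

(** The rescalings rho (x / (n + 1)). Every derivative gains a factor 1 / (n + 1), so the commutator
    terms disappear in the limit; the lower bound d on the inner half recovers u' from truncations
    of u. *)
Lemma cutoff_sequence : exists (chi dchi ddchi : nat -> R -> R) (c d : R),
  [/\ 0 <= c, 0 < d,
      forall n, [/\ rprim (chi n) (dchi n), rprim (dchi n) (ddchi n), continuous (chi n),
         continuous (dchi n) & continuous (ddchi n)],
      forall n x, [/\ `|chi n x| <= c, `|dchi n x| <= c / n.+1%:R & `|ddchi n x| <= c / n.+1%:R] &
   [/\ forall n x, n.+1%:R <= `|x| -> chi n x = 0,
      forall n x, n.+1%:R < `|x| -> dchi n x = 0 /\ ddchi n x = 0,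
      forall n x, `|x| <= n.+1%:R / 2 -> d <= chi n x &
      forall x, chi n x @[n --> \oo] --> (1 : R)]].
Proof.
have [rho1 b1 D1] := bump_derive bump_rho; have [rho2 b2 D2] := bump_derive b1.
have [c0 c00 H0] := bump_bounded bump_rho.
have [c1 c10 H1] := bump_bounded b1; have [c2 c20 H2] := bump_bounded b2.
pose e (n : nat) : R := n.+1%:R^-1.
have e0 n : 0 < e n by rewrite invr_gt0.
have e1 n : e n <= 1 by rewrite invf_le1// ler1n.
have sc (f g : R -> R) n : (forall x, is_derive x 1 f (g x)) ->
    forall x, is_derive x 1 (fun y => f (e n * y + 0)) (e n * g (e n * x + 0)).
  move=> fg x; rewrite mulrC.
  exact: (@is_derive1_comp _ f (fun y => e n * y + 0) x _ _ (fg _) (is_derive_affine (e n) 0 x)).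
have scc (f : R -> R) n : bump f -> continuous (fun y => f (e n * y + 0)).
  move=> bf x; have [g _ fg] := bump_derive bf.
  have [d _] := sc f g n fg x.
  exact: (differentiable_continuous (proj1 (derivable1_diffP _ _) d)).
have nx n x : `|e n * x + 0| = `|x| / n.+1%:R.
  by rewrite addr0 normrM (ger0_norm (ltW (e0 n))) mulrC.
have sup1 := derive_out D1 rho_supported.
have sup2 := derive_out D2 sup1.
exists (fun n x => rho (e n * x + 0)), (fun n x => e n * rho1 (e n * x + 0)),
  (fun n x => e n * (e n * rho2 (e n * x + 0))), (c0 + c1 + c2), (expR (- 2)).
split.
- by rewrite !addr_ge0.
- exact: expR_gt0.
- move=> n.
  have k1 : continuous (fun x => e n * rho1 (e n * x + 0)).
    by move=> x; apply: cvgM; [exact: cvg_cst|exact: scc].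
  have k2 : continuous (fun x => e n * (e n * rho2 (e n * x + 0))).
    by move=> x; apply: cvgM; [exact: cvg_cst|apply: cvgM; [exact: cvg_cst|exact: scc]].
  split => //.
  + by apply: rprim_C1 => // x; exact: sc.
  + apply: (@rprimZ _ (e n) (fun x => rho1 (e n * x + 0)) (fun x => e n * rho2 (e n * x + 0))).
    apply: (rprim_C1 (u := fun x => rho1 (e n * x + 0)) (fun x => sc _ _ n D2 x)).
    by move=> x; apply: cvgM; [exact: cvg_cst|exact: scc].
  + by apply: scc; exact: bump_rho.
- move=> n x; split.
  + by rewrite (le_trans (H0 _))// -addrA lerDl addr_ge0.
  + rewrite normrM (ger0_norm (ltW (e0 n))) mulrC ler_wpM2r//; first exact: ltW.
    by rewrite (le_trans (H1 _))// -addrA addrCA lerDl addr_ge0.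
  + rewrite !normrM !(ger0_norm (ltW (e0 n))) mulrC ler_wpM2r//; first exact: ltW.
    apply: (@le_trans _ _ `|rho2 (e n * x + 0)|); first by rewrite ler_piMl.
    by rewrite (le_trans (H2 _))// lerDr addr_ge0.
split.
(* The endpoints |x| = n + 1, where boundary terms are evaluated, are not covered by [rho_supported]
   and are computed directly. *)
- move=> n x nx1; have [h|h] := eqVneq `|x| n.+1%:R.
    have : `|e n * x + 0| = 1 by rewrite nx h divff.
    rewrite /rho /flat mul1r mulN1r => /eqP; rewrite eqr_norml => /andP[/orP[/eqP->|/eqP->] _].
      by rewrite addNr ltxx !mulr0.
    by rewrite addNr ltxx mul0r mulr0.
  by apply: rho_supported; rewrite nx ltr_pdivlMr// mul1r lt_def h.
- move=> n x nx1; have h : 1 < `|e n * x + 0| by rewrite nx ltr_pdivlMr// mul1r.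
  by rewrite sup1// sup2// !mulr0.
- move=> n x nx1; apply: rho_ge; rewrite nx ler_pdivrMr//.
  by rewrite mulrC.
- move=> x; have H : (e n * x + 0) @[n --> \oo] --> (0 * x + 0).
    by apply: cvgD; [apply: cvgM; [exact: cvg_harmonic|exact: cvg_cst]|exact: cvg_cst].
  rewrite mul0r addr0 in H; rewrite -[X in _ --> X]rho0.
  by apply: continuous_cvg => //; exact: bump_cont bump_rho 0.
Qed.

End Cutoff.

(** * Schroedinger operators *)

Section Schroedinger.
Context {R : realType}.
Local Notation mu := (@lebesgue_measure R).
Implicit Types (f g h u v w k y F : R -> R[i]) (a b x : R).
Variables (Q tau : R -> R[i]) (M : R).
Hypotheses (mQ : cmeasurable Q) (Ql : locint (fun x => csq (Q x))) (tl : clocint tau).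
Hypotheses (Vl : locint (potential Q tau)) (M0 : 0 <= M).
Hypothesis VM : forall s, \int[mu]_(x in `[s, s + 1]) potential Q tau x <= M.
Local Notation C := (stepanov_cst M).
Local Notation pot := (potential Q tau).
Local Notation eform := (form_integrand Q tau).

Lemma stepanov_cst_ge0 : 0 <= C.
Proof. by rewrite /stepanov_cst mulr_ge0// addr_ge0// mulr_ge0// addr_ge0. Qed.

(* g = u', w = u' - Q u is the quasi-derivative, k = w' and F = l[u]. *)
Definition quasi u g w k F := [/\ cprim u g, cprim w k,
  aeeq w (fun x => g x - Q x * u x) & aeeq k (fun x => - F x - Q x * g x + tau x * u x)].

Lemma SmaxP y f : Smax Q tau (y, f) <->
  [/\ L2 y, L2 f & exists u g w k, aeeq y u /\ quasi u g w k f].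
Proof.
split=> [[yl [fl [u [w [ua wa yu wE fE]]]]]|[yl fl [u [g [w [k [yu [ug wk wE kE]]]]]]]].
  split => //; have [g ug] := AC_cprim ua; have [k wk] := AC_cprim wa.
  exists u, g, w, k; split => //; split => //.
    by apply: ae_imp2 wE (cprim_cderive ug) => x -> ->.
  have H : aeeq f (fun x => - cderive w x - Q x * g x + tau x * u x).
    by apply: ae_imp2 fE (cprim_cderive ug) => x /= -> ->.
  apply: ae_imp2 H (cprim_cderive wk) => x -> ->; ring.
split=> //; split => //=; exists u, w; split => //.
- exact: cprim_AC ug.
- exact: cprim_AC wk.
- by apply: ae_imp2 wE (cprim_cderive ug) => x -> ->.
- have H : aeeq k (fun x => - f x - Q x * cderive u x + tau x * u x).
    by apply: ae_imp2 kE (cprim_cderive ug) => x -> ->.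
  apply: ae_imp2 H (cprim_cderive wk) => x /= e ->; rewrite e; ring.
Qed.

(** u' = w + Q u with u and w continuous, so u' inherits local square integrability from Q. *)
Lemma quasi_locint_csq u g w : cprim u g -> ccont w -> aeeq w (fun x => g x - Q x * u x) ->
  locint (fun x => csq (g x)).
Proof.
move=> ug cw wE; have mg := clocint_meas (cprim_locint ug).
have mw := ccont_meas cw; have mu_ := cprim_meas ug.
apply: (@ae_locint_csq _ (fun x => w x + Q x * u x)) => //.
  by apply: ae_imp wE => x ->; rewrite subrK.
apply: (@locint_le _ _ (fun x => 2 * csq (w x) + 2 * (csq (Q x) * csq (u x)))).
- by apply: meas_csq; apply: cmeasD => //; exact: cmeasM.
- apply: locintD; apply: locintZ; first exact: locint_cont_csq.
  by apply: locintM_csq => //; exact: cprim_cont ug.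
- by move=> x; rewrite ger0_norm ?csq_ge0// -csqM; exact: csqD_le.
Qed.

Lemma itv_double (n : nat) : - n%:R + (n + n)%N%:R = n%:R :> R.
Proof. by rewrite natrD; ring. Qed.

Lemma potential_sym u g (n : nat) : cprim u g -> locint (fun x => csq (g x)) ->
  \int[mu]_(x in `[- n%:R, n%:R]) (pot x * csq (u x)) <=
    4^-1 * \int[mu]_(x in `[- n%:R, n%:R]) csq (g x)
    + C * \int[mu]_(x in `[- n%:R, n%:R]) csq (u x).
Proof.
move=> ug gl; have := potential_segment (- n%:R) (n + n) Vl (pot_ge0 Q tau) M0 VM ug gl.
by rewrite itv_double.
Qed.

Lemma potential_line u g : cprim u g -> L2 u -> L2 g ->
  mu.-integrable setT (EFin \o (fun x => pot x * csq (u x))) /\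
  \int[mu]_x (pot x * csq (u x)) <= 4^-1 * nrm2 g + C * nrm2 u.
Proof.
move=> ug ul gl; apply: locint_exhaustion.
- by apply: locintM_csq => //; exact: cprim_cont ug.
- by move=> x; rewrite mulr_ge0 ?pot_ge0 ?csq_ge0.
- move=> n; apply: le_trans (potential_sym n ug (L2_locint_csq gl)) _.
  apply: lerD; apply: ler_wpM2l; rewrite ?stepanov_cst_ge0 ?invr_ge0//.
    by apply: Rint_subset => //; [exact: L2_int|move=> x _; exact: csq_ge0].
  by apply: Rint_subset => //; [exact: L2_int|move=> x _; exact: csq_ge0].
Qed.

Let mtau : cmeasurable tau := clocint_meas tl.

Lemma energy_segment u g w k F (n : nat) : quasi u g w k F -> clocint F ->
  u (- n%:R) = 0 -> u n%:R = 0 ->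
  let E := cint `[- n%:R, n%:R] (fun x => F x * (u x)^*) in
  let N := \int[mu]_(x in `[- n%:R, n%:R]) csq (g x) in
  let U := \int[mu]_(x in `[- n%:R, n%:R]) csq (u x) in
  2^-1 * N - C * U <= Re E /\ `|Im E| <= 2^-1 * N + C * U.
Proof.
move=> [ug wk wE kE] Fl ua ub E N U.
have gl := quasi_locint_csq ug (cprim_cont wk) wE.
have nn : - n%:R <= n%:R :> R by rewrite ge0_cp ?ler0n.
have mg := clocint_meas (cprim_locint ug); have mu_ := cprim_meas ug.
have := boundary_identity mQ Ql tl ug wk Fl ug gl wE kE nn.
rewrite ua ub rmorph0 !mulr0 subrr => /esym/eqP; rewrite subr_eq0 => /eqP e.
rewrite /E -e.
have mE := cmeas_eform mQ mtau mu_ mg mu_ mg.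
have mD : measurable `[- n%:R, n%:R : R]%classic by exact: measurable_itv.
have ig := locint_mint (- n%:R) n%:R gl.
have iV := locint_mint (- n%:R) n%:R (locintM_csq Vl (cprim_cont ug)).
have VC := potential_sym n ug gl.
split; first exact: (Re_eform mD mE mg ig iV VC).
exact: (Im_eform mD mE mg ig iV VC).
Qed.

Lemma cprim_realM (p q : R -> R) u g : rprim p q -> cprim u g ->
  cprim (fun x => (p x)%:C * u x) (fun x => (q x)%:C * u x + (p x)%:C * g x).
Proof. by move=> pq ug; exact: cprimM (cprimC pq) ug. Qed.

Lemma ccontC (p : R -> R) : continuous p -> ccont (fun x => (p x)%:C).
Proof. by move=> cp; split => //= x; exact: cst_continuous. Qed.

(* Leibniz: l[p u] = p l[u] - 2 p' u' - p'' u. *)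
Lemma quasi_cutoff (p p1 p2 : R -> R) u g w k F : rprim p p1 -> rprim p1 p2 ->
  continuous p -> continuous p1 -> quasi u g w k F -> clocint F ->
  quasi (fun x => (p x)%:C * u x) (fun x => (p1 x)%:C * u x + (p x)%:C * g x)
    (fun x => (p1 x)%:C * u x + (p x)%:C * w x)
    (fun x => (p2 x)%:C * u x + (p1 x)%:C * g x + ((p1 x)%:C * w x + (p x)%:C * k x))
    (fun x => (p x)%:C * F x - 2 * (p1 x)%:C * g x - (p2 x)%:C * u x).
Proof.
move=> pp1 p1p2 cp cp1 [ug wk wE kE] Fl; split.
- exact: cprim_realM.
- by apply: cprimD; exact: cprim_realM.
- apply: ae_imp wE => x ->; ring.
- apply: ae_imp2 wE kE => x -> ->; ring.
Qed.

Lemma clocint_cutoff (p p1 p2 : R -> R) u g F : continuous p -> continuous p1 -> continuous p2 ->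
  ccont u -> clocint g -> clocint F ->
  clocint (fun x => (p x)%:C * F x - 2 * (p1 x)%:C * g x - (p2 x)%:C * u x).
Proof.
move=> cp cp1 cp2 cu gl Fl; apply: clocintB; last first.
  by apply: clocintMl; [exact: ccontC|exact: clocint_cont].
apply: clocintB; first by apply: clocintMl => //; exact: ccontC.
have := clocintZ 2 (clocintMl (ccontC cp1) gl); by under eq_fun do rewrite mulrA.
Qed.

(** The delicate term is p1 zg, since nothing is known yet about u'. It comes multiplied by p, and p
    zg = v' - p1 z, where v' = p1 z + p zg is the derivative of the truncated function; a quarter of
    |v'|^2 absorbs the product, and the rest involves z and zf only. *)
Lemma cutoff_pointwise (p p1 p2 c : R) (z zg zf : R[i]) :
  `|p| <= c -> `|p1| <= c -> `|p2| <= c ->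
  Re ((p%:C * zf - 2 * p1%:C * zg - p2%:C * z) * (p%:C * z)^*) <=
  4^-1 * csq (p1%:C * z + p%:C * zg) + c ^+ 2 * csq zf + 9 * c ^+ 2 * csq z.
Proof.
move=> hp hp1 hp2; have c0 : 0 <= c := le_trans (normr_ge0 _) hp.
have sq (q : R) : `|q| <= c -> q ^+ 2 <= c ^+ 2.
  by move=> h; rewrite -real_normK ?num_real//; apply: lerXn2r; rewrite ?nnegrE.
have {}hp := sq _ hp; have {}hp1 := sq _ hp1; have {}hp2 := sq _ hp2.
case: z => z1 z2; case: zg => g1 g2; case: zf => f1 f2.
rewrite !(cReM, cImM, cReD, cImD, cReN, cImN, cReJ, cImJ) /csq !(cReM, cImM, cReD, cImD) /=.
have P := sqr_ge0 p; have P1 := sqr_ge0 p1; have P2 := sqr_ge0 p2.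
set D := c ^+ 2 in hp hp1 hp2 *.
have a1 : p1 ^+ 2 * (z1 ^+ 2 + z2 ^+ 2) <= D * (z1 ^+ 2 + z2 ^+ 2).
  by rewrite ler_wpM2r// addr_ge0 ?sqr_ge0.
have a2 : p2 ^+ 2 * (z1 ^+ 2 + z2 ^+ 2) <= D * (z1 ^+ 2 + z2 ^+ 2).
  by rewrite ler_wpM2r// addr_ge0 ?sqr_ge0.
have a3 : p ^+ 2 * (z1 ^+ 2 + z2 ^+ 2) <= D * (z1 ^+ 2 + z2 ^+ 2).
  by rewrite ler_wpM2r// addr_ge0 ?sqr_ge0.
have a4 : p ^+ 2 * (f1 ^+ 2 + f2 ^+ 2) <= D * (f1 ^+ 2 + f2 ^+ 2).
  by rewrite ler_wpM2r// addr_ge0 ?sqr_ge0.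
have b1 := sqr_ge0 (p * f1 - p * z1); have b2 := sqr_ge0 (p * f2 - p * z2).
have b3 := sqr_ge0 (p2 * z1 + p * z1); have b4 := sqr_ge0 (p2 * z2 + p * z2).
have b5 := sqr_ge0 ((p1 * z1 + p * g1) / 2 + 2 * (p1 * z1)).
have b6 := sqr_ge0 ((p1 * z2 + p * g2) / 2 + 2 * (p1 * z2)).
nra.
Qed.

(* The truncations of u satisfy an energy estimate uniform in the cutoff. *)
Lemma quasi_L2 u g w k F : quasi u g w k F -> L2 u -> L2 F -> L2 g.
Proof.
move=> q ul Fl; have [ug wk wE kE] := q.
have gl := quasi_locint_csq ug (cprim_cont wk) wE.
have mg := clocint_meas (cprim_locint ug).
have [chi [chi1 [chi2 [c [d [c0 d0 Hr Hb [H0 H1 H2 _]]]]]]] := @cutoff_sequence R.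
have FL := L2_clocint Fl; have cu := cprim_cont ug; have glc := cprim_locint ug.
(* The energy estimate gives N / 2 - C U <= Re E, while [cutoff_pointwise] bounds Re E by N / 4 plus
   known terms; a quarter of N remains, whence the factor 4. *)
pose B := 4 * (C * (c ^+ 2 * nrm2 u) + c ^+ 2 * nrm2 F + 9 * c ^+ 2 * nrm2 u).
have Hcc (r : R) : `|r| <= c -> r ^+ 2 <= c ^+ 2.
  by move=> h; rewrite -real_normK ?num_real//; apply: lerXn2r; rewrite ?nnegrE.
have e1 n : c / n.+1%:R <= c by rewrite ler_pdivrMr// ler_peMr// ler1n.
have b0 n x : `|chi n x| <= c by have [] := Hb n x.
have b1 n x : `|chi1 n x| <= c by have [_ h _] := Hb n x; exact: le_trans h (e1 n).
have b2 n x : `|chi2 n x| <= c by have [_ _ h] := Hb n x; exact: le_trans h (e1 n).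
have step n : \int[mu]_(x in `[- n.+1%:R, n.+1%:R])
     csq ((chi1 n x)%:C * u x + (chi n x)%:C * g x) <= B.
  have [r1 r2 c1 c2 c3] := Hr n.
  have qn := quasi_cutoff r1 r2 c1 c2 q FL.
  have Fn := clocint_cutoff c1 c2 c3 cu glc FL.
  have z1 : (chi n (- n.+1%:R))%:C * u (- n.+1%:R) = 0.
    by rewrite H0 ?mul0r// normrN ger0_norm.
  have z2 : (chi n n.+1%:R)%:C * u n.+1%:R = 0 by rewrite H0 ?mul0r// ger0_norm.
  have [E1 _] := energy_segment qn Fn z1 z2.
  have [vg _ _ _] := qn; have cv := cprim_cont vg.
  have hl := quasi_locint_csq vg (cprim_cont (let: And4 _ h _ _ := qn in h)) (let: And4 _ _ h _ := qn in h).
  set N := \int[mu]_(x in _) _ in E1 *.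
  have E2 : \int[mu]_(x in `[- n.+1%:R, n.+1%:R]) csq ((chi n x)%:C * u x) <= c ^+ 2 * nrm2 u.
    rewrite /nrm2 -RintegralZl//; last exact: L2_int.
    apply: (@le_trans _ _ (\int[mu]_(x in `[- n.+1%:R, n.+1%:R]) (c ^+ 2 * csq (u x)))).
      apply: le_Rintegral => //.
      - by apply: locint_mint; exact: locint_cont_csq.
      - by apply: locint_mint; apply: locintZ; exact: L2_locint_csq.
      - by move=> x _; rewrite csqM csqC ler_wpM2r ?csq_ge0// Hcc ?b0 ?b1.
    apply: Rint_subset => //; first by apply: mintZ => //; exact: L2_int.
    by move=> x _; rewrite mulr_ge0 ?sqr_ge0 ?csq_ge0.
  set E := cint _ _ in E1.
  have E3 : Re E <= 4^-1 * N + c ^+ 2 * nrm2 F + 9 * c ^+ 2 * nrm2 u.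
    rewrite /E cRe_cint.
    apply: (@le_trans _ _ (\int[mu]_(x in `[- n.+1%:R, n.+1%:R])
        (4^-1 * csq ((chi1 n x)%:C * u x + (chi n x)%:C * g x) +
          (c ^+ 2 * csq (F x) + 9 * c ^+ 2 * csq (u x))))).
      apply: le_Rintegral => //.
      - have := clocintMl (ccontJ cv) Fn; under eq_fun do rewrite mulrC.
        by move=> h; exact: (clocint_itv _ _ h).1.
      - apply: locint_mint; apply: locintD; first exact: locintZ.
        by apply: locintD; apply: locintZ; exact: L2_locint_csq.
      - by move=> x _; rewrite addrA; apply: cutoff_pointwise.
    rewrite RintegralD//; last 2 first.
    - by apply: locint_mint; exact: locintZ.
    - by apply: locint_mint; apply: locintD; apply: locintZ; exact: L2_locint_csq.
    rewrite RintegralZl//; last exact: locint_mint.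
    rewrite -addrA lerD2l -(RintegralZl _ _ (L2_int Fl))// -(RintegralZl _ _ (L2_int ul))//.
    rewrite -RintegralD//; last 2 first.
    - by apply: mintZ => //; exact: L2_int.
    - by apply: mintZ => //; exact: L2_int.
    apply: Rint_subset => //; first by apply: mintD => //; apply: mintZ => //; exact: L2_int.
    by move=> x _; rewrite addr_ge0// mulr_ge0 ?csq_ge0// ?mulr_ge0 ?sqr_ge0.
  have E4 := ler_wpM2l stepanov_cst_ge0 E2.
  by move: E1 E3 E4; rewrite /B; lra.
apply/L2P; split => //.
(* Where d <= chi, the bound on u' comes from chi u' = (chi u)' - chi' u: this explains the division
   by d^2 and the two terms. *)
pose B' := (d ^+ 2)^-1 * (2 * B + 2 * (c ^+ 2 * nrm2 u)).
apply: (proj1 (@locint_exhaustion _ _ B' gl (fun x => csq_ge0 _) _)) => m.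
(* The lower bound d holds for |x| <= (n + 1) / 2, and this n makes it hold on [[- m, m]]. *)
pose n := (m + m)%N.
have mn : m%:R <= n.+1%:R / 2 :> R.
  by rewrite /n -natr1 natrD; lra.
have mn' : m%:R <= n.+1%:R :> R by rewrite ler_nat /n -addnS leq_addr.
have [r1 r2 c1 c2 c3] := Hr n.
have ch : ccont (fun x => (chi1 n x)%:C * u x) by apply: ccontM => //; exact: ccontC.
have lh : locint (fun x => csq ((chi1 n x)%:C * u x + (chi n x)%:C * g x)).
  have qn := quasi_cutoff r1 r2 c1 c2 q FL; have [vg vw vE _] := qn.
  exact: quasi_locint_csq vg (cprim_cont vw) vE.
rewrite /B' mulrC -ler_pdivrMr ?invr_gt0 ?exprn_gt0// invrK mulrC -RintegralZl//; last exact: locint_mint.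
apply: (@le_trans _ _ (\int[mu]_(x in `[- m%:R, m%:R])
  (2 * csq ((chi1 n x)%:C * u x + (chi n x)%:C * g x) + 2 * (c ^+ 2 * csq (u x))))).
  apply: le_Rintegral => //.
  - by apply: locint_mint; exact: locintZ.
  - apply: locint_mint; apply: locintD; first exact: locintZ.
    by apply: locintZ; apply: locintZ; exact: L2_locint_csq.
  - move=> x; rewrite /= in_itv/= -ler_norml => xm.
    have dx : d <= chi n x by apply: H2; exact: le_trans xm mn.
    have dd : d ^+ 2 <= chi n x ^+ 2 by apply: lerXn2r; rewrite ?nnegrE ?(ltW d0)// (le_trans (ltW d0)).
    apply: (@le_trans _ _ (csq ((chi n x)%:C * g x))).
      by rewrite csqM csqC ler_wpM2r ?csq_ge0.
    rewrite [X in csq X <= _](_ : _ =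
      ((chi1 n x)%:C * u x + (chi n x)%:C * g x) - (chi1 n x)%:C * u x); last by ring.
    apply: le_trans (csqB_le _ _) _; rewrite lerD2l ler_wpM2l//.
    by rewrite csqM csqC ler_wpM2r ?csq_ge0// Hcc ?b0 ?b1.
rewrite RintegralD//; last 2 first.
- by apply: locint_mint; exact: locintZ.
- by apply: locint_mint; apply: locintZ; apply: locintZ; exact: L2_locint_csq.
have lu := L2_locint_csq ul.
rewrite (RintegralZl _ _ (locint_mint (- m%:R) m%:R lh))//.
rewrite (RintegralZl _ _ (locint_mint (- m%:R) m%:R (locintZ (c ^+ 2) lu)))//.
rewrite (RintegralZl _ _ (locint_mint (- m%:R) m%:R lu))//.
apply: lerD; apply: ler_wpM2l => //.
  apply: le_trans (step n); apply: Rint_subset => //; last by move=> x _; exact: csq_ge0.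
    by apply: subset_itv; rewrite bnd_simp ?lerN2.
  exact: locint_mint.
by apply: ler_wpM2l; rewrite ?sqr_ge0//; apply: Rint_subset => //; [exact: L2_int|move=> x _; exact: csq_ge0].
Qed.

End Schroedinger.

(** * The maximal operator inside the form-sum *)

Section SchroedingerForm.
Context {R : realType}.
Local Notation mu := (@lebesgue_measure R).
Implicit Types (f g h u v w k y z F : R -> R[i]) (a b x : R).
Variables (Q tau : R -> R[i]) (M : R).
Hypotheses (mQ : cmeasurable Q) (Ql : locint (fun x => csq (Q x))) (tl : clocint tau).
Hypotheses (Vl : locint (potential Q tau)) (M0 : 0 <= M).
Hypothesis VM : forall s, \int[mu]_(x in `[s, s + 1]) potential Q tau x <= M.
Local Notation C := (stepanov_cst M).
Local Notation pot := (potential Q tau).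
Local Notation eform := (form_integrand Q tau).
Local Notation quasi := (quasi Q tau).
Let mtau : cmeasurable tau := clocint_meas tl.

Lemma ccvgJ (zs : nat -> R[i]) (z0 : R[i]) : ccvg zs z0 -> ccvg (fun n => (zs n)^*) (z0^*).
Proof.
move=> [h1 h2]; split; first by under eq_fun do rewrite cReJ; rewrite cReJ.
by under eq_fun do rewrite cImJ; rewrite cImJ; exact: cvgN.
Qed.

Lemma quasi_aeeq_rhs u g w k f F : quasi u g w k f -> aeeq f F -> quasi u g w k F.
Proof.
move=> [ug wk wE kE] fF; split => //.
by apply: ae_imp2 kE fF => x -> ->.
Qed.

Lemma quasi_lin (c : R[i]) u g w k f u' g' w' k' f' : quasi u g w k f -> quasi u' g' w' k' f' ->
  quasi (fun x => c * u x + u' x) (fun x => c * g x + g' x) (fun x => c * w x + w' x)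
    (fun x => c * k x + k' x) (fun x => c * f x + f' x).
Proof.
move=> [ug wk wE kE] [ug' wk' wE' kE']; split.
- by apply: cprimD => //; exact: cprimZ.
- by apply: cprimD => //; exact: cprimZ.
- by apply: ae_imp2 wE wE' => x -> ->; ring.
- by apply: ae_imp2 kE kE' => x -> ->; ring.
Qed.

(** Here u is fixed: g is its derivative almost everywhere, w is continuous and hence determined
    everywhere, then k is determined as its derivative, and finally the right-hand side. *)
Lemma quasi_unique u g w k f g' w' k' f' : quasi u g w k f -> quasi u g' w' k' f' -> aeeq f f'.
Proof.
move=> [ug wk wE kE] [ug' wk' wE' kE'].
have gg : aeeq g g' := aeeq_trans (aeeq_sym (cprim_cderive ug)) (cprim_cderive ug').
have ww : w = w'.
  apply: ccont_ae_eq (cprim_cont wk) (cprim_cont wk') _.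
  have H : aeeq w (fun x => g' x - Q x * u x) by apply: ae_imp2 wE gg => x -> ->.
  exact: aeeq_trans H (aeeq_sym wE').
have kk : aeeq k k'.
  by apply: aeeq_trans (aeeq_sym (cprim_cderive wk)) _; rewrite ww; exact: cprim_cderive wk'.
have H : aeeq k' (fun x => - f x - Q x * g' x + tau x * u x).
  have H1 : aeeq k (fun x => - f x - Q x * g' x + tau x * u x) by apply: ae_imp2 kE gg => x -> ->.
  exact: aeeq_trans (aeeq_sym kk) H1.
apply: ae_imp2 H kE' => x -> /eqP; rewrite -!addrA => /eqP/addIr/oppr_inj //.
Qed.

Lemma Smax_operator : is_operator (Smax Q tau).
Proof.
split.
- by move=> u f /SmaxP[].
- move=> u v f g /SmaxP[_ _ [u' [g' [w [k [uu' q]]]]]] vl gl uv fg; apply/SmaxP; split => //.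
  exists u', g', w, k; split; first exact: aeeq_trans (aeeq_sym uv) uu'.
  exact: quasi_aeeq_rhs q fg.
- apply/SmaxP; split; [exact: L2_0|exact: L2_0|].
  exists (fun=> 0), (fun=> 0), (fun=> 0), (fun=> 0); split; first exact: aeeq_refl.
  split; try exact: cprim_cst.
    by apply: aeW => x; rewrite mulr0 subr0.
  by apply: aeW => x; rewrite !mulr0 oppr0 !addr0.
- move=> c u v f g /SmaxP[ul fl [u1 [g1 [w1 [k1 [e1 q1]]]]]] /SmaxP[vl gl [u2 [g2 [w2 [k2 [e2 q2]]]]]].
  apply/SmaxP; split; [by apply: L2D => //; exact: L2Z|by apply: L2D => //; exact: L2Z|].
  do 4 eexists; split; last exact: (quasi_lin c q1 q2).
  by apply: ae_imp2 e1 e2 => x -> ->.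
- move=> u f g /SmaxP[_ _ [u1 [g1 [w1 [k1 [e1 q1]]]]]] /SmaxP[_ _ [u2 [g2 [w2 [k2 [e2 q2]]]]]].
  have uu : u1 = u2.
    have [c1 _ _ _] := q1; have [c2 _ _ _] := q2.
    apply: (ccont_ae_eq (cprim_cont c1) (cprim_cont c2)).
    exact: aeeq_trans (aeeq_sym e1) e2.
  by rewrite -uu in q2; exact: quasi_unique q1 q2.
Qed.

(** An H^1 function y with its continuous representative u and its derivative g. The form is
    computed on (u, g), independently of the choices made by [wderiv]. *)
Definition h1rep y u g := [/\ cprim u g, aeeq y u, L2 y, L2 u & L2 g].

Lemma h1rep_H1 y u g : h1rep y u g -> H1 y /\ aeeq (wderiv y) g.
Proof.
move=> [ug yu yl ul gl].
have wd : weak_derivative y g.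
  apply: (weak_derivative_aeeq (L2_meas ul) (L2_meas yl) (aeeq_sym yu)).
  exact: weak_derivative_cprim.
have Hy : H1 y by split => //; exists g.
split => //; have [l d] := wderivP Hy.
by apply: (weak_derivative_unique d wd); exact: L2_clocint.
Qed.

Lemma H1_h1rep y : H1 y -> exists u, h1rep y u (wderiv y).
Proof.
move=> Hy; have [u [ug yu ul]] := H1_representative Hy; exists u; split => //.
  by case: Hy.
by have [] := wderivP Hy.
Qed.

Lemma h1rep_lin (c : R[i]) y u g z v h : h1rep y u g -> h1rep z v h ->
  h1rep (fun x => c * y x + z x) (fun x => c * u x + v x) (fun x => c * g x + h x).
Proof.
move=> [ug yu yl ul gl] [vh zv zl vl hl]; split.
- by apply: cprimD => //; exact: cprimZ.
- by apply: ae_imp2 yu zv => x -> ->.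
- by apply: L2D => //; exact: L2Z.
- by apply: L2D => //; exact: L2Z.
- by apply: L2D => //; exact: L2Z.
Qed.

Definition edom u g v h x := csq (g x) + csq (h x) + (pot x * csq (u x) + pot x * csq (v x)).

Lemma edom_int u g v h : cprim u g -> L2 u -> L2 g -> cprim v h -> L2 v -> L2 h ->
  mu.-integrable setT (EFin \o edom u g v h).
Proof.
move=> ug ul gl vh vl hl; apply: mintD => //.
  by apply: mintD => //; exact: L2_int.
by apply: mintD => //; [exact: (potential_line Vl M0 VM ug ul gl).1|exact: (potential_line Vl M0 VM vh vl hl).1].
Qed.

Lemma cintable_eform u g v h : cprim u g -> L2 u -> L2 g -> cprim v h -> L2 v -> L2 h ->
  cintable setT (eform u g v h).
Proof.
move=> ug ul gl vh vl hl.
apply: (@cintable_le _ _ _ (edom u g v h)) => //.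
- by apply: cmeas_eform => //; exact: L2_meas.
- exact: edom_int.
- by move=> x _; rewrite (le_trans (normc_eform _ _ _ _ _ _ _))// /edom mulrDr.
Qed.

Lemma t_formE y u g z v h : h1rep y u g -> h1rep z v h ->
  form_app (t_form Q tau) y z = cint setT (eform u g v h).
Proof.
move=> ry rz; have [_ wy] := h1rep_H1 ry; have [_ wz] := h1rep_H1 rz.
have [/wderivP[wyl _] _] := h1rep_H1 ry; have [/wderivP[wzl _] _] := h1rep_H1 rz.
have [ug yu yl ul gl] := ry; have [vh zv zl vl hl] := rz.
have -> : form_app (t_form Q tau) y z = inner (wderiv y) (wderiv z)
   - cint setT (fun x => Q x * (wderiv y x * (z x)^* + y x * (wderiv z x)^*))
   + cint setT (fun x => tau x * y x * (z x)^*) by [].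
have E1 : inner (wderiv y) (wderiv z) = inner g h.
  by apply: inner_aeeq => //; exact: L2_meas.
have mJ f : cmeasurable f -> cmeasurable (fun x => (f x)^*) by exact: cmeasJ.
have m1 := L2_meas yl; have m2 := L2_meas ul; have m3 := L2_meas gl; have m4 := L2_meas zl.
have m5 := L2_meas vl; have m6 := L2_meas hl; have m7 := L2_meas wyl; have m8 := L2_meas wzl.
have E2 : cint setT (fun x => Q x * (wderiv y x * (z x)^* + y x * (wderiv z x)^*)) =
    cint setT (fun x => Q x * (g x * (v x)^* + u x * (h x)^*)).
  apply: cint_aeeq => //.
  - by apply: cmeasM => //; apply: cmeasD; apply: cmeasM => //; exact: cmeasJ.
  - by apply: cmeasM => //; apply: cmeasD; apply: cmeasM => //; exact: cmeasJ.
  have H1 : {ae mu, forall x, y x = u x /\ z x = v x} by apply: ae_imp2 yu zv => x.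
  have H2 : {ae mu, forall x, wderiv y x = g x /\ wderiv z x = h x} by apply: ae_imp2 wy wz => x.
  by apply: ae_imp2 H1 H2 => x [-> ->] [-> ->].
have E3 : cint setT (fun x => tau x * y x * (z x)^*) = cint setT (fun x => tau x * u x * (v x)^*).
  apply: cint_aeeq => //.
  - by apply: cmeasM => //; [exact: cmeasM|exact: cmeasJ].
  - by apply: cmeasM => //; [exact: cmeasM|exact: cmeasJ].
  by apply: ae_imp2 yu zv => x -> ->.
rewrite E1 E2 E3.
have i1 := inner_int gl hl.
have i2 := cintable_eform ug ul gl vh vl hl.
have i3 : cintable setT (fun x => tau x * u x * (v x)^*).
  apply: (@cintable_le _ _ _ (edom u g v h)) => //.
  - by apply: cmeasM => //; [exact: cmeasM|exact: cmeasJ].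
  - exact: edom_int.
  - move=> x _; rewrite !normcM normcJ /edom -mulrDr.
    have h1 : normc (u x) * normc (v x) <= csq (u x) + csq (v x).
      rewrite -!sqr_normc; have := sqr_ge0 (normc (u x) - normc (v x)).
      by have := sqr_ge0 (normc (u x)); have := sqr_ge0 (normc (v x)); nra.
    have h2 := csq_ge0 (g x); have h3 := csq_ge0 (h x).
    have h4 : normc (tau x) <= pot x by rewrite /potential lerDr mulr_ge0// csq_ge0.
    rewrite -mulrA; apply: le_trans (_ : pot x * (csq (u x) + csq (v x)) <= _); last by rewrite lerDr addr_ge0.
    by apply: ler_pM => //; rewrite ?mulr_ge0 ?normc_ge0.
have -> : (fun x => Q x * (g x * (v x)^* + u x * (h x)^*)) =
    (fun x => g x * (h x)^* + tau x * u x * (v x)^* - eform u g v h x).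
  by apply/funext => x; rewrite /form_integrand; ring.
rewrite cintB//; last exact: cintableD.
rewrite cintD// /inner cintegralE; ring.
Qed.

(** The cutoff is placed on the second argument v: this removes the boundary terms and leaves l[u]
    untouched. Since u' is in L^2 by [quasi_L2], dominated convergence then removes the cutoff. *)
Lemma Smax_Sfs p : Smax Q tau p -> Sfs Q tau p.
Proof.
case: p => y f /SmaxP[yl fl [u [g [w [k [yu q]]]]]].
have [ug wk wE kE] := q.
have ul := L2_aeeq (cprim_meas ug) yu yl.
have gl := quasi_L2 mQ Ql tl Vl M0 VM q ul fl.
have ry : h1rep y u g by split.
split; first by have [] := h1rep_H1 ry.
split => // z Hz; rewrite [LHS](_ : _ = form_app (t_form Q tau) y z)// [RHS](_ : _ = inner f z)//.
have [v rz] := H1_h1rep Hz; move: (wderiv z) rz => h rz.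
have [vh zv zl vl hl] := rz.
rewrite (t_formE ry rz).
have -> : inner f z = inner f v.
  by apply: inner_aeeq (aeeq_refl _) zv; exact: L2_meas.
have [chi [chi1 [chi2 [c [d [c0 d0 Hr Hb [H0 H1 H2 Hl]]]]]]] := @cutoff_sequence R.
have e1 n : c / n.+1%:R <= c by rewrite ler_pdivrMr// ler_peMr// ler1n.
have b0 n x : `|chi n x| <= c by have [] := Hb n x.
have b1 n x : `|chi1 n x| <= c by have [_ e _] := Hb n x; exact: le_trans e (e1 n).
have Hcc (r : R) : `|r| <= c -> r ^+ 2 <= c ^+ 2.
  by move=> e; rewrite -real_normK ?num_real//; apply: lerXn2r; rewrite ?nnegrE.
have Hl1 x : chi1 n x @[n --> \oo] --> (0 : R).
  apply: norm_cvg0; apply: (@squeeze_cvgr _ _ _ _ (fun=> 0) (fun n => c / n.+1%:R)).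
  - by apply: nearW => n; rewrite normr_ge0/=; have [] := Hb n x.
  - exact: cvg_cst.
  - by rewrite -[X in _ --> X](mulr0 c); apply: cvgM; [exact: cvg_cst|exact: cvg_harmonic].
pose vn n x := (chi n x)%:C * v x; pose hn n x := (chi1 n x)%:C * v x + (chi n x)%:C * h x.
have vhn n : cprim (vn n) (hn n).
  by apply: cprim_realM => //; have [] := Hr n.
have hnl n : locint (fun x => csq (hn n x)).
  have mh := clocint_meas (cprim_locint (vhn n)).
  apply: (@locint_le _ _ (fun x => 2 * (c ^+ 2 * csq (v x)) + 2 * (c ^+ 2 * csq (h x)))).
  - exact: meas_csq.
  - by apply: locintD; do 2! apply: locintZ; exact: L2_locint_csq.
  - move=> x; rewrite ger0_norm ?csq_ge0// (le_trans (csqD_le _ _))// !csqM !csqC.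
    by rewrite lerD// ler_wpM2l// ler_wpM2r ?csq_ge0// Hcc.
have eqn n : cint setT (eform u g (vn n) (hn n)) = cint setT (fun x => f x * (vn n x)^*).
  have nn : - n.+1%:R <= n.+1%:R :> R by rewrite ge0_cp ?ler0n.
  have out x : ~ `[- n.+1%:R, n.+1%:R]%classic x -> vn n x = 0 /\ hn n x = 0.
    move=> /= /negP; rewrite in_itv/= -ler_norml -ltNge => xn.
    by rewrite /vn /hn H0 ?(ltW xn)// (H1 _ _ xn).1 !mul0r addr0.
  rewrite (@cint_supp _ `[- n.+1%:R, n.+1%:R]); last first.
    by move=> x /out[a b]; rewrite /form_integrand a b rmorph0 !(mulr0, addr0, subrr).
  rewrite (@cint_supp _ `[- n.+1%:R, n.+1%:R] (fun x => f x * (vn n x)^*)); last first.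
    by move=> x /out[a _]; rewrite a rmorph0 mulr0.
  have := boundary_identity mQ Ql tl ug wk (L2_clocint fl) (vhn n) (hnl n) wE kE nn.
  have -> : vn n n.+1%:R = 0 by rewrite /vn H0 ?mul0r// ger0_norm.
  have -> : vn n (- n.+1%:R) = 0 by rewrite /vn H0 ?mul0r// normrN ger0_norm.
  by rewrite rmorph0 !mulr0 subrr => /esym/eqP; rewrite subr_eq0 => /eqP.
have cv x : ccvg (vn ^~ x) (v x).
  rewrite -[v x]mul1r; apply: ccvgM (ccvg_cst _); split => /=; [exact: Hl|exact: cvg_cst].
have ch x : ccvg (hn ^~ x) (h x).
  have -> : h x = 0%:C * v x + 1%:C * h x by rewrite mul0r mul1r add0r.
  apply: ccvgD; apply: ccvgM (ccvg_cst _); split => /=; try exact: cvg_cst.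
    exact: Hl1.
  exact: Hl.
have mv := L2_meas vl; have mh := L2_meas hl; have mf := L2_meas fl.
have mvn n := cprim_meas (vhn n); have mhn n := clocint_meas (cprim_locint (vhn n)).
have vnb n x : csq (vn n x) <= c ^+ 2 * csq (v x).
  by rewrite csqM csqC ler_wpM2r ?csq_ge0// Hcc.
have L1 : ccvg (fun n => cint setT (eform u g (vn n) (hn n))) (cint setT (eform u g v h)).
  have I1 := (potential_line Vl M0 VM ug ul gl).1.
  have I2 := (potential_line Vl M0 VM vh vl hl).1.
  apply: (@cint_dct _ _ _ _ (fun x => csq (g x) + (2 * (c ^+ 2 * csq (v x)) + 2 * (c ^+ 2 * csq (h x)))
     + (pot x * csq (u x) + c ^+ 2 * (pot x * csq (v x)))) _ _ _ _ _ _).2 => //.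
  - by move=> n; apply: cmeas_eform => //; exact: L2_meas.
  - by apply: cmeas_eform => //; exact: L2_meas.
  - move=> x _; rewrite /form_integrand; apply: ccvgD; last first.
      by apply: ccvgM (ccvg_cst _) _; exact: ccvgJ.
    apply: ccvgB; first by apply: ccvgM (ccvg_cst _) _; exact: ccvgJ.
    apply: ccvgM (ccvg_cst _) _; apply: ccvgD; apply: ccvgM (ccvg_cst _) _; exact: ccvgJ.
  - move=> n x _; rewrite (le_trans (normc_eform _ _ _ _ _ _ _))//; apply: lerD.
      rewrite lerD2l (le_trans (csqD_le _ _))// !csqM !csqC.
      by rewrite lerD// ler_wpM2l// ler_wpM2r ?csq_ge0// Hcc.
    rewrite mulrDr lerD2l mulrCA ler_wpM2l ?pot_ge0//.
  - apply: mintD => //; last by apply: mintD => //; exact: mintZ.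
    apply: mintD => //; first exact: L2_int.
    by apply: mintD => //; do 2! apply: mintZ => //; exact: L2_int.
have L2' : ccvg (fun n => cint setT (fun x => f x * (vn n x)^*)) (inner f v).
  apply: (@cint_dct _ _ _ _ (fun x => csq (f x) + c ^+ 2 * csq (v x)) _ _ _ _ _ _).2 => //.
  - by move=> n; apply: cmeasM => //; exact: cmeasJ.
  - by apply: cmeasM => //; exact: cmeasJ.
  - by move=> x _; apply: ccvgM (ccvg_cst _) _; exact: ccvgJ.
  - move=> n x _; rewrite (le_trans (normc_prod_le _ _))// csqJ.
    have := vnb n x; have := csq_ge0 (f x); have := csq_ge0 (vn n x); lra.
  - by apply: mintD => //; [exact: L2_int|apply: mintZ => //; exact: L2_int].
by apply: ccvg_unique L2'; under eq_fun do rewrite -eqn.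
Qed.

Lemma Sfs_linear : linear_graph (Sfs Q tau).
Proof.
split.
- by move=> u f [[ul _] [fl _]].
- have r0 : h1rep (fun=> 0) (fun=> 0) (fun=> 0 : R[i]).
    split; [exact: cprim_cst|exact: aeeq_refl|exact: L2_0..].
  split; first by have [] := h1rep_H1 r0.
  split; first exact: L2_0.
  move=> z Hz; have [v rz] := H1_h1rep Hz; rewrite (t_formE r0 rz).
  rewrite /inner cintegralE; apply: eq_cint => x _.
  transitivity (0 : R[i]); last by rewrite mul0r.
  by rewrite /form_integrand !mul0r addr0 !mulr0 subr0 add0r mul0r.
- move=> c u v f g [Hu [fl Ef]] [Hv [gl Eg]]; rewrite /fst /snd in Hu fl Ef Hv gl Eg.
  have [u' ru] := H1_h1rep Hu; have [v' rv] := H1_h1rep Hv.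
  have rl := h1rep_lin c ru rv.
  split; first by have [] := h1rep_H1 rl.
  split; first by apply: L2D => //; exact: L2Z.
  move=> z Hz; have [z' rz] := H1_h1rep Hz; have [zl _] := Hz.
  have {}Ef : form_app (t_form Q tau) u z = inner f z := Ef z Hz.
  have {}Eg : form_app (t_form Q tau) v z = inner g z := Eg z Hz.
  have fcl := L2Z c fl.
  rewrite innerDl// innerZl// -Ef -Eg (t_formE rl rz) (t_formE ru rz) (t_formE rv rz).
  have [a1 _ _ a2 a3] := ru; have [b1 _ _ b2 b3] := rv; have [d1 _ _ d2 d3] := rz.
  rewrite -cintZ//; last exact: cintable_eform.
  rewrite -cintD//; [|by apply: cintableZ => //; exact: cintable_eform|exact: cintable_eform].
  by apply: eq_cint => x _; rewrite /form_integrand; ring.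
Qed.

Lemma Sfs_sectorial : sectorial (2 * C) (Sfs Q tau).
Proof.
move=> y f [Hy [fl /(_ _ Hy) E]]; have [u ry] := H1_h1rep Hy.
have {}E : form_app (t_form Q tau) y y = inner f y by exact: E.
rewrite -E (t_formE ry ry); have [ug yu yl ul gl] := ry.
have [I V] := potential_line Vl M0 VM ug ul gl.
have mg := L2_meas gl; have mu_ := L2_meas ul.
have mE := cmeas_eform mQ mtau mu_ mg mu_ mg.
have h1 := Re_eform (@measurableT _ _) mE mg (L2_int gl) I V.
have h2 := Im_eform (@measurableT _ _) mE mg (L2_int gl) I V.
rewrite (nrm2_aeeq (L2_meas yl) mu_ yu).
apply: le_trans h2 _; move: h1; rewrite /nrm2; move: (Re _) => r; lra.
Qed.

End SchroedingerForm.

(** * Convergent subsequences of bounded sequences *)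

Section Subsequences.
Context {R : realType}.

Lemma increasing_ge (s : nat -> nat) n : increasing_seq s -> (n <= s n)%N.
Proof.
move=> inc; elim: n => // n IH; apply: leq_ltn_trans IH _.
by rewrite ltnNge; have := inc n.+1 n; rewrite !leEnat => ->; rewrite -ltnNge.
Qed.

Lemma increasing_comp (s t : nat -> nat) : increasing_seq s -> increasing_seq t ->
  increasing_seq (s \o t).
Proof. by move=> h1 h2 n m; rewrite /= h1; exact: h2. Qed.

Lemma cvg_increasing (a : nat -> R) (s : nat -> nat) (l : R) : increasing_seq s ->
  a @ \oo --> l -> (a (s n)) @[n --> \oo] --> l.
Proof.
move=> inc /cvgrPdist_lt H; apply/cvgrPdist_lt => e e0; have [N _ HN] := H e e0.
by exists N => // n /= Nn; apply: HN; exact: leq_trans Nn (increasing_ge n inc).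
Qed.

Lemma bounded_cvg_subseq (a : nat -> R) (A : R) : (forall n, `|a n| <= A) ->
  exists (s : nat -> nat) (l : R), increasing_seq s /\ (a (s n)) @[n --> \oo] --> l.
Proof.
move=> H; have [|s inc /cvg_ex[l Hl]] := @bolzano_weierstrass R a; last by exists s, l.
exists A; split; first exact: num_real.
by move=> B AB n _; exact: le_trans (H n) (ltW AB).
Qed.

Lemma ccvg_increasing (zs : nat -> R[i]) (s : nat -> nat) z : increasing_seq s ->
  ccvg zs z -> ccvg (zs \o s) z.
Proof.
move=> inc [h1 h2]; split; first exact: (cvg_increasing (a := fun n => Re (zs n)) inc h1).
exact: (cvg_increasing (a := fun n => Im (zs n)) inc h2).
Qed.

Lemma bounded_ccvg_subseq (zs : nat -> R[i]) (A : R) : (forall n, normc (zs n) <= A) ->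
  exists (s : nat -> nat) (z : R[i]), increasing_seq s /\ ccvg (zs \o s) z.
Proof.
move=> H.
have [s [x [incs sx]]] := @bounded_cvg_subseq (fun n => Re (zs n)) A (fun n => le_trans (Re_le_normc _) (H n)).
have [t [y [inct ty]]] := @bounded_cvg_subseq (fun n => Im (zs (s n))) A (fun n => le_trans (Im_le_normc _) (H _)).
exists (s \o t), (x +i* y); split; first exact: increasing_comp.
by split => //=; exact: (cvg_increasing (a := fun n => Re (zs (s n))) inct sx).
Qed.

Lemma ccvg_csq_small (zs : nat -> R[i]) z (e : R) : ccvg zs z -> 0 < e ->
  exists N, forall n, (N <= n)%N -> csq (z - zs n) < e.
Proof.
move=> [h1 h2] e0.
have H : ((Re z - Re (zs n)) ^+ 2 + (Im z - Im (zs n)) ^+ 2) @[n --> \oo] -->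
    ((Re z - Re z) ^+ 2 + (Im z - Im z) ^+ 2).
  by apply: cvgD; rewrite expr2; under eq_fun do rewrite expr2; apply: cvgM; apply: cvgB => //; exact: cvg_cst.
rewrite !subrr expr0n addr0 in H.
have /cvgrPdist_lt/(_ _ e0)[N _ HN] := H.
exists N => n Nn; have := HN n Nn; rewrite /= sub0r normrN ger0_norm.
  by rewrite /csq cReD cReN cImD cImN.
by rewrite addr_ge0 ?sqr_ge0.
Qed.

End Subsequences.

(** * The resolvent equation: solutions and a priori bounds *)

Section Resolvent.
Context {R : realType}.
Local Notation mu := (@lebesgue_measure R).
Implicit Types (f g h u v w k y F G : R -> R[i]) (x : R) (a b : R[i]).
Variables (Q tau : R -> R[i]) (M : R).
Hypotheses (mQ : cmeasurable Q) (Ql : locint (fun x => csq (Q x))) (tl : clocint tau).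
Hypotheses (Vl : locint (potential Q tau)) (M0 : 0 <= M).
Hypothesis VM : forall s, \int[mu]_(x in `[s, s + 1]) potential Q tau x <= M.
Local Notation C := (stepanov_cst M).
Local Notation quasi := (quasi Q tau).
Variable lam : R[i].

Definition solution G u w := exists g k, quasi u g w k (fun x => G x - lam * u x).

Lemma le_1Dcsq (z : R[i]) : normc z <= 1 + csq z.
Proof.
rewrite -sqr_normc; have := sqr_ge0 (normc z - 1); have := normc_ge0 z; nra.
Qed.

Lemma Re_subZ (z l : R[i]) (c : R) : Re (z - l * c%:C) = Re z - Re l * c.
Proof. by rewrite cReD cReN cReM cImC cReC mulr0 subr0. Qed.

(** As a first-order system the equation reads u' = Q u + w and w' = (tau + lam - Q^2) u - Q w - G,
    whose coefficients are locally integrable because Q is locally square integrable. *)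
Lemma solution_exists G (a b : R[i]) : clocint G ->
  exists u w, [/\ u 0 = a, w 0 = b & solution G u w].
Proof.
move=> Gl.
have Qc : clocint Q.
  apply: (@clocint_le _ _ (fun x => 1 + csq (Q x))) => //.
    by apply: locintD => //; apply: locint_cont => x; exact: cst_continuous.
  by move=> x; exact: le_1Dcsq.
have cc (c : R[i]) : clocint (fun=> c : R[i]).
  by apply: clocint_cont; split => x; exact: cst_continuous.
have gal : clocint (fun x => tau x + lam - Q x * Q x).
  by apply: clocintB; [exact: clocintD|exact: clocint_csq].
have [u [w [u0 w0 ug wk]]] := linear_system_solution a b Qc (cc 1) gal (clocintN Qc) (cc 0) (clocintN Gl).
exists u, w; split => //; do 2 eexists; split; [exact: ug|exact: wk| |].
  by apply: aeW => x; rewrite /lin1; ring.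
by apply: aeW => x; rewrite /lin1 /lin2; ring.
Qed.

Lemma solution_lin (c : R[i]) G u w G' u' w' : solution G u w -> solution G' u' w' ->
  solution (fun x => c * G x + G' x) (fun x => c * u x + u' x) (fun x => c * w x + w' x).
Proof.
move=> [g [k q]] [g' [k' q']]; do 2 eexists.
apply: quasi_aeeq_rhs (quasi_lin c q q') _.
by apply: aeW => x; ring.
Qed.

Hypothesis lamC : C < Re lam.
Let kap : R := Re lam - C.
Let kap0 : 0 < kap. Proof. by rewrite /kap subr_gt0. Qed.

(** The first term bounds the integral of |u|^2, the second that of |u'|^2; their sum serves for
    both. *)
Definition energy_bound G := kap^-1 ^+ 2 * nrm2 G + kap^-1 * nrm2 G.

(** The energy estimate with |G| |u| <= |G|^2 / (2 kap) + (kap / 2) |u|^2: half of kap survives on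
    the left. The bound does not depend on n. *)
Lemma dirichlet_bound G u g w k (n : nat) : L2 G -> quasi u g w k (fun x => G x - lam * u x) ->
  u (- n%:R) = 0 -> u n%:R = 0 ->
  \int[mu]_(x in `[- n%:R, n%:R]) csq (u x) <= energy_bound G /\
  \int[mu]_(x in `[- n%:R, n%:R]) csq (g x) <= energy_bound G.
Proof.
move=> Gl q ua ub; have [ug wk wE kE] := q; have cu := cprim_cont ug.
have Gc := L2_clocint Gl; have ul := clocint_cont cu.
have Fl : clocint (fun x => G x - lam * u x) by apply: clocintB => //; exact: clocintZ.
have [E1 _] := energy_segment mQ Ql tl Vl M0 VM q Fl ua ub.
have gl := quasi_locint_csq mQ Ql ug (cprim_cont wk) wE.
have N0 : 0 <= \int[mu]_(x in `[- n%:R, n%:R]) csq (g x) by apply: Rintegral_ge0 => x _; exact: csq_ge0.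
have U0 : 0 <= \int[mu]_(x in `[- n%:R, n%:R]) csq (u x) by apply: Rintegral_ge0 => x _; exact: csq_ge0.
set N := \int[mu]_(x in _) csq (g x) in E1 N0 *; set U := \int[mu]_(x in _) csq (u x) in E1 U0 *.
set E := cint _ _ in E1.
have G0 : \int[mu]_(x in `[- n%:R, n%:R]) csq (G x) <= nrm2 G.
  by apply: Rint_subset => //; [exact: L2_int|move=> x _; exact: csq_ge0].
have E2 : Re E <= (2 * kap)^-1 * nrm2 G + (kap / 2 - Re lam) * U.
  rewrite /E cRe_cint.
  apply: (@le_trans _ _ (\int[mu]_(x in `[- n%:R, n%:R]) ((2 * kap)^-1 * csq (G x) +
     (kap / 2 - Re lam) * csq (u x)))).
    apply: le_Rintegral => //.
    - have := clocintMl (ccontJ cu) Fl; under eq_fun do rewrite mulrC.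
      by move=> h; exact: (clocint_itv _ _ h).1.
    - apply: locint_mint; apply: locintD; apply: locintZ; first exact: L2_locint_csq.
      exact: locint_cont_csq.
    - move=> x _; rewrite mulrBl -mulrA mulJc [X in Re X](_ : _ = G x * (u x)^* - lam * (csq (u x))%:C)//.
      rewrite Re_subZ mulrBl addrA lerD2r.
      apply: le_trans (ler_norm _) _; apply: le_trans (Re_le_normc _) _.
      rewrite normcM normcJ -!sqr_normc invfM.
      have := sqr_ge0 (normc (G x) - kap * normc (u x)).
      set p := normc (G x); set r := normc (u x) => h.
      have h2 : 0 <= (p - kap * r) ^+ 2 * (2^-1 * kap^-1) by rewrite mulr_ge0// mulr_ge0// invr_ge0 ltW.
      have e : (p - kap * r) ^+ 2 * (2^-1 * kap^-1) = 2^-1 * kap^-1 * p ^+ 2 + kap / 2 * r ^+ 2 - p * r.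
        by field; rewrite gt_eqF.
      by rewrite e in h2; lra.
  rewrite RintegralD//; last 2 first.
  - by apply: locint_mint; apply: locintZ; exact: L2_locint_csq.
  - by apply: locint_mint; apply: locintZ; exact: locint_cont_csq.
  rewrite (RintegralZl _ _ (locint_mint _ _ (L2_locint_csq Gl)))//.
  rewrite (RintegralZl _ _ (locint_mint _ _ (locint_cont_csq cu)))//.
  by rewrite lerD2r ler_wpM2l// invr_ge0 mulr_ge0// ltW.
have E3 : N + kap * U <= kap^-1 * nrm2 G.
  have e : (2 * kap)^-1 * nrm2 G = kap^-1 * nrm2 G / 2 by rewrite invfM; ring.
  move: E1 E2; rewrite e /kap; lra.
have nG := nrm2_ge0 G.
have k1 : 0 <= kap^-1 * nrm2 G by rewrite mulr_ge0// invr_ge0 ltW.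
have k2 : 0 <= kap^-1 ^+ 2 * nrm2 G by rewrite mulr_ge0// sqr_ge0.
rewrite /energy_bound; split.
  have : U <= kap^-1 * (kap^-1 * nrm2 G).
    rewrite mulrC ler_pdivlMr// mulrC; lra.
  by rewrite mulrA -expr2; lra.
have : 0 <= kap * U by rewrite mulr_ge0// ltW.
lra.
Qed.

(** u 0 is bounded by the supremum estimate on [0, 1]; w 0 is bounded by the mean of |w| there plus
    the integral of |w'|, and both integrands are controlled by the equation. As tau is only
    integrable, tau u needs the supremum of u and not its square integral. *)
Lemma initial_bound G (B : R) : clocint G -> 0 <= B -> exists A, forall u g w k,
  quasi u g w k (fun x => G x - lam * u x) ->
  \int[mu]_(x in `[0, 1]) csq (u x) <= B -> \int[mu]_(x in `[0, 1]) csq (g x) <= B ->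
  normc (u 0) <= A /\ normc (w 0) <= A.
Proof.
(* [sup_estimate] with e = 1 gives |u|^2 <= 2 B + B, and |u| <= 1 + |u|^2. *)
move=> Gl B0; pose S := 1 + 3 * B.
have S0 : 0 <= S by rewrite /S; lra.
(* The part of a majorant of |w| + |w'| that does not involve the solution; the other part, 2 |u'|^2
   + |u|^2, integrates to at most 3 B. *)
pose H0 x := 1 + 2 * csq (Q x) + normc (G x) + (normc lam * S + S * normc (tau x)).
have one : locint (fun=> 1 : R) by apply: locint_cont => x; exact: cst_continuous.
have cst (c : R) : locint (fun=> c : R) by apply: locint_cont => x; exact: cst_continuous.
have H0l : locint H0.
  apply: locintD; last by apply: locintD => //; apply: locintZ; exact: clocint_normc.
  by apply: locintD; [apply: locintD => //; exact: locintZ|exact: clocint_normc].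
exists (S + `|\int[mu]_(x in `[0, 1]) H0 x| + 3 * B) => u g w k q uB gB.
have [ug wk wE kE] := q; have cu := cprim_cont ug; have cw := cprim_cont wk.
have gl := quasi_locint_csq mQ Ql ug cw wE; have ul := locint_cont_csq cu.
have mg := clocint_meas (cprim_locint ug); have mk := clocint_meas (cprim_locint wk).
have mu_ := cprim_meas ug; have mw := cprim_meas wk; have mG := clocint_meas Gl.
have mt := clocint_meas tl.
have uS x : 0 <= x <= 1 -> normc (u x) <= S.
  move=> x01; have x01' : 0 <= x <= 0 + 1 by rewrite add0r.
  have := sup_estimate ug gl ltr01 x01'; rewrite add0r invr1 mul1r -sqr_normc => h.
  have := le_1Dcsq (u x); rewrite /S -sqr_normc; lra.
split; first by rewrite (le_trans (uS 0 _)) ?lexx ?ler01// -addrA lerDl addr_ge0// mulr_ge0.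
have D01 : measurable `[(0 : R), 1]%classic by exact: measurable_itv.
have wl : locint (fun x => normc (w x)) by apply: locint_cont; exact: cont_normc.
have kl := clocint_normc (cprim_locint wk).
have step x : 0 <= x <= 1 -> normc (w 0) <= normc (w x) + \int[mu]_(t in `[0, 1]) normc (k t).
  move=> /andP[x0 x1]; have := cprimB_int wk x0.
  move=> e; have -> : w 0 = w x - cint `[0, x] k by rewrite -e; ring.
  rewrite (le_trans (normcB _ _))// lerD2l (le_trans (normc_cint_le _ _ _))//.
    by apply: clocint_itv; exact: cprim_locint wk.
  apply: Rint_subset => //; [|exact: locint_mint|by move=> t _; exact: normc_ge0].
  by apply: subset_itv; rewrite bnd_simp.
have I1 : normc (w 0) <= \int[mu]_(x in `[0, 1]) normc (w x) + \int[mu]_(t in `[0, 1]) normc (k t).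
  set K := \int[mu]_(t in _) normc (k t) in step *.
  have c1 (c : R) : \int[mu]_(x in `[(0 : R), 1]) c = c.
    by rewrite Rintegral_cst//= lebesgue_measure_itv/= lte_fin ltr01 oppr0 adde0 mulr1.
  rewrite -[leLHS]c1 -[X in _ + X]c1 -RintegralD//; [|exact: locint_mint..].
  have i1 := locint_mint 0 1 (cst (normc (w 0))).
  have i2 := locint_mint 0 1 (locintD wl (cst K)).
  by apply: le_Rintegral => // x; rewrite /= in_itv/=; exact: step.
have W : \int[mu]_(x in `[0, 1]) normc (w x) = \int[mu]_(x in `[0, 1]) normc (g x - Q x * u x).
  apply: ae_Rintegral => //.
  - by apply: measurable_funTS; exact: meas_normc.
  - by apply: measurable_funTS; apply: meas_normc; apply: cmeasB => //; exact: cmeasM.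
  - by apply: ae_imp wE => x ->.
have mk' : cmeasurable (fun x => - (G x - lam * u x) - Q x * g x + tau x * u x).
  apply: cmeasD; last exact: cmeasM.
  apply: cmeasB; last exact: cmeasM.
  by apply: cmeasN; apply: cmeasB => //; apply: cmeasM => //; exact: cmeas_cst.
have K : \int[mu]_(x in `[0, 1]) normc (k x) =
   \int[mu]_(x in `[0, 1]) normc (- (G x - lam * u x) - Q x * g x + tau x * u x).
  apply: ae_Rintegral => //.
  - by apply: measurable_funTS; exact: meas_normc.
  - by apply: measurable_funTS; exact: meas_normc.
  - by apply: ae_imp kE => x ->.
rewrite {}W {}K in I1.
have L1 : locint (fun x => normc (g x - Q x * u x)).
  apply: (@locint_le _ _ (fun x => 1 + csq (g x) + csq (Q x) + csq (u x))).
  - by apply: meas_normc; apply: cmeasB => //; exact: cmeasM.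
  - by apply: locintD => //; apply: locintD => //; exact: locintD.
  - move=> x; rewrite ger0_norm ?normc_ge0// (le_trans (normcB _ _))//.
    have := normc_prod_le (Q x) (u x); have := le_1Dcsq (g x).
    have := csq_ge0 (Q x); have := csq_ge0 (u x); lra.
have L2' : locint (fun x => normc (- (G x - lam * u x) - Q x * g x + tau x * u x)).
  apply: clocint_normc; apply: clocintD; last by have := clocintMl cu tl; under eq_fun do rewrite mulrC.
  apply: clocintB; last exact: clocint_csq.
  by apply: clocintN; apply: clocintB => //; apply: clocintZ; exact: clocint_cont.
rewrite -RintegralD// in I1; [|exact: locint_mint..].
apply: le_trans I1 _.
apply: (@le_trans _ _ (\int[mu]_(x in `[0, 1]) (H0 x + (2 * csq (g x) + csq (u x))))).
  apply: le_Rintegral => //.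
  - by apply: locint_mint; exact: locintD.
  - by apply: locint_mint; apply: locintD => //; apply: locintD => //; exact: locintZ.
  move=> x; rewrite /= in_itv/= => /uS ux.
  have h1 := normcB (g x) (Q x * u x).
  have h2 := normcD (- (G x - lam * u x) - Q x * g x) (tau x * u x).
  have h3 := normcB (- (G x - lam * u x)) (Q x * g x).
  have h4 := normcB (G x) (lam * u x); rewrite normcN in h3.
  have h5 := normc_prod_le (Q x) (u x); have h6 := normc_prod_le (Q x) (g x).
  have h7 : normc (lam * u x) <= normc lam * S by rewrite normcM ler_wpM2l ?normc_ge0.
  have h8 : normc (tau x * u x) <= S * normc (tau x) by rewrite normcM mulrC ler_wpM2r ?normc_ge0.
  have h9 := le_1Dcsq (g x).
  have := csq_ge0 (Q x); have := csq_ge0 (u x); have := csq_ge0 (g x); rewrite /H0; lra.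
have lg := locintZ 2 gl.
rewrite (RintegralD _ (locint_mint 0 1 H0l) (locint_mint 0 1 (locintD lg ul)))//.
rewrite (RintegralD _ (locint_mint 0 1 lg) (locint_mint 0 1 ul))//.
rewrite (RintegralZl _ _ (locint_mint 0 1 gl))//.
have := ler_norm (\int[mu]_(x in `[0, 1]) H0 x); lra.
Qed.

End Resolvent.

(** * Dirichlet solutions and solvability on the line *)

Section Onto.
Context {R : realType}.
Local Notation mu := (@lebesgue_measure R).
Implicit Types (f g h u v w k y F G : R -> R[i]) (x : R) (a b : R[i]).
Variables (Q tau : R -> R[i]) (M : R).
Hypotheses (mQ : cmeasurable Q) (Ql : locint (fun x => csq (Q x))) (tl : clocint tau).
Hypotheses (Vl : locint (potential Q tau)) (M0 : 0 <= M).
Hypothesis VM : forall s, \int[mu]_(x in `[s, s + 1]) potential Q tau x <= M.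
Local Notation C := (stepanov_cst M).
Variable lam : R[i].
Hypothesis lamC : C < Re lam.
Local Notation solution := (solution Q tau lam).

Lemma solution_cont G u w : solution G u w -> ccont u.
Proof. by move=> [g [k [ug _ _ _]]]; exact: cprim_cont ug. Qed.

(** The interval [0, 1] lies in every [[- n.+1, n.+1]], so [initial_bound] applies with one constant
    for all n. *)
Lemma dirichlet_initial G : L2 G -> exists A, forall u w (n : nat), solution G u w ->
  u (- n.+1%:R) = 0 -> u n.+1%:R = 0 -> normc (u 0) <= A /\ normc (w 0) <= A.
Proof.
move=> Gl.
pose B := `|energy_bound M lam G|.
have [A HA] := initial_bound mQ Ql tl lam (L2_clocint Gl) (normr_ge0 (energy_bound M lam G)).
exists A => u w n [g [k q]] u1 u2.
have [b1 b2] := dirichlet_bound mQ Ql tl Vl M0 VM lamC Gl q u1 u2.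
have [ug wk wE kE] := q.
have gl := quasi_locint_csq mQ Ql ug (cprim_cont wk) wE.
have sub : `[0, 1] `<=` `[- n.+1%:R, n.+1%:R : R]%classic.
  by apply: subset_itv; rewrite bnd_simp ?oppr_le0 ?ler1n ?ler0n.
apply: HA q _ _.
  apply: le_trans (le_trans b1 (ler_norm _)); apply: Rint_subset => //.
    by apply: locint_mint; apply: locint_cont_csq; exact: cprim_cont ug.
  by move=> x _; exact: csq_ge0.
apply: le_trans (le_trans b2 (ler_norm _)); apply: Rint_subset => //.
  exact: locint_mint.
by move=> x _; exact: csq_ge0.
Qed.

(** The multiples are written n z + z because [solution_lin] produces them in this shape. *)
Lemma bounded_multiples (z : R[i]) (A : R) :
  (forall n : nat, normc (n%:R%:C * z + z) <= A) -> z = 0.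
Proof.
move=> H; apply: csq_eq0; rewrite -sqr_normc; apply/eqP; rewrite sqrf_eq0.
apply/negPn/negP => z0; have zp : 0 < normc z by rewrite lt_def z0 normc_ge0.
have := H (Num.truncn (A / normc z)).
have -> : (Num.truncn (A / normc z))%:R%:C * z + z = (Num.truncn (A / normc z)).+1%:R%:C * z.
  by rewrite -natr1 rmorphD/= mulrDl rmorph1 mul1r.
rewrite normcM normcC ger0_norm// -ler_pdivlMr// leNgt truncnS_gt//.
Qed.

(* The data of all multiples of (u, w) obey one and the same bound. *)
Lemma dirichlet_unique u w (n : nat) : solution (fun=> 0) u w ->
  u (- n.+1%:R) = 0 -> u n.+1%:R = 0 -> u 0 = 0 /\ w 0 = 0.
Proof.
move=> s u1 u2; have [A HA] := dirichlet_initial L2_0.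
have H (m : nat) : normc (m%:R%:C * u 0 + u 0) <= A /\ normc (m%:R%:C * w 0 + w 0) <= A.
  have := solution_lin m%:R%:C s s; under [X in solution X]eq_fun do rewrite mulr0 addr0.
  by move=> sm; apply: (HA _ _ n sm); rewrite ?u1 ?u2 mulr0 addr0.
by split; apply: (@bounded_multiples _ A) => m; have [] := H m.
Qed.

(** If the determinant vanished, psi (- N) phi - phi (- N) psi and psi N phi - phi N psi would
    vanish at both ends. Uniqueness then makes their coefficients 0, so phi itself vanishes at both
    ends, against phi 0 = 1. *)
Lemma fundamental_det phi phi' psi psi' (n : nat) :
  solution (fun=> 0) phi phi' -> solution (fun=> 0) psi psi' ->
  phi 0 = 1 -> phi' 0 = 0 -> psi 0 = 0 -> psi' 0 = 1 ->
  phi (- n.+1%:R) * psi n.+1%:R - phi n.+1%:R * psi (- n.+1%:R) != 0.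
Proof.
move=> s1 s2 p1 p2 p3 p4; set N := n.+1%:R; apply/eqP => D.
have S a b : a * phi (- N) + (b * psi (- N) + psi (- N)) = 0 ->
    a * phi N + (b * psi N + psi N) = 0 -> a = 0 /\ b + 1 = 0.
  move=> e1 e2.
  have s3 : solution (fun=> 0) (fun x => b * psi x + psi x) (fun x => b * psi' x + psi' x).
    by have := solution_lin b s2 s2; under [X in solution X]eq_fun do rewrite mulr0 addr0.
  have s4 : solution (fun=> 0) (fun x => a * phi x + (b * psi x + psi x))
      (fun x => a * phi' x + (b * psi' x + psi' x)).
    by have := solution_lin a s1 s3; under [X in solution X]eq_fun do rewrite mulr0 addr0.
  have [] := dirichlet_unique s4 e1 e2.
  by rewrite p1 p2 p3 p4 !mulr0 !mulr1 !addr0 add0r.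
(* The total coefficient of psi in [S] is b + 1, here - phi (- N). *)
have [c1 c2] : psi (- N) = 0 /\ - phi (- N) - 1 + 1 = 0.
  apply: S; first by ring.
  by apply: oppr_inj; rewrite oppr0 -[RHS]D; ring.
have [d1 d2] : psi N = 0 /\ - phi N - 1 + 1 = 0.
  by apply: S; [rewrite -[RHS]D; ring|ring].
have f1 : phi (- N) = 0 by apply: oppr_inj; rewrite oppr0 -[RHS]c2; ring.
have f2 : phi N = 0 by apply: oppr_inj; rewrite oppr0 -[RHS]d2; ring.
have [] := dirichlet_unique s1 f1 f2.
by rewrite p1 => /eqP; rewrite oner_eq0.
Qed.

(* Variation of parameters on [- n, n] gives Dirichlet solutions; their initial
   data at 0 are bounded, and any cluster point of these data yields a solution
   that is square integrable on the line. *)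
Lemma solution_L2_exists G : L2 G -> exists u w, solution G u w /\ L2 u.
Proof.
move=> Gl; have Gc := L2_clocint Gl; have zc : clocint (fun=> 0 : R[i]) := L2_clocint L2_0.
have [phi [phi' [p1 p2 s1]]] := solution_exists mQ Ql tl lam 1 0 zc.
have [psi [psi' [q1 q2 s2]]] := solution_exists mQ Ql tl lam 0 1 zc.
have [p [p' [r1 r2 s3]]] := solution_exists mQ Ql tl lam 0 0 Gc.
pose U a b x := a * phi x + (b * psi x + p x).
pose W a b x := a * phi' x + (b * psi' x + p' x).
have sU a b : solution G (U a b) (W a b).
  have s4 : solution G (fun x => b * psi x + p x) (fun x => b * psi' x + p' x).
    by have := solution_lin b s2 s3; under [X in solution X]eq_fun do rewrite mulr0 add0r.
  by have := solution_lin a s1 s4; under [X in solution X]eq_fun do rewrite mulr0 add0r.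
have /choice[ab Hab] (n : nat) : exists ab : R[i] * R[i],
    U ab.1 ab.2 (- n.+1%:R) = 0 /\ U ab.1 ab.2 n.+1%:R = 0.
  have D := fundamental_det n s1 s2 p1 p2 q1 q2; set N := n.+1%:R in D *.
  set E := _ - _ in D.
  (* Cramer's rule for the two boundary conditions. *)
  exists ((psi (- N) * p N - psi N * p (- N)) / E, (phi N * p (- N) - phi (- N) * p N) / E).
  by rewrite /U /=; split; rewrite /E in D *; field.
have [A HA] := dirichlet_initial Gl.
have H0 n : normc (ab n).1 <= A /\ normc (ab n).2 <= A.
  have [e1 e2] := Hab n; have := HA _ _ _ (sU _ _) e1 e2.
  by rewrite /U /W p1 p2 q1 q2 r1 r2 !mulr0 !mulr1 !addr0 add0r.
(* A subsequence for the first coefficient, then a further one for the second. *)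
have [s [a [incs sa]]] := bounded_ccvg_subseq (fun n => (H0 n).1).
have [t [b [inct tb]]] := bounded_ccvg_subseq (fun n => (H0 (s n)).2).
have {}sa : ccvg (fun n => (ab (s (t n))).1) a := ccvg_increasing inct sa.
exists (U a b), (W a b); split => //.
have cU := solution_cont (sU a b).
have c1 := solution_cont s1; have c2 := solution_cont s2.
apply/L2P; split; first exact: ccont_meas.
pose B := energy_bound M lam G.
(* 2 B comes from the Dirichlet solution close to the limit. The errors in the two coefficients
   contribute at most 4, because they are taken below 1 / (P1 + P2 + 1). *)
apply: (proj1 (@locint_exhaustion _ _ (2 * B + 4) (locint_cont_csq cU) (fun x => csq_ge0 _) _)) => N.
pose P1 := \int[mu]_(x in `[- N%:R, N%:R]) csq (phi x).
pose P2 := \int[mu]_(x in `[- N%:R, N%:R]) csq (psi x).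
have P10 : 0 <= P1 by apply: Rintegral_ge0 => x _; exact: csq_ge0.
have P20 : 0 <= P2 by apply: Rintegral_ge0 => x _; exact: csq_ge0.
have P3 : 0 < P1 + P2 + 1 by lra.
have e0 : 0 < (P1 + P2 + 1)^-1 by rewrite invr_gt0.
have [N1 HN1] := ccvg_csq_small sa e0; have [N2 HN2] := ccvg_csq_small tb e0.
(* The index also exceeds N, so that [[- N, N]] lies inside the interval of the Dirichlet
   problem. *)
pose m := maxn N (maxn N1 N2); pose n := s (t m).
have nN : (N <= n)%N.
  by apply: leq_trans (increasing_ge _ incs); apply: leq_trans (increasing_ge _ inct); exact: leq_maxl.
have m1 : (N1 <= m)%N by rewrite /m !leq_max leqnn !orbT.
have m2 : (N2 <= m)%N by rewrite /m !leq_max leqnn !orbT.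
have h1 : csq (a - (ab n).1) < (P1 + P2 + 1)^-1 := HN1 m m1.
have h2 : csq (b - (ab n).2) < (P1 + P2 + 1)^-1 := HN2 m m2.
have [e1 e2] := Hab n; have sn := sU (ab n).1 (ab n).2; have cn := solution_cont sn.
have Bn : \int[mu]_(x in `[- N%:R, N%:R]) csq (U (ab n).1 (ab n).2 x) <= B.
  have [g [k q]] := sn.
  apply: le_trans (proj1 (dirichlet_bound mQ Ql tl Vl M0 VM lamC Gl q e1 e2)).
  apply: Rint_subset => //; last by move=> x _; exact: csq_ge0.
    by apply: subset_itv; rewrite bnd_simp ?lerN2 ler_nat leqW.
  by apply: locint_mint; exact: locint_cont_csq.
have l1 := locint_cont_csq c1; have l2 := locint_cont_csq c2; have l3 := locint_cont_csq cn.
have l4 := locintD (locintZ (2 * (2 * csq (a - (ab n).1))) l1) (locintZ (2 * (2 * csq (b - (ab n).2))) l2).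
apply: (@le_trans _ _ (\int[mu]_(x in `[- N%:R, N%:R]) (2 * csq (U (ab n).1 (ab n).2 x) +
  (2 * (2 * csq (a - (ab n).1)) * csq (phi x) + 2 * (2 * csq (b - (ab n).2)) * csq (psi x))))).
  have i1 := locint_mint (- N%:R) N%:R (locint_cont_csq cU).
  have i2 := locint_mint (- N%:R) N%:R (locintD (locintZ 2 l3) l4).
  apply: le_Rintegral => // x _.
  have -> : U a b x = U (ab n).1 (ab n).2 x + ((a - (ab n).1) * phi x + (b - (ab n).2) * psi x).
    by rewrite /U; ring.
  apply: le_trans (csqD_le _ _) _; rewrite lerD2l.
  have := csqD_le ((a - (ab n).1) * phi x) ((b - (ab n).2) * psi x).
  rewrite !csqM; set A1 := csq _ * csq _; set A2 := csq _ * csq _.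
  by rewrite -!(mulrA 2) -/A1 -/A2; lra.
rewrite (RintegralD _ (locint_mint _ _ (locintZ 2 l3)) (locint_mint _ _ l4))//.
rewrite (RintegralD _ (locint_mint _ _ (locintZ _ l1)) (locint_mint _ _ (locintZ _ l2)))//.
rewrite (RintegralZl _ _ (locint_mint _ _ l1))// (RintegralZl _ _ (locint_mint _ _ l2))//.
rewrite (RintegralZl _ _ (locint_mint _ _ l3))// -/P1 -/P2.
apply: lerD; first by rewrite ler_wpM2l.
have k1 : csq (a - (ab n).1) * P1 <= (P1 + P2 + 1)^-1 * P1 by rewrite ler_wpM2r// ltW.
have k2 : csq (b - (ab n).2) * P2 <= (P1 + P2 + 1)^-1 * P2 by rewrite ler_wpM2r// ltW.
have k3 : (P1 + P2 + 1)^-1 * P1 + (P1 + P2 + 1)^-1 * P2 <= 1.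
  by rewrite -mulrDr mulrC ler_pdivrMr//; lra.
rewrite -!(mulrA 2).
move: k1 k2 k3; move: (csq _ * P1) (csq _ * P2) (_^-1 * P1) (_^-1 * P2) => A1 A2 A3 A4; lra.
Qed.

End Onto.

Section SmaxOnto.
Context {R : realType}.
Local Notation mu := (@lebesgue_measure R).
Variables (Q tau : R -> R[i]) (M : R).
Hypotheses (mQ : cmeasurable Q) (Ql : locint (fun x => csq (Q x))) (tl : clocint tau).
Hypotheses (Vl : locint (potential Q tau)) (M0 : 0 <= M).
Hypothesis VM : forall s, \int[mu]_(x in `[s, s + 1]) potential Q tau x <= M.

Lemma Smax_onto : resolvent_onto (2 * stepanov_cst M) (Smax Q tau).
Proof.
move=> z zK G Gl; have C0 := stepanov_cst_ge0 M0.
have zC : stepanov_cst M < Re z by lra.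
have [u [w [[g [k q]] ul]]] := solution_L2_exists mQ Ql tl Vl M0 VM zC Gl.
exists u; exists (fun x => G x - z * u x).
  apply/SmaxP; split => //; first by apply: L2B => //; exact: L2Z.
  by exists u, g, w, k; split => //; exact: aeeq_refl.
by split => //; apply: aeW => x /=; rewrite subrK.
Qed.

End SmaxOnto.

(** * Compactly supported functions as a core *)

Section Core.
Context {R : realType}.
Local Notation mu := (@lebesgue_measure R).
Implicit Types (f g u v y : R -> R[i]) (p : R -> R).

Lemma L2_mulC p (c : R) f : continuous p -> (forall x, `|p x| <= c) -> L2 f ->
  L2 (fun x => (p x)%:C * f x).
Proof.
move=> cp pc fl; apply: (@L2_le _ _ (fun x => c ^+ 2 * csq (f x))).
- apply: cmeasM; last exact: L2_meas.
  by apply: ccont_meas; exact: ccontC.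
- by apply: mintZ => //; exact: L2_int.
- move=> x; rewrite csqM csqC ler_wpM2r ?csq_ge0// -real_normK ?num_real//.
  by apply: lerXn2r; rewrite ?nnegrE// (le_trans (normr_ge0 _) (pc x)).
Qed.

Lemma nrm2_dct (us : nat -> R -> R[i]) u (G : R -> R) : (forall n, L2 (us n)) -> L2 u ->
  mu.-integrable setT (EFin \o G) -> (forall n x, csq (us n x - u x) <= G x) ->
  (forall x, csq (us n x - u x) @[n --> \oo] --> (0 : R)) -> cvgL2 us u.
Proof.
move=> usl ul Gi le H; apply/cvgL2P => //.
rewrite -[X in _ --> X](Rintegral0 setT).
apply: (@Rint_dct _ _ _ _ G _ _ _ _ _ _).2 => //.
- by move=> n; apply: meas_csq; apply: cmeasB; exact: L2_meas.
- by move=> n x _; rewrite ger0_norm ?csq_ge0.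
Qed.

Variables (Q tau : R -> R[i]) (M : R).
Hypotheses (mQ : cmeasurable Q) (Ql : locint (fun x => csq (Q x))) (tl : clocint tau).
Hypotheses (Vl : locint (potential Q tau)) (M0 : 0 <= M).
Hypothesis VM : forall s, \int[mu]_(x in `[s, s + 1]) potential Q tau x <= M.

(** For truncations chi u, the image differs from chi l[u] by 2 chi' u' and chi'' u. Both tend to 0
    in L^2, since u' is in L^2 by [quasi_L2] and the derivatives of chi are O(1 / (n + 1)). *)
Lemma S00_core : graph_core (S00 Q tau) (Smax Q tau).
Proof.
move=> y f /SmaxP[yl fl [u [g [w [k [yu q]]]]]].
have [ug wk wE kE] := q.
have ul := L2_aeeq (cprim_meas ug) yu yl.
have gl := quasi_L2 mQ Ql tl Vl M0 VM q ul fl.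
have [chi [chi1 [chi2 [c [d [c0 d0 Hr Hb [H0 H1 H2 Hl]]]]]]] := @cutoff_sequence R.
have e1 n : c / n.+1%:R <= c by rewrite ler_pdivrMr// ler_peMr// ler1n.
have b0 n x : `|chi n x| <= c by have [] := Hb n x.
have b1 n x : `|chi1 n x| <= c by have [_ e _] := Hb n x; exact: le_trans e (e1 n).
have b2 n x : `|chi2 n x| <= c by have [_ _ e] := Hb n x; exact: le_trans e (e1 n).
have Hcc (r : R) : `|r| <= c -> r ^+ 2 <= c ^+ 2.
  by move=> e; rewrite -real_normK ?num_real//; apply: lerXn2r; rewrite ?nnegrE.
have Hz (a : nat -> R) : (forall n, `|a n| <= c / n.+1%:R) -> a @ \oo --> (0 : R).
  move=> H; apply: norm_cvg0; apply: (@squeeze_cvgr _ _ _ _ (fun=> 0) (fun n => c / n.+1%:R)).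
  - by apply: nearW => n; rewrite normr_ge0 H.
  - exact: cvg_cst.
  - by rewrite -[X in _ --> X](mulr0 c); apply: cvgM; [exact: cvg_cst|exact: cvg_harmonic].
pose fn n x := (chi n x)%:C * f x - 2 * (chi1 n x)%:C * g x - (chi2 n x)%:C * u x.
have ynl n : L2 (fun x => (chi n x)%:C * y x) by have [_ _ cc _ _] := Hr n; exact: L2_mulC cc (b0 n) yl.
have fnl n : L2 (fn n).
  have [_ _ cc cc1 cc2] := Hr n; apply: L2B; last exact: L2_mulC cc2 (b2 n) ul.
  apply: L2B; first exact: L2_mulC cc (b0 n) fl.
  by have := L2Z 2 (L2_mulC cc1 (b1 n) gl); under eq_fun do rewrite mulrA.
exists (fun n x => (chi n x)%:C * y x), fn; split.
- move=> n; split.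
    apply/SmaxP; split => //; have [r1 r2 cc cc1 cc2] := Hr n.
    do 4 eexists; split; last exact: (quasi_cutoff r1 r2 cc cc1 q (L2_clocint fl)).
    by apply: ae_imp yu => x ->.
  exists `[- n.+1%:R, n.+1%:R]%classic; first exact: segment_compact.
  apply: aeW => x /= /negP; rewrite in_itv/= -ler_norml -ltNge => xn.
  by rewrite H0 ?mul0r// ltW.
- apply: (@nrm2_dct _ _ (fun x => (2 * c ^+ 2 + 2) * csq (y x))) => //.
  + by apply: mintZ => //; exact: L2_int.
  + move=> n x; have e := csqB_le ((chi n x)%:C * y x) (y x).
    rewrite csqM csqC in e; apply: le_trans e _; rewrite [leRHS]mulrDl.
    by apply: lerD => //; rewrite -[leRHS]mulrA; apply: ler_wpM2l => //; rewrite ler_wpM2r ?csq_ge0// Hcc.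
  + move=> x; have H : ((chi n x - 1) * (chi n x - 1) * csq (y x)) @[n --> \oo] --> ((1 - 1) * (1 - 1) * csq (y x)).
      by apply: cvgM; [apply: cvgM; apply: cvgB; [exact: Hl|exact: cvg_cst|exact: Hl|exact: cvg_cst]|exact: cvg_cst].
    rewrite subrr mul0r mul0r in H.
    have -> // : (fun n => csq ((chi n x)%:C * y x - y x)) = (fun n => (chi n x - 1) * (chi n x - 1) * csq (y x)).
    apply/funext => n; rewrite -expr2 -csqC -csqM rmorphB/=.
    by congr csq; rewrite mulrBl rmorph1 mul1r.
(* The weights 4, 4, 2 are those of [csqD3], the inner 4 is the squared modulus of the factor 2 in
   the commutator, and (chi - 1)^2 <= 2 c^2 + 2. *)
- pose G x := 4 * ((2 * c ^+ 2 + 2) * csq (f x)) + (4 * (4 * (c ^+ 2 * csq (g x))) + 2 * (c ^+ 2 * csq (u x))).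
  have c2 : csq (2 : R[i]) = 4.
    by rewrite (_ : 2 = (2 : R)%:C) ?csqC; [ring|rewrite rmorphD/= rmorph1].
  have E n x : fn n x - f x = (chi n x - 1)%:C * f x + - (2 * (chi1 n x)%:C * g x) + - ((chi2 n x)%:C * u x).
    by rewrite /fn rmorphB/= rmorph1; ring.
  have E2 n x : csq (fn n x - f x) <= 4 * ((chi n x - 1) ^+ 2 * csq (f x)) +
      (4 * (4 * (chi1 n x ^+ 2 * csq (g x))) + 2 * (chi2 n x ^+ 2 * csq (u x))).
    rewrite E (le_trans (csqD3 _ _ _))// !csqN !csqM !csqC c2.
    by rewrite -!addrA -!mulrA.
  apply: (@nrm2_dct _ _ G) => //.
  + apply: mintD => //; first by do 2! apply: mintZ => //; exact: L2_int.
    by apply: mintD => //; [do 3! apply: mintZ => //|do 2! apply: mintZ => //]; exact: L2_int.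
  + move=> n x; apply: le_trans (E2 n x) _; rewrite /G.
    apply: lerD; first (apply: ler_wpM2l => //; apply: ler_wpM2r; first exact: csq_ge0).
      by have := Hcc _ (b0 n x); have := sqr_ge0 (chi n x + 1); nra.
    apply: lerD; first (do 2! apply: ler_wpM2l => //; apply: ler_wpM2r; [exact: csq_ge0|exact: Hcc]).
    by apply: ler_wpM2l => //; apply: ler_wpM2r; [exact: csq_ge0|exact: Hcc].
  + move=> x; apply: (@squeeze_cvgr _ _ _ _ (fun=> 0) (fun n => 4 * ((chi n x - 1) ^+ 2 * csq (f x)) +
      (4 * (4 * (chi1 n x ^+ 2 * csq (g x))) + 2 * (chi2 n x ^+ 2 * csq (u x))))).
    * by apply: nearW => n; rewrite csq_ge0 E2.
    * exact: cvg_cst.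
    have z1 : (chi n x - 1) ^+ 2 @[n --> \oo] --> (0 : R).
      have H : ((chi n x - 1) * (chi n x - 1)) @[n --> \oo] --> ((1 - 1) * (1 - 1) : R).
        by apply: cvgM; apply: cvgB; [exact: Hl|exact: cvg_cst|exact: Hl|exact: cvg_cst].
      by rewrite subrr mul0r in H; under eq_fun do rewrite expr2.
    have zz (a : nat -> R) : (forall n, `|a n| <= c / n.+1%:R) -> (a n ^+ 2) @[n --> \oo] --> (0 : R).
      move=> /Hz ha; have H : (a n * a n) @[n --> \oo] --> (0 * 0 : R) by exact: cvgM.
      by rewrite mul0r in H; under eq_fun do rewrite expr2.
    have z2 : (chi1 n x ^+ 2) @[n --> \oo] --> (0 : R) by apply: zz => n; have [] := Hb n x.
    have z3 : (chi2 n x ^+ 2) @[n --> \oo] --> (0 : R) by apply: zz => n; have [] := Hb n x.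
    have e : (0 : R) = 4 * (0 * csq (f x)) + (4 * (4 * (0 * csq (g x))) + 2 * (0 * csq (u x))) by ring.
    rewrite [X in _ --> X]e; apply: cvgD; last apply: cvgD.
    * by apply: cvgM; [exact: cvg_cst|apply: cvgM => //; exact: cvg_cst].
    * apply: cvgM; [exact: cvg_cst|apply: cvgM; [exact: cvg_cst|]].
      by apply: cvgM => //; exact: cvg_cst.
    * by apply: cvgM; [exact: cvg_cst|apply: cvgM => //; exact: cvg_cst].
Qed.

Lemma S00_linear : linear_graph (S00 Q tau).
Proof.
have [TL _ T0 Tlin _] := Smax_operator Q tau; split.
- by move=> u f [uf _]; exact: TL.
- split => //; exists set0; first exact: compact0.
  exact: aeW.
- move=> a u v f g [uf [K1 cK1 h1]] [vg [K2 cK2 h2]]; split; first exact: Tlin.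
  exists (K1 `|` K2); first exact: compactU.
  apply: ae_imp2 h1 h2 => x e1 e2 /= nK.
  have {}e1 : ~ K1 x -> u x = 0 := e1; have {}e2 : ~ K2 x -> v x = 0 := e2.
  by rewrite e1 ?e2 ?mulr0 ?addr0// => h; apply: nK; [right|left].
Qed.

End Core.

Theorem theoremA (R : realType) (q : @schwartz_distribution R) (hq : Hm1_unif q)
    (Q tau : R -> R[i]%C) (hQtau : Hm1_representation q Q tau) :
  [/\ m_sectorial (Smin Q tau), m_sectorial (Smax Q tau),
      m_sectorial (Sfs Q tau) & m_sectorial (SF Q tau)] /\
  [/\ Smin Q tau = Smax Q tau, Smax Q tau = Sfs Q tau & Sfs Q tau = SF Q tau].
Proof.
have [hQ ht _] := hQtau.
have mQ : cmeasurable Q by have [[]] := hQ.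
have mt : cmeasurable tau by have [[]] := ht.
have [Ql [M1 M10 HM1]] := Lp_unif2 hQ; have [tl [M2 M20 HM2]] := Lp_unif1 ht.
have tc : clocint tau by exact: clocint_le mt tl (fun x => lexx _).
(* The uniform bound for the potential 4 |Q|^2 + |tau| on unit intervals. *)
pose M := 4 * M1 + M2; have M0 : 0 <= M by rewrite addr_ge0// mulr_ge0.
have Vl : locint (potential Q tau) by apply: locintD => //; exact: locintZ.
have VM s : \int[@lebesgue_measure R]_(x in `[s, s + 1]) potential Q tau x <= M.
  rewrite (RintegralD _ (locint_mint _ _ (locintZ 4 Ql)) (locint_mint _ _ tl))//.
  by rewrite (RintegralZl _ _ (locint_mint _ _ Ql))// lerD// ler_wpM2l.
have op := Smax_operator Q tau.
have fs := Smax_Sfs mQ Ql tc Vl M0 VM.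
have sfs := Sfs_sectorial mQ tc Vl M0 VM.
have smax : sectorial (2 * stepanov_cst M) (Smax Q tau) by move=> u f /fs; exact: sfs.
have onto := Smax_onto mQ Ql tc Vl M0 VM.
have core := S00_core mQ Ql tc Vl M0 VM.
have sub p : S00 Q tau p -> Smax Q tau p by case.
have E1 : Smin Q tau = Smax Q tau by exact: op_closure_core op smax onto sub core.
have E2 : Smax Q tau = Sfs Q tau.
  exact: operator_maximal op onto (Sfs_linear mQ tc Vl M0 VM) sfs fs.
have E3 : SF Q tau = Smax Q tau.
  rewrite /SF; exact: friedrichs_closure op smax onto sub core (S00_linear Q tau).
(* Operators are graphs and the four graphs are equal, so m-sectoriality of one of them is that of
   all. *)
have ms := m_sectorial_criterion op smax onto.
by rewrite E3 E1 -E2.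
Qed.
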